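(* Let $f$ be locally integrable on $[0,T)\times\mathbf{R}^d$ and let $p\in[1,\infty]$. Assume that $a^{ij}(t)\xi^i\xi^j\ge 0$ for all $t\in(0,T)$ and $\xi\in\mathbf{R}^d$, and that $$\int_s^t\Big(\max_{i,j}|a^{ij}(r)|+\max_i|b^i(r)|+|c(r)|\Big)\,\mathrm{d}r<\infty\quad\text{for all }0<s<t<T.$$ Assume further: (i) $\int_s^t \mathrm{e}^{\int_s^r c(\rho)\mathrm{d}\rho}\max_{i,j}|a^{ij}(r)|\,\mathrm{d}r<\infty$ for all $0<s<t<T$; (ii) $\int_0^t \mathrm{e}^{\int_s^t|c(r)|\mathrm{d}r}\|f(s,\cdot)\|_{L_p(\mathbf{R}^d)}\,\mathrm{d}s<\infty$ for all $t\in(0,T)$; (iii) $\int_0^{T'}\mu_{a,b,c}(t)\int_0^t \mathrm{e}^{\int_s^t c(r)\mathrm{d}r}\|f(s,\cdot)\|_{L_p(\mathbf{R}^d)}\,\mathrm{d}s\,\mathrm{d}t<\infty$ for all $T'\in(0,T)$. Then there exists a weak solution $u$ to the Cauchy problem (CP) such that for every $t\in(0,T)$ $$\|u(t,\cdot)\|_{L_p(\mathbf{R}^d)}\le\int_0^t \mathrm{e}^{\int_s^t c(r)\mathrm{d}r}\|f(s,\cdot)\|_{L_p(\mathbf{R}^d)}\,\mathrm{d}s$$ and $$\int_0^t\mu_{a,b,c}(s)\|u(s,\cdot)\|_{L_p(\mathbf{R}^d)}\,\mathrm{d}s\le\int_0^t\mu_{a,b,c}(s)\int_0^s \mathrm{e}^{\int_r^s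 c(\rho)\mathrm{d}\rho}\|f(r,\cdot)\|_{L_p(\mathbf{R}^d)}\,\mathrm{d}r\,\mathrm{d}s.$$
   Context: Fix $d\in\mathbf{N}$ and $T\in(0,\infty)$. The coefficients $a^{ij},b^i,c$ ($i,j=1,\dots,d$) are real-valued Lebesgue measurable functions on $(0,T)$. Repeated indices are summed over $1,\dots,d$. Put $\mu_{a,b,c}(t)=\max_{i,j}|a^{ij}(t)|+\max_i|b^i(t)|+|c(t)|$. The Cauchy problem (CP) is $$u_t(t,x)=a^{ij}(t)u_{x^ix^j}(t,x)+b^i(t)u_{x^i}(t,x)+c(t)u(t,x)+f(t,x),\quad u(0,x)=0,\quad (t,x)\in(0,T)\times\mathbf{R}^d.$$ A real-valued measurable function $f$ defined a.e. on $[0,T)\times\mathbf{R}^d$ is locally integrable on $[0,T)\times\mathbf{R}^d$ if $\int_0^t\int_{|x|<r}|f(s,x)|\,\mathrm{d}x\,\mathrm{d}s<\infty$ for all $t\in(0,T)$, $r>0$. Weak solution: for $u,f$ locally integrable on $[0,T)\times\mathbf{R}^d$, $u$ is a weak solution to (CP) (with data $f$) if for every $\varphi\in C_c^\infty(\mathbf{R}^d)$ and all $t\in(0,T)$, $$(u(t,\cdot),\varphi)=\int_0^t\big(u(s,\cdot),a^{ij}(s)\varphi_{x^ix^j}-b^i(s)\varphi_{x^i}+c(s)\varphi\big)\,\mathrm{d}s+\int_0^t(f(s,\cdot),\varphi)\,\mathrm{d}s,$$ where $(g,\varphi)=\int_{\mathbf{R}^d}g(x)\varphi(x)\,\mathrm{d}x$.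 *)

(* Defs.v *)
From HB Require Import structures.
From mathcomp Require Import all_boot all_order all_algebra.
From mathcomp Require Import all_classical all_reals all_analysis.
From mathcomp Require Import measurable_realfun.

Set Implicit Arguments.
Unset Strict Implicit.
Unset Printing Implicit Defensive.

Import Order.TTheory GRing.Theory Num.Theory.
Import numFieldNormedType.Exports.

Local Open Scope classical_set_scope.
Local Open Scope ring_scope.

Definition measure_rV_display : measure_display -> measure_display.
Proof. exact. Qed.

(* Row vectors carry the sigma-algebra generated by their coordinates, so that
   'rV[R]_n has its Borel sigma-algebra. *)
Section measurable_rV.
Context {d} {T : measurableType d}.
Variable n : nat.

Let coors : 'I_n -> 'rV[T]_n -> T := fun i x => x ord0 i.

Let rV_set0 : g_sigma_preimage coors set0.
Proof. exact: sigma_algebra0. Qed.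

Let rV_setC A : g_sigma_preimage coors A -> g_sigma_preimage coors (~` A).
Proof. exact: sigma_algebraC. Qed.

Let rV_bigcup (F : _^nat) : (forall i, g_sigma_preimage coors (F i)) ->
  g_sigma_preimage coors (\bigcup_i (F i)).
Proof. exact: sigma_algebra_bigcup. Qed.

HB.instance Definition _ := @isMeasurable.Build (measure_rV_display d)
  'rV[T]_n (g_sigma_preimage coors) rV_set0 rV_setC rV_bigcup.

End measurable_rV.

Lemma measurable_coord d (T : measurableType d) n (i : 'I_n) :
  measurable_fun [set: 'rV[T]_n] (fun x : 'rV[T]_n => x ord0 i).
Proof.
move=> _ Y mY; rewrite setTI; apply: sub_sigma_algebra => /=.
rewrite -bigcup_seq/=; exists i => /=; first by rewrite mem_index_enum.
by exists Y => //; rewrite setTI.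
Qed.

Lemma measurable_fun_rVP d1 d2 (T1 : measurableType d1)
    (T2 : measurableType d2) n (f : T1 -> 'rV[T2]_n) :
  measurable_fun [set: T1] f <->
  forall i, measurable_fun [set: T1] (fun x => f x ord0 i).
Proof.
split=> [mf i|mf].
  exact: (measurableT_comp (@measurable_coord _ _ _ i) mf).
move=> _ Y mY; rewrite setTI.
suff sub : (measurable : set (set 'rV[T2]_n)) `<=`
           [set Z | measurable (f @^-1` Z)] by exact: sub.
apply: smallest_sub => /=.
  split => [|A|F mF] /=; first by rewrite preimage_set0.
    by rewrite setTD preimage_setC => /measurableC.
  by rewrite preimage_bigcup; exact: bigcupT_measurable.
rewrite -bigcup_seq/= => A [i _ [B mB <-]] /=.
by rewrite setTI -[X in measurable X]setTI; exact: mf.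
Qed.

Section lebesgue_rV.
Context {R : realType}.

Definition cons_rV n (z : measurableTypeR R * 'rV[R]_n) : 'rV[R]_n.+1 :=
  row_mx z.1%:M z.2.

Lemma cons_rV0 n (z : measurableTypeR R * 'rV[R]_n) :
  cons_rV z ord0 ord0 = z.1.
Proof.
have -> : ord0 = lshift n (ord0 : 'I_1) :> 'I_(1 + n) by exact/val_inj.
by rewrite [LHS]row_mxEl mxE eqxx.
Qed.

Lemma cons_rVS n (z : measurableTypeR R * 'rV[R]_n) (i : 'I_n) :
  cons_rV z ord0 (lift ord0 i) = z.2 ord0 i.
Proof.
have -> : lift ord0 i = rshift 1 i :> 'I_(1 + n) by exact/val_inj.
by rewrite [LHS]row_mxEr.
Qed.

Lemma measurable_cons_rV n : measurable_fun setT (@cons_rV n).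
Proof.
apply/measurable_fun_rVP => i; case: (unliftP ord0 i) => [j|] ->.
  under eq_fun do rewrite cons_rVS.
  exact: (measurableT_comp (@measurable_coord _ _ _ j) measurable_snd).
by under eq_fun do rewrite cons_rV0; exact: measurable_fst.
Qed.

Definition uncons_rV n (x : 'rV[R]_n.+1) : measurableTypeR R * 'rV[R]_n :=
  (x ord0 ord0, \row_i x ord0 (lift ord0 i)).

Lemma measurable_uncons_rV n : measurable_fun setT (@uncons_rV n).
Proof.
apply/measurable_fun_pairP; split; first exact: measurable_coord.
apply/measurable_fun_rVP => i /=; rewrite /comp/=.
by under eq_fun do rewrite mxE; exact: measurable_coord.
Qed.

Lemma cons_rVK n : cancel (@cons_rV n) (@uncons_rV n).
Proof.
move=> z; rewrite [RHS]surjective_pairing /uncons_rV cons_rV0; congr pair.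
by apply/rowP => i; rewrite mxE cons_rVS.
Qed.

Lemma uncons_rVK n : cancel (@uncons_rV n) (@cons_rV n).
Proof.
move=> x; apply/rowP => i; case: (unliftP ord0 i) => [j|] ->.
  by rewrite cons_rVS mxE.
by rewrite cons_rV0.
Qed.

Section step.
Variables (n : nat) (mu : {sigma_finite_measure set 'rV[R]_n -> \bar R}).

Definition lebesgue_rV_step : set 'rV[R]_n.+1 -> \bar R :=
  pushforward (lebesgue_measure \x mu)%E (@cons_rV n).

Let step0 : lebesgue_rV_step set0 = 0%E.
Proof. by rewrite /lebesgue_rV_step /pushforward preimage_set0 measure0. Qed.

Let step_ge0 A : (0 <= lebesgue_rV_step A)%E.
Proof. by rewrite /lebesgue_rV_step /pushforward measure_ge0. Qed.

Let step_sigma_additive : semi_sigma_additive lebesgue_rV_step.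
Proof.
move=> F mF tF mUF; rewrite /lebesgue_rV_step /pushforward preimage_bigcup.
have mpre A : measurable A -> measurable (@cons_rV n @^-1` A).
  by move=> mA; rewrite -[X in measurable X]setTI; exact: measurable_cons_rV.
apply: measure_semi_sigma_additive => [k||].
- exact: mpre.
- apply/trivIsetP => i j _ _ ij; rewrite -preimage_setI.
  by move/trivIsetP : tF => -> //; rewrite preimage_set0.
- by rewrite -preimage_bigcup; exact: mpre.
Qed.

HB.instance Definition _ := isMeasure.Build _ _ _ lebesgue_rV_step
  step0 step_ge0 step_sigma_additive.

Let step_sigma_finite : sigma_finite setT lebesgue_rV_step.
Proof.
have /sigma_finiteP[F [TF ndF Foo]] := sigma_finiteT (@lebesgue_measure R).
have /sigma_finiteP[G [TG ndG Goo]] := sigma_finiteT mu.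
exists (fun k => @uncons_rV n @^-1` (F k `*` G k)) => [|k].
  rewrite -preimage_bigcup -[LHS](preimage_setT (@uncons_rV n)); congr preimage.
  apply/seteqP; split=> // -[x y] _.
  have [i _ Fx] : (\bigcup_i F i) x by rewrite -TF.
  have [j _ Gy] : (\bigcup_i G i) y by rewrite -TG.
  exists (maxn i j) => //; split => /=.
    by move: x Fx; exact/subsetPset/ndF/leq_maxl.
  by move: y Gy; exact/subsetPset/ndG/leq_maxr.
have [[mF Fk] [mG Gk]] := (Foo k, Goo k); split.
  by rewrite -[X in measurable X]setTI; apply: measurable_uncons_rV => //;
    exact: measurableX.
rewrite /lebesgue_rV_step /pushforward -comp_preimage.
rewrite (_ : _ \o _ = id) ?preimage_id; last first.
  by apply/funext => z; exact: cons_rVK.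
by rewrite product_measure1E// lte_mul_pinfty// ge0_fin_numE.
Qed.

HB.instance Definition _ := Measure_isSigmaFinite.Build _ _ _ lebesgue_rV_step
  step_sigma_finite.

End step.

(* Lebesgue measure on R^n: the product measure of n copies of the
   one-dimensional Lebesgue measure, transported to row vectors (and the unit
   mass on the one-point space R^0). *)
Fixpoint lebesgue_rV n : {sigma_finite_measure set 'rV[R]_n -> \bar R} :=
  match n with
  | 0 => @dirac _ 'rV[R]_0 (0 : 'rV[R]_0) R
  | n'.+1 => lebesgue_rV_step (lebesgue_rV n')
  end.

Lemma lebesgue_rV_box n (A : 'I_n -> set (measurableTypeR R)) :
  (forall i, measurable (A i)) ->
  lebesgue_rV n [set x | forall i, A i (x ord0 i)] =
  (\prod_(i < n) lebesgue_measure (A i))%E.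
Proof.
elim: n A => [|n IH] A mA /=.
  by rewrite big_ord0 diracE mem_set// => -[].
have mAS i : measurable (A (lift ord0 i)) by exact: mA.
set B := [set x : 'rV[R]_n | forall i, A (lift ord0 i) (x ord0 i)].
have mB : measurable B.
  have -> : B = \bigcap_(i in [set: 'I_n])
      ((fun x : 'rV[R]_n => x ord0 i) @^-1` A (lift ord0 i)).
    by apply/seteqP; split => x /= Bx i; [move=> _|]; exact: Bx.
  apply: fin_bigcap_measurable => // i _.
  rewrite -[X in measurable X]setTI.
  exact: (@measurable_coord _ (measurableTypeR R) n i measurableT _ (mAS i)).
have pre : @cons_rV n @^-1` [set x | forall i, A i (x ord0 i)] = A ord0 `*` B.
  apply/seteqP; split => z /=.
    move=> Az; split=> [|i]; first by rewrite -[z.1]cons_rV0; exact: Az.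
    by rewrite -cons_rVS; exact: Az.
  move=> [A0 AS] i; case: (unliftP ord0 i) => [j|] ->.
    by rewrite cons_rVS; exact: AS.
  by rewrite cons_rV0.
rewrite /lebesgue_rV_step /pushforward pre product_measure1E//.
by rewrite (IH _ mAS) big_ord_recl.
Qed.

End lebesgue_rV.

(* The integrals \int, the norms 'N[mu]_p[_] and negligibility are taken with
   respect to Borel measures; they agree with those of the completed measures,
   because \int of a nonnegative function is a supremum over simple functions
   below it, and every Lebesgue measurable function equals a Borel one off a
   Borel null set. Only measurability itself has to refer to the completion. *)
Section lebesgue_measurability.
Context d (T : measurableType d) (R : realType).
Variable mu : {measure set T -> \bar R}.

Definition lebesgue_measurable_fun (D : set T) (g : T -> R) : Prop :=
  forall B : set R, measurable B -> completed_algebra_gen mu (D `&` g @^-1` B).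

Definition lebesgue_integrable (D : set T) (g : T -> R) : Prop :=
  lebesgue_measurable_fun D g /\ (\int[mu]_(x in D) `|g x|%:E < +oo)%E.

End lebesgue_measurability.

Section test_functions.
Context {R : realType} {d : nat}.
Implicit Types (phi : 'rV[R]_d -> R) (i : 'I_d).

Definition partial i phi : 'rV[R]_d -> R :=
  fun x => 'D_(delta_mx ord0 i) phi x.

Definition partials (l : seq 'I_d) phi : 'rV[R]_d -> R := foldr partial phi l.

Definition smooth phi : Prop := forall l : seq 'I_d,
  continuous (partials l phi) /\
  forall i x, derivable (partials l phi) x (delta_mx ord0 i).

Definition test_function phi : Prop :=
  smooth phi /\ compact (closure [set x | phi x != 0]).

End test_functions.

Section cauchy_problem.
Context {R : realType} {d : nat}.
Implicit Types (a : 'I_d -> 'I_d -> R -> R) (b : 'I_d -> R -> R) (c : R -> R).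
Implicit Types (f u : R -> 'rV[R]_d -> R) (phi : 'rV[R]_d -> R) (T t s : R).

(* The norm `|x| of 'rV[R]_d is the maximum norm. *)
Definition enorm (x : 'rV[R]_d) : R := Num.sqrt (\sum_i x ord0 i ^+ 2).

Definition eball (r : R) : set 'rV[R]_d := [set x | enorm x < r].

Definition locally_integrable_cyl T f : Prop :=
  lebesgue_measurable_fun (lebesgue_measure \x lebesgue_rV d)%E
    (`[0, T[ `*` setT) (fun z => f z.1 z.2) /\
  forall t r : R, 0 < t < T -> 0 < r ->
    (\int[lebesgue_measure]_(s in `]0%R, t[)
       \int[lebesgue_rV d]_(x in eball r) `|f s x|%:E < +oo)%E.

Definition pairing (g phi : 'rV[R]_d -> R) : R :=
  \int[lebesgue_rV d]_x (g x * phi x).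

Definition max_a a t : R := \big[Num.max/0]_(i < d) \big[Num.max/0]_(j < d) `|a i j t|.

Definition mu_abc a b c t : R :=
  max_a a t + \big[Num.max/0]_(i < d) `|b i t| + `|c t|.

Definition adjoint a b c s phi : 'rV[R]_d -> R := fun x =>
  \sum_(i < d) \sum_(j < d) a i j s * partials [:: j; i] phi x
  - \sum_(i < d) b i s * partial i phi x + c s * phi x.

(* The two integrability clauses say that (u(t,.), phi) and the time integral
   containing u exist, so that the identity is not about default values. The
   analogous fact for f follows from local integrability. *)
Definition weak_solution T a b c f u : Prop :=
  [/\ locally_integrable_cyl T u, locally_integrable_cyl T f &
  forall phi, test_function phi -> forall t, 0 < t < T ->
  [/\ lebesgue_integrable (lebesgue_rV d) setT (fun x => u t x * phi x),
      lebesgue_integrable lebesgue_measure `]0, t[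
        (fun s => pairing (u s) (adjoint a b c s phi)) &
      pairing (u t) phi =
        \int[lebesgue_measure]_(s in `]0, t[)
          pairing (u s) (adjoint a b c s phi) +
        \int[lebesgue_measure]_(s in `]0, t[) pairing (f s) phi]].

Definition Lp_norm (p : \bar R) (g : 'rV[R]_d -> R) : \bar R :=
  'N[lebesgue_rV d]_p[EFin \o g].

Definition exp_int c s t : R :=
  expR (\int[lebesgue_measure]_(r in `]s, t[) c r).

End cauchy_problem.

(* Main.v *)
(* Because the coefficients do not depend on x, the solution is explicit.  With
   A, B, C the integrals of the symmetrized (a_ij), of b and of c over ]s, t[,
     u(t, x) = \int_0^t e^C E f(s, x + B - sum_k Y_k v_k) ds,
   where Y is a standard Gaussian vector and the v_k form a Cholesky factor of a
   multiple of A, which may be degenerate.  Minkowski's integral inequality and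
   translation invariance give the two norm estimates.

   The adjoint P_{s,t} of f(s, .) |-> e^C E f(s, . + B - sum_k Y_k v_k) acts on test
   functions, and the point is the integral equation
     P_{s,t} phi = phi + \int_s^t P_{s,r} (L_r^* phi) dr.
   Rotation invariance of the Gaussian measure shows that an average over Gaussian
   combinations of directions depends only on their Gram matrix, so P composes as a
   semigroup.  A Taylor expansion bounds the error of one step of P by a power 3/2 of
   the increment of the integral of mu_{a,b,c}; a function whose increments are that
   small is constant, which is the integral equation.  Testing u(t, .) against phi and
   exchanging integrals, which the third integrability hypothesis permits, then gives
   the weak formulation.

   Coefficients and source are first replaced by Borel functions equal to them almost
   everywhere; since \int ignores null sets even for nonmeasurable functions, hypotheses
   and conclusions are unaffected. *)
Require Import Defs.
From HB Require Import structures.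
From mathcomp Require Import all_boot all_order all_algebra.
From mathcomp Require Import all_classical all_reals all_analysis.
From mathcomp Require Import measurable_realfun ess_sup_inf ring lra.

Set Implicit Arguments.
Unset Strict Implicit.
Unset Printing Implicit Defensive.

Import Order.TTheory GRing.Theory Num.Theory.
Import numFieldNormedType.Exports.

Local Open Scope classical_set_scope.
Local Open Scope ring_scope.

(** * Integrals of arbitrary functions *)

(** Two obstacles shape the proof. The diffusion matrix may be singular, so there is no heat kernel
    to differentiate: regularity is taken from the test function alone, and the evolution is an
    iterated average along [d] directions, some possibly zero. The coefficients are only integrable
    in time, and only away from time 0, so the evolution need not have a time derivative at a given
    time: a step from [r] to [r'] is measured by [e], where [e ^+ 2] is the integral of mu over the
    step. The third-order Taylor remainder is of size [e ^+ 3], which repeated halving of the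
    integral of mu drives to 0; an error of size [e ^+ 2] would survive. In the integral equation
    the starting time stays positive, and the behaviour near 0 enters only through weighted
    integrals of the source. A Cholesky factor is used, not a symmetric square root, because it is
    explicit in the entries: it is Borel in [(s, t)], and plane rotations reduce any family of
    directions to it. Of the Gaussian measure only symmetry, rotation invariance, a finite third
    moment and a positive variance enter. *)

Section integral_of_arbitrary_functions.
Context d (T : measurableType d) (R : realType).
Variable mu : {measure set T -> \bar R}.
Local Open Scope ereal_scope.
Import HBNNSimple.

(** The integral is a supremum over simple functions below the integrand, and those below [f] are
    below [g]; the functions themselves are arbitrary. *)
Lemma le_integral_ge0 (D : set T) (f g : T -> \bar R) :
  (forall x, D x -> 0 <= f x) -> (forall x, D x -> f x <= g x) ->
  \int[mu]_(x in D) f x <= \int[mu]_(x in D) g x.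
Proof.
move=> f0 fg; have g0 x (Dx : D x) : 0 <= g x := le_trans (f0 _ Dx) (fg _ Dx).
rewrite !ge0_integralE//; apply: le_ereal_sup => _ [h /= hf <-].
exists h => //= x.
by apply: le_trans (hf x) _; rewrite /patch; case: ifPn => //; rewrite inE => /fg.
Qed.

(** A simple function below [f] is cut off on the exceptional null set: its integral does not
    change, and it now lies below [g] everywhere. *)
Let le_ae_integral_ge0 (D : set T) (f g : T -> \bar R) :
  (forall x, D x -> 0 <= f x) -> (forall x, D x -> 0 <= g x) ->
  (\forall x \ae mu, D x -> f x <= g x) ->
  \int[mu]_(x in D) f x <= \int[mu]_(x in D) g x.
Proof.
move=> f0 g0 [N [mN N0 subN]].
rewrite !ge0_integralE//; apply: ge_ereal_sup => _ [h /= hf <-].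
have mCN : measurable (~` N) by exact: measurableC.
apply: (@le_trans _ _ (sintegral mu (h \_ (~` N)))).
  rewrite -integral_nnsfun// -[leLHS](_ : \int[mu]_x (h x)%:E = _).
    rewrite -setTD -ge0_negligible_integral//.
    - exact/measurable_EFinP.
    - by move=> x _; rewrite lee_fin.
  by rewrite integral_nnsfun// patch_setT.
apply: ereal_sup_ubound; exists (proj_nnsfun h mCN); last first.
  by apply: eq_sintegral => x; rewrite mrestrict.
move=> x; rewrite /= /patch mindicE.
have [xN|xN] := boolP (x \in ~` N); last first.
  by rewrite mulr0; case: ifPn => //; rewrite inE => /g0.
rewrite mulr1; apply: le_trans (hf x) _; rewrite /patch; case: ifPn => //; rewrite inE => Dx.
apply: contrapT => fg; move: xN; rewrite inE; apply; apply: subN => /=.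
by move=> /(_ Dx).
Qed.

Let ae_eq_integral_ge0 (D : set T) (f g : T -> \bar R) :
  (forall x, D x -> 0 <= f x) -> (forall x, D x -> 0 <= g x) ->
  (\forall x \ae mu, D x -> f x = g x) ->
  \int[mu]_(x in D) f x = \int[mu]_(x in D) g x.
Proof.
move=> f0 g0 fg; apply/eqP; rewrite eq_le; apply/andP.
by split; apply: le_ae_integral_ge0 => //; apply: filterS fg => x fg /fg ->.
Qed.

(** Arbitrary integrands are allowed so that Lebesgue measurable data can be replaced by Borel data
    directly under the integral sign. *)
Lemma integral_eq_ae (D : set T) (f g : T -> \bar R) :
  (\forall x \ae mu, D x -> f x = g x) ->
  \int[mu]_(x in D) f x = \int[mu]_(x in D) g x.
Proof.
move=> fg; rewrite [LHS]integralE [RHS]integralE.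
by congr (_ - _); apply: ae_eq_integral_ge0 => //; apply: filterS fg => x fg Dx;
  rewrite ?funeposE ?funenegE fg.
Qed.

Lemma Rintegral_eq_ae (D : set T) (f g : T -> R) :
  (\forall x \ae mu, D x -> f x = g x) ->
  (\int[mu]_(x in D) f x = \int[mu]_(x in D) g x)%R.
Proof.
by move=> fg; congr fine; apply: integral_eq_ae; apply: filterS fg => x h /h ->.
Qed.

Lemma Lnorm_eq_ae (p : \bar R) (f g : T -> \bar R) :
  (\forall x \ae mu, f x = g x) -> 'N[mu]_p[f] = 'N[mu]_p[g].
Proof.
move=> fg; rewrite unlock; case: p => [r| |].
- by congr (_ `^ _); apply: integral_eq_ae; apply: filterS fg => x -> _.
- by case: ifPn => // _; apply: eq_ess_sup; apply: filterS fg => x /= ->.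
- by case: ifPn => // _; apply: eq_ess_inf; apply: filterS fg => x /= ->.
Qed.

End integral_of_arbitrary_functions.

Section lebesgue_measurable_functions.
Context d (T : measurableType d) (R : realType).
Variable mu : {measure set T -> \bar R}.

Lemma lebesgue_measurable_funP (D : set T) (g h : T -> R) :
  measurable D -> measurable_fun D h -> (\forall x \ae mu, D x -> g x = h x) ->
  lebesgue_measurable_fun mu D g.
Proof.
move=> mD mh [N [mN N0 subN]] B mB.
exists ((D `&` h @^-1` B) `\` N).
  by apply: measurableD => //; exact: mh.
exists (D `&` g @^-1` B `&` N).
  by apply: (@negligibleS _ _ _ _ N) => [x []//|]; exists N; split.
have gh x : D x -> ~ N x -> g x = h x.
  by move=> Dx Nx; apply: contrapT => gh; apply: Nx; apply: subN => /= /(_ Dx).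
apply/seteqP; split => [x [[[Dx Bx] Nx]|[]//]|x [Dx Bx]].
  by split=> //=; rewrite gh.
have [Nx|Nx] := pselect (N x); first by right.
by left; split => //; split => //=; rewrite -gh.
Qed.

(** The preimage of each ray with rational endpoint is Borel off a null set. Off the countable union
    of these null sets [g] is Borel, since every open ray is a countable union of rational ones. *)
Lemma lebesgue_measurable_fun_borel (D : set T) (g : T -> R) :
  lebesgue_measurable_fun mu D g ->
  exists Z, [/\ measurable Z, mu Z = 0 :> \bar R,
    measurable (D `\` Z) & measurable_fun (D `\` Z) g].
Proof.
move=> mg.
have H (B : set R) : measurable B ->
    exists Z, [/\ measurable Z, mu Z = 0%E & measurable ((D `&` g @^-1` B) `\` Z)].
  move=> mB; have [A mA [N [Z [mZ Z0 NZ]] AN]] := mg _ mB.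
  exists Z; split => //; rewrite -AN setDUl.
  rewrite (_ : N `\` Z = set0) ?setU0; first exact: measurableD.
  by apply/seteqP; split => x // [/NZ].
(* The case [B := setT] makes the domain [D] itself Borel off the null set [ZT]. *)
have [ZT [mZT ZT0 mDZT]] := H _ measurableT.
pose P (q : rat) := sval (cid (H _ (measurable_itv `]ratr q, +oo[))).
have PP q : [/\ measurable (P q), mu (P q) = 0%E &
  measurable ((D `&` g @^-1` `]ratr q, +oo[) `\` P q)] by rewrite /P; case: cid.
pose F (n : nat) := if unpickle n is Some q then P q else set0.
have FP n : measurable (F n) /\ mu (F n) = 0%E.
  by rewrite /F; case: unpickle => [q|]; [case: (PP q)|rewrite measure0].
exists (ZT `|` \bigcup_n F n).
have mU : measurable (ZT `|` \bigcup_n F n).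
  by apply: measurableU => //; apply: bigcupT_measurable => n; case: (FP n).
have mDU : measurable (D `\` (ZT `|` \bigcup_n F n)).
  rewrite -setDDl; apply: measurableD; first by rewrite preimage_setT setIT in mDZT.
  by apply: bigcupT_measurable => n; case: (FP n).
split => //.
  apply/negligibleP => //; apply: negligibleU; first exact/negligibleP.
  by apply: negligible_bigcup => n; apply/negligibleP; case: (FP n).
apply: (measurability _ (RGenOInfty.measurableE R)) => _ [_ [x ->] <-].
rewrite (_ : _ `&` _ = \bigcup_(n in [set n | exists2 q : rat, unpickle n = Some q & x < ratr q])
  ((D `\` (ZT `|` \bigcup_n F n)) `&`
   oapp (fun q : rat => ((D `&` g @^-1` `]ratr q, +oo[) `\` P q)) set0 (unpickle n))).
  apply: bigcup_measurable => n _; apply: measurableI => //.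
  by case: unpickle => [q|]//=; case: (PP q).
apply/seteqP; split => y /=.
  move=> [[Dy Zy]]; rewrite in_itv/= andbT => xy.
  have [q /andP[xq qy]] := rat_in_itvoo xy.
  exists (pickle q); first by exists q => //; rewrite pickleK.
  rewrite pickleK; split; first by split.
  split.
    by split; [exact: Dy|rewrite /= in_itv/= andbT].
  move=> Py; apply: Zy; right; exists (pickle q); first exact: I.
  by rewrite /F pickleK.
move=> [n /= [q nq xq] [[Dy Zy]]]; rewrite nq/= => -[[_ /=]].
rewrite !in_itv/= !andbT => qy _; split=> //.
exact: lt_trans qy.
Qed.

End lebesgue_measurable_functions.

(** * Lebesgue measure on row vectors *)

Section lebesgue_affine.
Context {R : realType}.
Local Notation mu := (@lebesgue_measure R).
Local Open Scope ereal_scope.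

Let measurable_shift (a : R) :
  measurable_fun setT (fun x : measurableTypeR R => (x + a)%R : measurableTypeR R).
Proof. exact: measurable_funD. Qed.

Let measurable_dil (k : R) :
  measurable_fun setT (fun x : measurableTypeR R => (k * x)%R : measurableTypeR R).
Proof. exact: measurable_funM. Qed.

(** The translated measure agrees with Lebesgue measure on the intervals []x, y]], and these
    determine it. *)
Lemma ge0_integral_shift (h : R -> \bar R) (a : R) : measurable_fun setT h ->
  (forall x, 0 <= h x) -> \int[mu]_x h (x + a)%R = \int[mu]_x h x.
Proof.
move=> mh h0.
rewrite (_ : \int[mu]_x h (x + a)%R =
  \int[mu]_x (h \o (fun x : measurableTypeR R => (x + a)%R : measurableTypeR R)) x) //.
rewrite -(preimage_setT (fun x : measurableTypeR R => (x + a)%R : measurableTypeR R)).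
rewrite -ge0_integral_pushforward//.
apply: eq_measure_integral => A mA _; apply/esym.
pose phi : {mfun measurableTypeR R >-> measurableTypeR R} :=
  HB.pack (fun x : measurableTypeR R => (x + a)%R : measurableTypeR R)
   (isMeasurableFun.Build _ _ _ _ _ (measurable_shift a)).
apply: (@lebesgue_measure_unique _ (pushforward mu phi)) => // _ [[x y]] _ <-.
rewrite [RHS](_ : _ = mu `](x - a)%R, (y - a)%R]%classic); last first.
  by congr (mu _); apply/seteqP; split => z /=; rewrite !in_itv/= ltrBlDr lerBrDr.
rewrite !lebesgue_measure_itv/= !lte_fin ltrD2r; case: ifPn => // _.
by rewrite -EFinB; congr (_%:E); rewrite opprB addrA subrK.
Qed.

Let ge0_integral_dil_pos (h : R -> \bar R) (k : R) : measurable_fun setT h ->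
  (forall x, 0 <= h x) -> (0 < k)%R ->
  k%:E * \int[mu]_x h (k * x)%R = \int[mu]_x h x.
Proof.
move=> mh h0 k0.
rewrite (_ : \int[mu]_x h (k * x)%R =
  \int[mu]_x (h \o (fun x : measurableTypeR R => (k * x)%R : measurableTypeR R)) x) //.
rewrite -(preimage_setT (fun x : measurableTypeR R => (k * x)%R : measurableTypeR R)).
rewrite -ge0_integral_pushforward//.
have k0' := ltW k0.
pose K : {nonneg R} := NngNum k0'.
pose phi : {mfun measurableTypeR R >-> measurableTypeR R} :=
  HB.pack (fun x : measurableTypeR R => (k * x)%R : measurableTypeR R)
   (isMeasurableFun.Build _ _ _ _ _ (measurable_dil k)).
have := @ge0_integral_mscale _ (measurableTypeR R) R (pushforward mu phi) setT measurableT K h mh (fun x _ => h0 x).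
move=> /= <-.
apply: eq_measure_integral => A mA _; apply/esym.
apply: (@lebesgue_measure_unique _ (mscale K (pushforward mu phi))) => // _ [[x y]] _ <-.
rewrite [RHS](_ : _ = k%:E * mu `](k^-1 * x)%R, (k^-1 * y)%R]%classic); last first.
  by congr (_ * mu _); apply/seteqP; split => z /=; rewrite !in_itv/= ltr_pdivrMl// ler_pdivlMl.
rewrite !lebesgue_measure_itv/= !lte_fin ltr_pM2l ?invr_gt0//; case: ifPn => // _; last by rewrite mule0.
by rewrite -!EFinB -EFinM; congr (_%:E); rewrite mulrBr !mulVKf// gt_eqF.
Qed.

Let ge0_integral_opp (h : R -> \bar R) : measurable_fun setT h ->
  (forall x, 0 <= h x) -> \int[mu]_x h (- x)%R = \int[mu]_x h x.
Proof.
move=> mh h0.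
rewrite (_ : \int[mu]_x h (- x)%R = \int[mu]_x (h \o (-%R : _ -> measurableTypeR R)) x) //.
rewrite -(preimage_setT (-%R : _ -> measurableTypeR R)).
rewrite -ge0_integral_pushforward//.
by apply: eq_measure_integral => A mA _; exact: lebesgue_measureN.
Qed.

Lemma ge0_integral_dil (h : R -> \bar R) (k : R) : measurable_fun setT h ->
  (forall x, 0 <= h x) -> (k != 0)%R ->
  (`|k|%R)%:E * \int[mu]_x h (k * x)%R = \int[mu]_x h x.
Proof.
move=> mh h0; rewrite neq_lt => /orP[k0|k0]; last first.
  by rewrite gtr0_norm//; exact: ge0_integral_dil_pos.
rewrite ltr0_norm//.
rewrite -[RHS]ge0_integral_opp//.
rewrite -(@ge0_integral_dil_pos (fun x => h (- x)%R) (- k)%R) ?oppr_gt0//.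
  by congr (_ * _); apply: eq_integral => x _; rewrite mulNr opprK.
exact: measurableT_comp.
Qed.

End lebesgue_affine.

Section lebesgue_rV_translation.
Context {R : realType}.
Local Open Scope ereal_scope.

Lemma ge0_integral_rVS n (h : 'rV[R]_n.+1 -> \bar R) : measurable_fun setT h ->
  (forall x, 0 <= h x) ->
  \int[lebesgue_rV n.+1]_x h x =
  \int[lebesgue_measure]_y \int[lebesgue_rV n]_z h (cons_rV (y, z)).
Proof.
move=> mh h0.
rewrite -(@fubini_tonelli1 _ _ _ _ _ _ _ (h \o @cons_rV R n)); first last.
  by move=> x; exact: h0.
  by apply: measurableT_comp => //; exact: measurable_cons_rV.
rewrite -[in RHS](preimage_setT (@cons_rV R n)).
by rewrite -ge0_integral_pushforward//; exact: measurable_cons_rV.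
Qed.

Lemma measurable_addv n (v : 'rV[R]_n) : measurable_fun setT (fun x : 'rV[R]_n => (x + v)%R).
Proof.
apply/measurable_fun_rVP => i; under eq_fun do rewrite mxE.
by apply: measurable_funD => //; exact: measurable_coord.
Qed.

(** Induction on the dimension: Tonelli splits off the first coordinate, where one-dimensional
    translation invariance applies. *)
Lemma ge0_integral_rV_shift n (h : 'rV[R]_n -> \bar R) (v : 'rV[R]_n) :
  measurable_fun setT h -> (forall x, 0 <= h x) ->
  \int[lebesgue_rV n]_x h (x + v)%R = \int[lebesgue_rV n]_x h x.
Proof.
elim: n h v => [|n IH] h v mh h0.
  by apply: eq_integral => x _; congr h; apply/rowP => -[].
rewrite (ge0_integral_rVS mh h0).
rewrite (ge0_integral_rVS (measurableT_comp mh (measurable_addv v)) (fun x => h0 _)).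
have mc : measurable_fun setT (h \o @cons_rV R n).
  by apply: measurableT_comp => //; exact: measurable_cons_rV.
have mF : measurable_fun setT (fun y => \int[lebesgue_rV n]_z h (cons_rV (y, z))).
  by apply: (@measurable_fun_fubini_tonelli_F _ _ _ _ _ (lebesgue_rV n) _ mc) => x; exact: h0.
rewrite -[RHS](ge0_integral_shift (v ord0 ord0) mF); last first.
  by move=> y; exact: integral_ge0.
apply: eq_integral => y _.
pose w : 'rV[R]_n := (\row_i v ord0 (lift ord0 i))%R.
have mcy := measurableT_comp mc (pair1_measurable (y + v ord0 ord0)%R).
rewrite -[RHS](IH _ w mcy (fun x => h0 _)).
apply: eq_integral => z _; congr h; apply/rowP => i.
rewrite mxE; case: (unliftP ord0 i) => [j|] ->; rewrite ?cons_rVS ?cons_rV0//=.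
by rewrite !mxE.
Qed.

End lebesgue_rV_translation.

Section continuous_measurable.
Context {R : realType}.

(** Balls of the maximum norm are boxes, and an open set is the union of the countably many balls
    with rational centre and radius [1 / (m + 1)] that it contains. *)
Lemma open_measurable_rV n (U : set 'rV[R]_n) : open U -> measurable U.
Proof.
move=> oU.
pose Q := ('rV[rat]_n * nat)%type.
pose B (q : Q) : set 'rV[R]_n := ball (map_mx ratr q.1 : 'rV[R]_n) (q.2.+1%:R^-1 : R).
have mB q : measurable (B q).
  rewrite (_ : B q = \bigcap_(i in [set: 'I_n]) ((fun x : 'rV[R]_n => x ord0 i) @^-1`
      ball (ratr (q.1 ord0 i) : R) (q.2.+1%:R^-1 : R))).
    apply: fin_bigcap_measurable => // i _.
    rewrite -[X in measurable X]setTI; apply: measurable_coord => //.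
    exact: measurable_ball.
  apply/seteqP; split => x /=.
    by move=> [e0 qx] i _ /=; have := qx ord0 i; rewrite mxE.
  move=> qx; split; first by [].
  by move=> i j; rewrite ord1 mxE; exact: qx.
pose V k := oapp B set0 (unpickle k).
rewrite (_ : U = \bigcup_(k in [set k | V k `<=` U]) V k).
  apply: bigcup_measurable => k _; rewrite /V.
  by case: unpickle => [q|]//=; exact: mB.
apply/seteqP; split => x; last by move=> [k /= kU /kU].
move=> Ux; have /nbhs_ballP[e /= e0 xU] : nbhs x U by exact: open_nbhs_nbhs.
(* With a radius below [e / 2], a ball that contains [x] stays within [e] of [x]. *)
have [m me] : exists m : nat, (m.+1%:R^-1 : R) < e / 2.
  exists (Num.truncn (e / 2)^-1).
  rewrite invf_plt ?posrE ?divr_gt0//. exact: truncnS_gt.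
have H i : exists q : rat, ball (ratr q : R) (m.+1%:R^-1) (x ord0 i).
  have : x ord0 i - m.+1%:R^-1 < x ord0 i + m.+1%:R^-1.
    by rewrite ltrBlDr -addrA ltrDl addr_gt0.
  move=> /rat_in_itvoo [q]; rewrite in_itv/= => /andP[q1 q2]; exists q.
  by rewrite -ball_normE /= distrC ltr_distlC q1 q2.
pose q : 'rV[rat]_n := \row_i sval (cid (H i)).
have xq : B (q, m) x.
  by split=> // i j; rewrite ord1 !mxE; case: cid.
have VB : V (pickle (q, m)) = B (q, m) by rewrite /V pickleK.
exists (pickle (q, m)); last by rewrite VB.
rewrite /= VB => z zq.
apply: xU; apply: (@ball_splitr _ _ (map_mx ratr q : 'rV[R]_n)).
  by apply: le_ball xq; exact: ltW.
by apply: le_ball zq; exact: ltW.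
Qed.

Lemma continuous_measurable_rV n (phi : 'rV[R]_n -> R) :
  continuous phi -> measurable_fun setT phi.
Proof.
move=> /continuousP cphi; apply: (measurability _ (RGenOpens.measurableE R)).
move=> _ [_ [a [b ->] <-]]; rewrite setTI.
by apply: open_measurable_rV; apply: cphi; exact: interval_open.
Qed.

End continuous_measurable.

(** * Test functions *)

Section one_variable.
Context {R : realType}.

Lemma mvt_le (g dg : R -> R) (M : R) (a b : R) : 0 <= M ->
  (forall x : R, is_derive x (1 : R) g (dg x)) ->
  (forall x, `|x - a| <= `|b - a| -> `|dg x| <= M) ->
  `|g b - g a| <= M * `|b - a|.
Proof.
move=> M0 hg hM.
have cg : continuous g.
  by move=> x; have [dx _] := hg x; exact/differentiable_continuous/derivable1_diffP.
have [ab|ba] := leP a b.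
  have [c] := @MVT_segment R g dg a b ab (fun x _ => hg x) (continuous_subspaceT cg).
  rewrite in_itv/= => /andP[ac cb] ->; rewrite normrM ler_wpM2r// hM//.
  by rewrite !ger0_norm ?subr_ge0//; lra.
have [c] := @MVT_segment R g dg b a (ltW ba) (fun x _ => hg x) (continuous_subspaceT cg).
rewrite in_itv/= => /andP[ac cb] E; rewrite distrC E distrC normrM.
rewrite ler_wpM2r// hM//.
by rewrite !ler0_norm ?subr_le0//; lra.
Qed.

Lemma is_derive_sub_linear (g : R -> R) (dg c x : R) : is_derive x (1 : R) g dg ->
  is_derive x (1 : R) (fun t : R => g t - t * c) (dg - c).
Proof.
move=> hg; rewrite (_ : (fun t : R => g t - t * c) = g - c *: (@idfun R)).
  have -> : dg - c = dg - c *: (1 : R) by rewrite /GRing.scale/= mulr1.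
  by apply: is_deriveB; apply: is_deriveZ; exact: is_derive_id.
by apply/funext => t; rewrite -[RHS]/(g t - c * t) mulrC.
Qed.

Let is_derive_sub_square (g : R -> R) (dg c x : R) : is_derive x (1 : R) g dg ->
  is_derive x (1 : R) (fun t : R => g t - t ^+ 2 * c) (dg - 2 * x * c).
Proof.
move=> hg; rewrite (_ : (fun t : R => g t - t ^+ 2 * c) = g - c *: ((@idfun R) ^+ 2)).
  have H : is_derive x (1 : R) ((@idfun R) ^+ 2) ((2 * x ^+ 1) *: (1 : R)).
    exact: is_deriveX.
  rewrite (_ : 2 * x * c = c *: ((2 * x ^+ 1) *: (1 : R))).
    by apply: is_deriveB; apply: is_deriveZ.
  by rewrite /GRing.scale/=; ring.
by apply/funext => t; rewrite -[RHS]/(g t - c * t ^+ 2) mulrC.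
Qed.

(** The mean value inequality is applied twice: to [dg] minus its linear part, then to [g] minus its
    Taylor polynomial. Bounding the oscillation of [ddg] avoids differentiating a third time. *)
Lemma taylor2_le (g dg ddg : R -> R) (M : R) : 0 <= M ->
  (forall x : R, is_derive x (1 : R) g (dg x)) -> (forall x : R, is_derive x (1 : R) dg (ddg x)) ->
  (forall x, `|x| <= 1 -> `|ddg x - ddg 0| <= M) ->
  `|g 1 - g 0 - dg 0 - ddg 0 / 2| <= M.
Proof.
move=> M0 hg hdg hM.
have h1 x : `|x| <= 1 -> `|dg x - dg 0 - x * ddg 0| <= M.
  move=> x1.
  have := @mvt_le (fun x => dg x - x * ddg 0) (fun x => ddg x - ddg 0) M 0 x M0.
  rewrite mul0r subr0 subr0 => H; rewrite -[X in `|X|]addrAC.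
  apply: (le_trans (H _ _)); last by rewrite ler_piMr.
  - by move=> y; exact: is_derive_sub_linear.
  - by move=> y; rewrite subr0 => yx; apply: hM; exact: le_trans x1.
pose k x := g x - x * dg 0 - x ^+ 2 * (ddg 0 / 2).
have := @mvt_le k (fun x => dg x - dg 0 - x * ddg 0) M 0 1 M0.
rewrite /k subr0 normr1 mulr1 mul1r mul0r subr0 expr1n mul1r expr0n mul0r subr0.
have -> : g 1 - dg 0 - ddg 0 / 2 - g 0 = g 1 - g 0 - dg 0 - ddg 0 / 2 by ring.
apply.
- move=> y; rewrite (_ : _ - _ - _ = dg y - dg 0 - 2 * y * (ddg 0 / 2)); last by field.
  by apply: is_derive_sub_square; exact: is_derive_sub_linear.
- by move=> y; rewrite subr0; exact: h1.
Qed.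

End one_variable.

Section several_variables.
Context {R : realType} {d : nat}.
Implicit Types (psi phi : 'rV[R]_d -> R) (z v : 'rV[R]_d) (i j : 'I_d) (K : R).

Definition norm1 v : R := \sum_i `|v ord0 i|.

Lemma norm1_ge0 v : 0 <= norm1 v. Proof. by apply: sumr_ge0. Qed.

Lemma norm1Z (y : R) v : norm1 (y *: v) = `|y| * norm1 v.
Proof. by rewrite mulr_sumr; apply: eq_bigr => i _; rewrite mxE normrM. Qed.

Lemma is_derive_line psi z v (t : R) : derivable psi (z + t *: v) v ->
  is_derive t (1 : R) (fun h : R => psi (z + h *: v)) ('D_v psi (z + t *: v)).
Proof.
move=> dpsi.
have E : (fun h : R => h^-1 *: (((fun h : R => psi (z + h *: v)) \o shift t) (h *: 1) - psi (z + t *: v)))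
   = (fun h : R => h^-1 *: ((psi \o shift (z + t *: v)) (h *: v) - psi (z + t *: v))).
  apply/funext => h /=; congr (_ *: (psi _ - _)).
  by rewrite [h *: 1]mulr1 scalerDl addrCA.
by split; rewrite /derivable /derive E.
Qed.

(** Only derivatives along the coordinate axes are given; the estimates below turn bounds on them
    into bounds along arbitrary vectors. *)
Definition lip_partials psi K :=
  (forall i x, derivable psi x (delta_mx ord0 i)) /\
  (forall i x, `|partial i psi x| <= K).

Lemma lip_coord psi K i z (h : R) : lip_partials psi K ->
  `|psi (z + h *: delta_mx ord0 i) - psi z| <= K * `|h|.
Proof.
move=> [dpsi Kpsi].
have K0 : 0 <= K by exact: le_trans (Kpsi i z).
have := @mvt_le R (fun h : R => psi (z + h *: delta_mx ord0 i))
  (fun h => partial i psi (z + h *: delta_mx ord0 i)) K 0 h K0.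
rewrite scale0r addr0 subr0; apply => x; last by [].
exact: is_derive_line.
Qed.

(** The path from [z] to [z + v] moves along one axis at a time, and the inductions run over the
    list of axes already used. *)
Let sub_vec (s : seq 'I_d) v : 'rV[R]_d := \sum_(i <- s) v ord0 i *: delta_mx ord0 i.

Let sub_vec_enum v : sub_vec (index_enum 'I_d) v = v.
Proof. exact/esym/row_sum_delta. Qed.

Let lip_seq psi K s z v : lip_partials psi K ->
  `|psi (z + sub_vec s v) - psi z| <= K * \sum_(i <- s) `|v ord0 i|.
Proof.
move=> hpsi; elim: s => [|i s IH].
  by rewrite /sub_vec !big_nil addr0 subrr normr0 mulr0.
rewrite /sub_vec !big_cons mulrDr.
have := lip_coord i (z + sub_vec s v) (v ord0 i) hpsi.
rewrite -addrA (addrC (sub_vec s v)) => h1.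
rewrite (le_trans (ler_distD (psi (z + sub_vec s v)) _ _))// lerD//.
Qed.

Lemma lip_norm1 psi K z v : lip_partials psi K ->
  `|psi (z + v) - psi z| <= K * norm1 v.
Proof. by move=> /(lip_seq (index_enum 'I_d) z v); rewrite sub_vec_enum. Qed.

Let taylor1_seq psi K s z v :
  (forall i x, derivable psi x (delta_mx ord0 i)) -> 0 <= K ->
  (forall i, lip_partials (partial i psi) K) ->
  `|psi (z + sub_vec s v) - psi z - \sum_(i <- s) v ord0 i * partial i psi z|
    <= K * (\sum_(i <- s) `|v ord0 i|) ^+ 2.
Proof.
move=> dpsi K0 hpsi; elim: s => [|i s IH].
  by rewrite /sub_vec !big_nil addr0 !subrr normr0 expr0n mulr0.
rewrite /sub_vec !big_cons -/(sub_vec s v).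
set S := \sum_(j <- s) `|v ord0 j|; set a := v ord0 i.
have S0 : 0 <= S by exact: sumr_ge0.
set w := z + sub_vec s v; set e := delta_mx ord0 i.
(* The slope is frozen at [z], not at the current point [w]: the derivative of [k] is then a
   difference of values of one partial along the path from [z], of size [K * (|a| + S)]. *)
pose k h := psi (w + h *: e) - h * partial i psi z.
have := @mvt_le R k (fun h => partial i psi (w + h *: e) - partial i psi z)
  (K * (`|a| + S)) 0 a.
rewrite /k scale0r addr0 mul0r !subr0 => H.
have {}H : `|psi (w + a *: e) - a * partial i psi z - psi w| <= K * (`|a| + S) * `|a|.
  apply: H.
  - by rewrite mulr_ge0// addr_ge0.
  - by move=> x; apply: is_derive_sub_linear; apply: is_derive_line; exact: dpsi.
  - move=> x; rewrite subr0 => xa.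
    have h1 := lip_coord i w x (hpsi i).
    have h2 := lip_seq s z v (hpsi i).
    apply: (le_trans (ler_distD (partial i psi w) _ _)); rewrite mulrDr.
    by apply: lerD => //; apply: (le_trans h1); rewrite ler_wpM2l.
have -> : psi (z + (a *: e + sub_vec s v)) - psi z -
    (a * partial i psi z + \sum_(j <- s) v ord0 j * partial j psi z) =
  (psi (w + a *: e) - a * partial i psi z - psi w) +
  (psi w - psi z - \sum_(j <- s) v ord0 j * partial j psi z).
  by rewrite /w (addrC (a *: e)) addrA; ring.
apply: (le_trans (ler_normD _ _)); apply: (le_trans (lerD H IH)).
rewrite -/S -mulrA -mulrDr ler_wpM2l// sqrrD.
have := normr_ge0 a; nra.
Qed.

Lemma taylor1_norm1 psi K z v :
  (forall i x, derivable psi x (delta_mx ord0 i)) -> 0 <= K ->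
  (forall i, lip_partials (partial i psi) K) ->
  `|psi (z + v) - psi z - \sum_i v ord0 i * partial i psi z| <= K * norm1 v ^+ 2.
Proof.
move=> h1 K0 h2.
by have := taylor1_seq (index_enum 'I_d) z v h1 K0 h2; rewrite sub_vec_enum.
Qed.

(** Chain rule along a line: the quadratic remainder of [taylor1_norm1], divided by the step, tends
    to 0. *)
Lemma is_derive_line_sum psi K z v (t : R) :
  (forall i x, derivable psi x (delta_mx ord0 i)) -> 0 <= K ->
  (forall i, lip_partials (partial i psi) K) ->
  is_derive t (1 : R) (fun h : R => psi (z + h *: v))
    (\sum_i v ord0 i * partial i psi (z + t *: v)).
Proof.
move=> h1 K0 h2.
set D := \sum_i _.
have cv : h^-1 *: (((fun h : R => psi (z + h *: v)) \o shift t) (h *: 1) - psi (z + t *: v))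
    @[h --> (0:R)^'] --> D.
  have N0 : 0 <= K * norm1 v ^+ 2 by rewrite mulr_ge0// sqr_ge0.
  apply/cvgrPdist_le => e e0; near=> h.
  have hn0 : h != 0 by near: h; exact: nbhs_dnbhs_neq.
  have -> : ((fun h : R => psi (z + h *: v)) \o shift t) (h *: 1) =
    psi (z + t *: v + h *: v).
    by rewrite /= [h *: 1]mulr1 scalerDl addrA addrAC.
  have := taylor1_norm1 (z + t *: v) (h *: v) h1 K0 h2.
  have -> : \sum_i (h *: v) ord0 i * partial i psi (z + t *: v) = h * D.
    by rewrite mulr_sumr; apply: eq_bigr => i _; rewrite mxE mulrA.
  rewrite norm1Z => H.
  have -> : D - h^-1 *: (psi (z + t *: v + h *: v) - psi (z + t *: v)) =
     - (h^-1 * (psi (z + t *: v + h *: v) - psi (z + t *: v) - h * D)).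
    by rewrite /GRing.scale/=; field.
  rewrite normrN normrM normfV ler_pdivrMl ?normr_gt0//.
  apply: (le_trans H); rewrite exprMn mulrCA expr2 -mulrA ler_wpM2l//.
  apply: (@le_trans _ _ ((K * norm1 v ^+ 2 + 1) * `|h|)).
    by rewrite mulrC ler_wpM2r// lerDl.
  rewrite mulrC -ler_pdivlMr; last by rewrite ltr_pwDr.
  near: h; apply: dnbhs0_le; rewrite divr_gt0// ltr_pwDr//.
by split; [apply/cvg_ex; exists D|exact/cvg_lim].
Unshelve. all: by end_near. Qed.

End several_variables.

Section test_functions.
Context {R : realType} {d : nat}.
Implicit Types (psi phi : 'rV[R]_d -> R) (z v : 'rV[R]_d) (i j : 'I_d) (K : R).

Lemma partials_rcons l i phi : partials (rcons l i) phi = partials l (partial i phi).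
Proof. by rewrite /partials foldr_rcons. Qed.

(** Off its closed support [phi] vanishes in a whole neighbourhood, hence so does the derivative. *)
Lemma partial_support i phi :
  closure [set x | partial i phi x != 0] `<=` closure [set x | phi x != 0].
Proof.
rewrite [X in _ `<=` X](closure_id (closure [set x | phi x != 0])).1; last exact: closed_closure.
apply: closure_subset => x /= px; apply: contrapT => nx; move/eqP: px; apply.
have : nbhs x (~` closure [set x | phi x != 0]).
  by apply: open_nbhs_nbhs; split => //; apply: closed_openC; exact: closed_closure.
move=> nb; rewrite /partial (@near_eq_derive _ _ _ phi (cst 0)) ?derive_cst//.
apply: filterS nb => y /= ny; apply: contrapT => /eqP py; apply: ny.
exact: subset_closure.
Qed.

Lemma test_function_partial i phi : test_function phi -> test_function (partial i phi).
Proof.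
move=> [sm cp]; split.
  by move=> l; have := sm (rcons l i); rewrite partials_rcons.
by apply: subclosed_compact cp _; [exact: closed_closure|exact: partial_support].
Qed.

Lemma test_function_partials l phi : test_function phi -> test_function (partials l phi).
Proof. by move=> tp; elim: l => //= i l; exact: test_function_partial. Qed.

Lemma test_function_continuous phi : test_function phi -> continuous phi.
Proof. by move=> [/(_ [::])[]]. Qed.

Lemma test_function_derivable phi i x :
  test_function phi -> derivable phi x (delta_mx ord0 i).
Proof. by move=> [/(_ [::])[]]. Qed.

Lemma test_function_box phi : test_function phi ->
  exists2 r, 0 < r & forall x, phi x != 0 -> forall i, `|x ord0 i| <= r.
Proof.
move=> [_ /compact_bounded[M [_ HM]]].
exists (`|M| + 1) => [|x px i]; first by rewrite ltr_pwDr.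
have /= := HM (`|M| + 1); rewrite (le_lt_trans (ler_norm M)) ?ltrDl// => /(_ isT x).
have cx : closure [set x | phi x != 0] x by exact: subset_closure.
move=> /(_ cx); apply: le_trans.
by rewrite /Num.norm/= mx_normrE; exact: (le_bigmax _ (fun p => `|x p.1 p.2|) (ord0, i)).
Qed.

Lemma test_function_bounded phi : test_function phi ->
  exists2 K, 0 <= K & forall x, `|phi x| <= K.
Proof.
move=> tp; have cphi := test_function_continuous tp; case: tp => _ cp.
have := continuous_compact (continuous_subspaceT cphi) cp.
move=> /compact_bounded[M [_ HM]].
exists (`|M| + 1) => [|x]; first by rewrite addr_ge0.
have [->|px] := eqVneq (phi x) 0; first by rewrite normr0 addr_ge0.
have /= := HM (`|M| + 1); rewrite (le_lt_trans (ler_norm M)) ?ltrDl// => /(_ isT (phi x)).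
by apply; exists x => //; exact: subset_closure.
Qed.

Definition partials_le n phi K :=
  forall l, (size l <= n)%N -> forall x, `|partials l phi x| <= K.

Lemma test_function_partials_le n phi : test_function phi ->
  exists2 K, 0 <= K & partials_le n phi K.
Proof.
elim: n phi => [|n IH] phi tp.
  have [K K0 HK] := test_function_bounded tp.
  by exists K => // -[].
have [K K0 HK] := test_function_bounded tp.
have H i : {K' | 0 <= K' & partials_le n (partial i phi) K'}.
  by apply: cid2; apply: IH; exact: test_function_partial.
exists (K + \sum_i s2val (H i)).
  by rewrite addr_ge0// sumr_ge0// => i _; case: (H i).
move=> l; case/lastP: l => [_ x|l i].
  by rewrite (le_trans (HK x))// lerDl sumr_ge0// => i _; case: (H i).
rewrite size_rcons ltnS => ln x; rewrite partials_rcons.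
apply: (@le_trans _ _ (s2val (H i))); first by case: (H i) => K' /= _; exact.
rewrite (bigD1 i)//= addrCA lerDl addr_ge0// sumr_ge0// => j _; by case: (H j).
Qed.

Lemma test_function_lip l n phi K : test_function phi -> partials_le n phi K ->
  (size l < n)%N -> lip_partials (partials l phi) K.
Proof.
move=> tp pK ln; split => i x; last exact: (pK (i :: l)).
exact: test_function_derivable (test_function_partials l tp).
Qed.

(** This is [taylor2_le] on the segment from [z] to [z + v]: bounded third partials make the second
    derivative along it Lipschitz with constant [K * norm1 v ^+ 3]. *)
Lemma taylor2_test phi K z v : test_function phi -> 0 <= K -> partials_le 3 phi K ->
  `|phi (z + v) - phi z - \sum_i v ord0 i * partial i phi z
     - (\sum_i \sum_j v ord0 i * v ord0 j * partials [:: j; i] phi z) / 2|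
  <= K * norm1 v ^+ 3.
Proof.
move=> tp K0 pK.
pose g (t : R) := phi (z + t *: v).
pose dg (t : R) := \sum_i v ord0 i * partial i phi (z + t *: v).
pose ddg (t : R) := \sum_i v ord0 i * \sum_j v ord0 j * partials [:: j; i] phi (z + t *: v).
have hg t : is_derive t (1 : R) g (dg t).
  apply: (@is_derive_line_sum _ _ _ K) => //.
    by move=> i x; exact: test_function_derivable.
  by move=> i; apply: (@test_function_lip [:: i] 3).
have hdg t : is_derive t (1 : R) dg (ddg t).
  rewrite (_ : dg = \sum_i (fun t => v ord0 i * partial i phi (z + t *: v))); last first.
    by apply/funext => x; rewrite fct_sumE.
  apply: is_derive_sum => i; apply: is_deriveZ.
  apply: (@is_derive_line_sum _ _ (partial i phi) K) => //.
    by move=> j x; apply: test_function_derivable; exact: test_function_partial.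
  by move=> j; apply: (@test_function_lip [:: j; i] 3).
have M0 : 0 <= K * norm1 v ^+ 3 by rewrite mulr_ge0// exprn_ge0// norm1_ge0.
have := taylor2_le M0 hg hdg.
rewrite /g /dg /ddg scale1r scale0r addr0.
have -> : \sum_i \sum_j v ord0 i * v ord0 j * partials [:: j; i] phi z =
  \sum_i v ord0 i * \sum_j v ord0 j * partials [:: j; i] phi z.
  by apply: eq_bigr => i _; rewrite mulr_sumr; apply: eq_bigr => j _; rewrite mulrA.
apply => t t1.
rewrite -sumrB; under eq_bigr do rewrite -mulrBr -sumrB.
apply: (le_trans (ler_norm_sum _ _ _)).
rewrite exprSr expr2 -mulrA mulrCA [X in _ <= X]mulr_suml.
apply: ler_sum => i _; rewrite normrM ler_wpM2l//.
apply: (le_trans (ler_norm_sum _ _ _)).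
rewrite mulrCA [X in _ <= X]mulr_suml.
apply: ler_sum => j _; rewrite -mulrBr normrM ler_wpM2l//.
apply: (le_trans (lip_norm1 _ _ (test_function_lip (l := [:: j; i]) tp pK _))) => //.
by rewrite norm1Z ler_wpM2l// ler_piMl// norm1_ge0.
Qed.

(** The second difference over a square of side [h] is symmetric in the two axes, and it equals
    [h ^+ 2] times either mixed partial up to [2 * K * h ^+ 3]. *)
Lemma partials_sym phi i j : test_function phi ->
  partials [:: i; j] phi = partials [:: j; i] phi.
Proof.
move=> tp; apply/funext => z.
have [K K0 pK] := test_function_partials_le 3 tp.
pose e k : 'rV[R]_d := delta_mx ord0 k.
have H p q (h : R) : 0 < h ->
  `|(phi (z + h *: e p + h *: e q) - phi (z + h *: e p)
     - (phi (z + h *: e q) - phi z)) - h ^+ 2 * partials [:: p; q] phi z|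
   <= 2 * K * h ^+ 3.
  move=> h0.
  (* The mean value inequality is used along the axis [q] for [k], then along [p] for [m]; what
     remains is the Lipschitz bound of the second partial on the square. *)
  pose k t := phi (z + h *: e p + t *: e q) - phi (z + t *: e q)
     - t * (h * partials [:: p; q] phi z).
  have := @mvt_le R k (fun t => partial q phi (z + h *: e p + t *: e q)
    - partial q phi (z + t *: e q) - h * partials [:: p; q] phi z) (2 * K * h ^+ 2) 0 h.
  rewrite /k !scale0r !addr0 mul0r !subr0 (gtr0_norm h0) => H.
  have -> : phi (z + h *: e p + h *: e q) - phi (z + h *: e p) -
     (phi (z + h *: e q) - phi z) - h ^+ 2 * partials [:: p; q] phi z =
     phi (z + h *: e p + h *: e q) - phi (z + h *: e q) -
     h * (h * partials [:: p; q] phi z) - (phi (z + h *: e p) - phi z) by ring.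
  have -> : 2 * K * h ^+ 3 = 2 * K * h ^+ 2 * h by ring.
  apply: H => [|t|t th].
  - by rewrite !mulr_ge0// ltW.
  - have D y : is_derive t (1 : R) (fun h : R => phi (y + h *: e q)) (partial q phi (y + t *: e q)).
      by apply: is_derive_line; exact: test_function_derivable.
    exact: is_derive_sub_linear.
  - pose m s := partial q phi (z + t *: e q + s *: e p) - s * partials [:: p; q] phi z.
    have := @mvt_le R m (fun s => partials [:: p; q] phi (z + t *: e q + s *: e p)
        - partials [:: p; q] phi z) (2 * K * h) 0 h.
    rewrite /m !scale0r !addr0 mul0r !subr0 (gtr0_norm h0) => H'.
    have -> : partial q phi (z + h *: e p + t *: e q) - partial q phi (z + t *: e q)
      - h * partials [:: p; q] phi z = partial q phi (z + t *: e q + h *: e p)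
      - h * partials [:: p; q] phi z - partial q phi (z + t *: e q).
      by rewrite (addrAC z); ring.
    have -> : 2 * K * h ^+ 2 = 2 * K * h * h by ring.
    apply: H' => [|s|s sh].
    + by rewrite !mulr_ge0// ltW.
    + have D : is_derive s (1 : R) (fun h : R => partial q phi (z + t *: e q + h *: e p))
         (partials [:: p; q] phi (z + t *: e q + s *: e p)).
        apply: is_derive_line; apply: test_function_derivable.
        exact: test_function_partial.
      exact: is_derive_sub_linear.
    + have L := test_function_lip (l := [:: p; q]) tp pK isT.
      apply: (le_trans (ler_distD (partials [:: p; q] phi (z + t *: e q)) _ _)).
      rewrite -mulrA mulr_natl mulr2n; apply: lerD.
        apply: (le_trans (lip_coord p _ _ L)).
        by rewrite ler_wpM2l//; move: sh; rewrite subr0.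
      apply: (le_trans (lip_coord q _ _ L)).
      by rewrite ler_wpM2l//; move: th; rewrite subr0.
apply/eqP; rewrite -subr_eq0 -normr_le0; apply/ler_addgt0Pr => eps eps0; rewrite add0r.
(* The two errors add up to [4 * K * h ^+ 3], which this [h] makes at most [eps * h ^+ 2]; the 1
   keeps the denominator positive when [K = 0]. *)
pose h := eps / (4 * K + 1).
have h0 : 0 < h by rewrite divr_gt0// ltr_pwDr// mulr_ge0.
have H1 := H i j h h0; have H2 := H j i h h0.
have h2 : 0 < h ^+ 2 by rewrite exprn_gt0.
rewrite -(ler_pM2l h2) -[X in X * `|_|]gtr0_norm// -normrM.
set A := phi (z + h *: e i + h *: e j) - phi (z + h *: e i)
     - (phi (z + h *: e j) - phi z) in H1.
have H3 : `|A - h ^+ 2 * partials [:: j; i] phi z| <= 2 * K * h ^+ 3.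
  apply: le_trans H2; rewrite le_eqVlt; apply/orP; left; apply/eqP; congr `| _ |.
  by rewrite /A (addrAC z); ring.
move: H1 H3; move: A (partials [:: i; j] phi z) (partials [:: j; i] phi z) => A p q H1 H3.
have -> : h ^+ 2 * (p - q) = (A - h ^+ 2 * q) - (A - h ^+ 2 * p) by ring.
apply: (le_trans (ler_normB _ _)); apply: (le_trans (lerD H3 H1)).
rewrite -mulrDl exprSr mulrA (mulrC (_ + _)) -mulrA ler_wpM2l//; first exact: ltW.
have -> : 2 * K + 2 * K = 4 * K by ring.
rewrite /h mulrA ler_pdivrMr ?ltr_pwDr ?mulr_ge0//.
by rewrite mulrC ler_wpM2l// ?lerDl// ltW.
Qed.

End test_functions.

(** * Gaussian averages *)

Section gaussian.
Context {R : realType}.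
Local Notation mu := (@lebesgue_measure R).

Definition gauss : probability (measurableTypeR R) R := @normal_prob R 0 1.

Local Notation pdf := (@normal_pdf R 0 1).

Let pdf_ge0 (x : R) : 0 <= pdf x. Proof. exact: normal_pdf_ge0. Qed.

Let mpdf : measurable_fun [set: R] pdf. Proof. exact: measurable_normal_pdf. Qed.

Section density.
Local Open Scope ereal_scope.
Import HBNNSimple.

Let integral_gauss_nnsfun (h : {nnsfun (measurableTypeR R) >-> R}) :
  \int[gauss]_x (h x)%:E = \int[mu]_x ((h x)%:E * (pdf x)%:E).
Proof.
under [LHS]eq_integral do rewrite fimfunE -fsumEFin//.
rewrite [LHS]ge0_integral_fsum//; last 2 first.
  - by move=> r; exact/measurable_EFinP/measurableT_comp.
  - by move=> n x _; rewrite EFinM nnfun_muleindic_ge0.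
transitivity (\int[mu]_x (\sum_(r \in range h)
    (r * \1_(h @^-1` [set r]) x)%:E * (pdf x)%:E)); last first.
  apply: eq_integral => x _; rewrite -ge0_mule_fsuml => [|r]; last first.
    exact: nnfun_muleindic_ge0.
  by rewrite fsumEFin// -(fimfunE h x).
rewrite ge0_integral_fsum//; last 2 first.
  - move=> r; apply/measurable_EFinP/measurable_funM => //.
    exact: measurable_funM.
  - by move=> r x _; rewrite mule_ge0 ?lee_fin//; exact: nnfun_muleindic_ge0.
apply: eq_fsbigr => r _.
rewrite integralZl_indic_nnsfun// integral_indic// setIT.
have [r0|r0] := ltP r 0%R.
  have -> : h @^-1` [set r] = set0.
    apply/seteqP; split => // x /= hx.
    by have : (0 <= h x)%R by []; rewrite hx leNgt r0.
  rewrite measure0 mule0; apply/esym/integral0_eq => x _.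
  by rewrite indic0 mulr0 mul0e.
under eq_integral => x _ do rewrite EFinM -muleA.
rewrite ge0_integralZl//; first last.
  - by move=> x _; rewrite mule_ge0 ?lee_fin.
  - apply/measurable_EFinP/measurable_funM => //.
congr (_ * _); rewrite /= /normal_prob integral_mkcond.
apply: eq_integral => x _; rewrite patchE indicE.
by case: ifPn => _; rewrite ?mul1e ?mul0e.
Qed.

(** For simple functions the density formula unfolds the definition of [normal_prob]; monotone
    convergence on both sides does the rest. *)
Lemma ge0_integral_gauss (f : R -> \bar R) : measurable_fun setT f ->
  (forall x, 0 <= f x) -> \int[gauss]_x f x = \int[mu]_x (f x * (pdf x)%:E).
Proof.
move=> mf f0; pose f_ := nnsfun_approx (@measurableT _ (measurableTypeR R)) mf.
transitivity (limn (fun n => \int[gauss]_x (f_ n x)%:E)).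
  rewrite -monotone_convergence//=.
  - apply: eq_integral => x _; apply/esym/cvg_lim => //.
    by apply: cvg_nnsfun_approx.
  - by move=> n; exact/measurable_EFinP/measurable_funTS.
  - by move=> n x _; rewrite lee_fin.
  - by move=> x _ m n mn; rewrite lee_fin; exact/lefP/nd_nnsfun_approx.
under eq_fun do rewrite integral_gauss_nnsfun.
rewrite -monotone_convergence//=.
- apply: eq_integral => x _; apply/cvg_lim => //.
  by apply: cvgeZr => //; exact: cvg_nnsfun_approx.
- move=> n; apply: emeasurable_funM; exact/measurable_EFinP/measurable_funTS.
- by move=> n x _; rewrite mule_ge0 ?lee_fin.
- move=> x _ m n mn; rewrite lee_wpmul2r ?lee_fin//.
  exact/lefP/nd_nnsfun_approx.
Qed.

End density.

Section symmetries.
Local Open Scope ereal_scope.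

Lemma ge0_integral_gaussN (f : R -> \bar R) : measurable_fun setT f ->
  (forall x, 0 <= f x) -> \int[gauss]_x f (- x)%R = \int[gauss]_x f x.
Proof.
move=> mf f0; rewrite [RHS]ge0_integral_gauss// ge0_integral_gauss//; last first.
  exact: measurableT_comp.
rewrite -[RHS](@ge0_integral_dil _ _ (-1)%R) ?oppr_eq0//.
- rewrite normrN1 mul1e; apply: eq_integral => x _; rewrite mulN1r.
  by rewrite !normal_pdfE// /normal_fun !subr0 sqrrN.
- by apply: emeasurable_funM => //; exact/measurable_EFinP.
- by move=> x; rewrite mule_ge0 ?lee_fin.
Qed.

(** The product density depends only on [y ^+ 2 + z ^+ 2], which leaves Lebesgue measure in the
    plane. There the rotation splits into one-dimensional affine substitutions: at fixed [y] the
    first rotated coordinate replaces [z]; after Tonelli, at fixed first coordinate, the second one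
    replaces [y]. The two Jacobians cancel. *)
Lemma ge0_integral_gauss_rotation (G : measurableTypeR R * measurableTypeR R -> \bar R) (c s : R) :
  measurable_fun setT G -> (forall z, 0 <= G z) -> (c ^+ 2 + s ^+ 2 = 1)%R ->
  \int[gauss]_y \int[gauss]_z G (c * y + s * z, - s * y + c * z)%R =
  \int[gauss]_y \int[gauss]_z G (y, z).
Proof.
move=> mG G0 cs1.
have mlin a b : measurable_fun setT
   (fun y : measurableTypeR R * measurableTypeR R => (a * y.1 + b * y.2)%R : measurableTypeR R).
  by apply: measurable_funD; apply: measurable_funM.
have mlin2 a b a' b' : measurable_fun setT
   (fun y : measurableTypeR R * measurableTypeR R =>
      ((a * y.1 + b * y.2)%R, (a' * y.1 + b' * y.2)%R) : measurableTypeR R * measurableTypeR R).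
  by apply/measurable_fun_pairP; split; exact: mlin.
have mGl (a b a' b' : R) : measurable_fun setT
   (fun y : measurableTypeR R * measurableTypeR R => G ((a * y.1 + b * y.2)%R, (a' * y.1 + b' * y.2)%R)).
  exact: (measurableT_comp mG (mlin2 _ _ _ _)).
pose W (z : measurableTypeR R * measurableTypeR R) := G z * (pdf z.1 * pdf z.2)%:E.
have mW : measurable_fun setT W.
  apply: emeasurable_funM => //; apply/measurable_EFinP/measurable_funM.
    exact: measurableT_comp.
  exact: measurableT_comp.
have W0 z : 0 <= W z by rewrite mule_ge0 ?lee_fin ?mulr_ge0.
have mWl (a b a' b' : R) : measurable_fun setT
   (fun y : measurableTypeR R * measurableTypeR R => W ((a * y.1 + b * y.2)%R, (a' * y.1 + b' * y.2)%R)).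
  exact: (measurableT_comp mW (mlin2 _ _ _ _)).
have dens (H : measurableTypeR R * measurableTypeR R -> \bar R) :
    measurable_fun setT H -> (forall z, 0 <= H z) ->
    \int[gauss]_y \int[gauss]_z H (y, z) =
    \int[mu]_y \int[mu]_z (H (y, z) * (pdf y * pdf z)%:E).
  move=> mH H0; rewrite ge0_integral_gauss; first last.
  - by move=> x; exact: integral_ge0.
  - exact: (@measurable_fun_fubini_tonelli_F _ _ _ _ _ gauss _ mH).
  apply: eq_integral => y _.
  have mHy := measurableT_comp mH (pair1_measurable y).
  rewrite ge0_integral_gauss// muleC -ge0_integralZl//; first last.
  - by rewrite lee_fin.
  - by move=> x _; rewrite mule_ge0 ?lee_fin.
  - by apply: emeasurable_funM => //; exact/measurable_EFinP.
  by apply: eq_integral => z _; rewrite EFinM muleCA.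
rewrite (dens _ mG G0).
transitivity (\int[mu]_y \int[mu]_z W ((c * y + s * z)%R, (- s * y + c * z)%R)).
  have /= -> := dens _ (mGl c s (- s)%R c) (fun=> G0 _).
  apply: eq_integral => y _; apply: eq_integral => z _; rewrite /W/=.
  congr (_ * _%:E); rewrite !normal_pdfE// /normal_fun !subr0.
  rewrite mulrACA -expRD [RHS]mulrACA -expRD; congr (_ * expR _)%R.
  rewrite -!mulrDl -!opprD; congr (- _ / _)%R.
  have -> : ((c * y + s * z) ^+ 2 + (- s * y + c * z) ^+ 2 =
    (c ^+ 2 + s ^+ 2) * (y ^+ 2 + z ^+ 2))%R by ring.
  by rewrite cs1 mul1r.
(* The substitution divides by [s]. When [s = 0], [c] is 1 or -1 and the rotation is the identity or
   reflects both coordinates. *)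
have [s0|s0] := eqVneq s 0%R.
  move: cs1; rewrite s0 expr0n addr0 => /eqP; rewrite sqrf_eq1 => /orP[]/eqP ->.
    by apply: eq_integral => y _; apply: eq_integral => z _;
      rewrite !mul1r !mul0r oppr0 !mul0r add0r addr0.
  pose V y := \int[mu]_z W (y, z).
  have mV : measurable_fun setT V.
    exact: (@measurable_fun_fubini_tonelli_F _ _ _ _ _ mu _ mW).
  have V0 y : 0 <= V y by exact: integral_ge0.
  rewrite -[RHS](@ge0_integral_dil _ V (-1)%R) ?oppr_eq0// normrN1 mul1e.
  apply: eq_integral => y _.
  have mWy := measurableT_comp mW (pair1_measurable (-1 * y)%R).
  rewrite -[RHS](@ge0_integral_dil _ (fun z => W ((-1 * y)%R, z)) (-1)%R) ?oppr_eq0//.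
  rewrite normrN1 mul1e; apply: eq_integral => z _.
  by rewrite !mul0r oppr0 !mul0r add0r addr0.
(* Here [a] is the first rotated coordinate, so [z = (a - c * y) / s]; as [c ^+ 2 + s ^+ 2 = 1], the
   second rotated coordinate is [(c * a - y) / s]. *)
pose P (a y : R) := W (a, (- s * y + c * ((a - c * y) / s))%R).
have PE (a y : R) : P a y = W ((1 * a + 0 * y)%R, (c / s * a + - s^-1 * y)%R).
  rewrite /P; congr (W (_, _)); first by rewrite mul1r mul0r addr0.
  transitivity (c / s * a - (c ^+ 2 + s ^+ 2) / s * y)%R; first by field.
  by rewrite cs1; field.
have mP : measurable_fun setT
    (fun ay : measurableTypeR R * measurableTypeR R => P ay.1 ay.2).
  rewrite (_ : (fun _ => _) = fun ay : measurableTypeR R * measurableTypeR R =>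
    W ((1 * ay.1 + 0 * ay.2)%R, (c / s * ay.1 + - s^-1 * ay.2)%R)); first exact: mWl.
  by apply/funext => ay; rewrite PE.
have mPy y : measurable_fun setT (fun a : measurableTypeR R => P a y).
  exact: (measurableT_comp mP (pair2_measurable y)).
have mPa a : measurable_fun setT (fun y : measurableTypeR R => P a y).
  exact: (measurableT_comp mP (pair1_measurable a)).
have P0 a y : 0 <= P a y by exact: W0.
have ns0 : (0 < `|s|^-1)%R by rewrite invr_gt0 normr_gt0.
have nsK : (`|s|^-1)%:E * (`|s|)%:E = 1.
  by rewrite -EFinM mulVf// normr_eq0.
transitivity (\int[mu]_y ((`|s|^-1)%:E * \int[mu]_a P a y)).
  apply: eq_integral => y _.
  rewrite -(ge0_integral_shift (c * y)%R (mPy y) (P0 ^~ y)).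
  have := @ge0_integral_dil _ (fun a => P (a + c * y)%R y) s.
  move=> <- //; last by apply: (measurableT_comp (mPy y)); exact: measurable_funD.
  rewrite muleA nsK mul1e; apply: eq_integral => z _; rewrite /P.
  congr (W (_, _)); first by rewrite addrC.
  by rewrite addrK mulrC (mulrC s) mulfK// (mulrC y).
rewrite ge0_integralZl//; first last.
- by move=> y _; exact: integral_ge0.
- exact: (@measurable_fun_fubini_tonelli_G _ _ _ _ _ mu _ mP).
have F := @fubini_tonelli _ _ (measurableTypeR R) (measurableTypeR R) R
  (@lebesgue_measure R) (@lebesgue_measure R) _ mP (fun=> P0 _ _).
transitivity ((`|s|^-1)%:E * \int[mu]_a \int[mu]_y P a y).
  exact: (congr1 (fun z => (`|s|^-1)%:E * z) (esym F)).
have mFP := @measurable_fun_fubini_tonelli_F _ _ (measurableTypeR R)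
  (measurableTypeR R) R (@lebesgue_measure R) _ mP (fun=> P0 _ _).
have ns0' : 0 <= (`|s|^-1)%:E by rewrite lee_fin ltW.
have F0 a : [set: R] a -> 0 <= \int[mu]_y P a y by move=> _; exact: integral_ge0.
have E := ge0_integralZl mu (@measurableT _ (measurableTypeR R)) mFP F0 ns0'.
apply: (etrans (esym E)).
apply: eq_integral => a _.
have mWa := measurableT_comp mW (pair1_measurable a).
rewrite -[RHS](ge0_integral_shift (c / s * a)%R mWa (fun x => W0 _)).
rewrite -[RHS](@ge0_integral_dil _ (fun y => W (a, y + c / s * a)%R) (- s^-1)%R).
- rewrite normrN normfV; apply: (congr1 (fun z => (`|s|^-1)%:E * z)); apply: eq_integral => y _.
  by rewrite PE mul1r mul0r addr0 addrC.
- by apply: (measurableT_comp mWa); exact: measurable_funD.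
- by [].
- by rewrite oppr_eq0 invr_eq0.
Qed.

End symmetries.

(** The integrand is dominated by a multiple of the normal density of variance 2. The third moment
    is the one that the cubic Taylor remainder requires, and it controls the first two. *)
Lemma gauss_moment3 : gauss.-integrable setT (fun y : R => (`|y| ^+ 3)%:E).
Proof.
have mn k : measurable_fun [set: R] (fun y : R => (`|y| ^+ k)%:E).
  by apply/measurable_EFinP; apply: measurable_funX; exact: normr_measurable.
apply/integrableP; split; first exact: mn.
under eq_integral do rewrite gee0_abs ?lee_fin ?exprn_ge0//.
have m0 (x : R) : (0 <= (`|x| ^+ 3)%:E)%E by rewrite lee_fin exprn_ge0.
rewrite (ge0_integral_gauss (mn 3%N) m0).
pose q : R := Num.sqrt 2.
have q0 : q != 0 by rewrite sqrtr_eq0 -ltNge.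
(* 65 is 1 + 64: for [a >= 0], [a ^+ 3 <= 1 + a ^+ 4] and [a ^+ 4 <= 64 * (1 + a ^+ 2 / 8) ^+ 2],
   while [(1 + a ^+ 2 / 8) ^+ 2 <= expR (a ^+ 2 / 4)]. *)
pose C : R := 65 * normal_peak 1 * (normal_peak q)^-1.
have C0 : 0 <= C by rewrite !mulr_ge0 ?normal_peak_ge0// invr_ge0 normal_peak_ge0.
apply: (@le_lt_trans _ _ (\int[mu]_x (C%:E * (normal_pdf 0 q x)%:E)))%E; last first.
  have mq : measurable_fun setT (fun x : R => (normal_pdf 0 q x)%:E).
    by apply/measurable_EFinP; exact: measurable_normal_pdf.
  rewrite (ge0_integralZl mu (@measurableT _ (measurableTypeR R)) mq)//.
    by rewrite integral_normal_pdf mule1 ltry.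
  by move=> x _; rewrite lee_fin normal_pdf_ge0.
apply: le_integral_ge0 => x _.
  by rewrite mule_ge0 ?lee_fin ?exprn_ge0.
rewrite -!EFinM lee_fin !normal_pdfE// /C /normal_fun !subr0.
rewrite sqr_sqrtr// expr1n mulrCA.
have -> : 65 * normal_peak 1 * (normal_peak q)^-1 *
   (normal_peak q * expR (- x ^+ 2 / (2 *+ 2))) =
   normal_peak 1 * (65 * expR (- x ^+ 2 / (2 *+ 2))) :> R.
  by field; rewrite gt_eqF// normal_peak_gt0.
rewrite ler_wpM2l ?normal_peak_ge0//.
have -> : - x ^+ 2 / (1 *+ 2) = - x ^+ 2 / (2 *+ 2) + - x ^+ 2 / (2 *+ 2) :> R by field.
rewrite expRD mulrA ler_wpM2r ?expR_ge0//.
have -> : - x ^+ 2 / (2 *+ 2) = - (x ^+ 2 / 4) :> R by field.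
rewrite expRN ler_pdivrMr ?expR_gt0//.
have t0 : 0 <= x ^+ 2 / 8 by rewrite divr_ge0// sqr_ge0.
have h1 := expR_ge1Dx (x ^+ 2 / 8).
have -> : x ^+ 2 / 4 = x ^+ 2 / 8 + x ^+ 2 / 8 by field.
rewrite expRD.
have : `|x| ^+ 2 = x ^+ 2 by rewrite real_normK// num_real.
set a := `|x|; have a0 : 0 <= a by exact: normr_ge0.
move=> ax; move: t0 h1; rewrite -ax; set e := expR _ => t0 h1.
have h2 : (1 + a ^+ 2 / 8) * (1 + a ^+ 2 / 8) <= e * e.
  by apply: ler_pM => //; rewrite addr_ge0.
apply: (@le_trans _ _ (65 * ((1 + a ^+ 2 / 8) * (1 + a ^+ 2 / 8)))); last first.
  by rewrite ler_wpM2l.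
have : a ^+ 3 <= 1 + a ^+ 4.
  have [a1|a1] := leP a 1.
    by rewrite (@le_trans _ _ 1)// ?exprn_ile1// lerDl exprn_ge0.
  by rewrite (@le_trans _ _ (a ^+ 4))// ?lerDr// ler_eXn2l// ltW.
have : 0 <= a ^+ 2 by rewrite exprn_ge0.
have -> : a ^+ 4 = a ^+ 2 * a ^+ 2 by ring.
set b := a ^+ 2; nra.
Qed.

End gaussian.

(** * Fubini for real-valued integrals *)

Section Rintegral_product.
Context d1 d2 (T1 : measurableType d1) (T2 : measurableType d2) (R : realType).
Variable m1 : {sigma_finite_measure set T1 -> \bar R}.
Variable m2 : {sigma_finite_measure set T2 -> \bar R}.
Variable f : T1 * T2 -> R.
Hypothesis mf : measurable_fun setT f.

(** Positive and negative parts have integrals measurable in [x] by Tonelli, and [fine] of the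
    difference is measurable too, default values included. *)
Lemma measurable_Rintegral_param :
  measurable_fun setT (fun x => \int[m2]_y f (x, y)).
Proof.
have mEf : measurable_fun setT (EFin \o f) by exact/measurable_EFinP.
apply: measurableT_comp; first exact: fine_measurable.
under eq_fun do rewrite integralE.
apply: emeasurable_funB.
  rewrite (_ : (fun x => _) = fubini_F m2 ((EFin \o f)^\+)%E); last first.
    by apply/funext => x; apply: eq_integral => y _; rewrite !funeposE.
  exact: (measurable_fun_fubini_tonelli_F _ (measurable_funepos mEf)).
rewrite (_ : (fun x => _) = fubini_F m2 ((EFin \o f)^\-)%E); last first.
  by apply/funext => x; apply: eq_integral => y _; rewrite !funenegE.
exact: (measurable_fun_fubini_tonelli_F _ (measurable_funeneg mEf)).
Qed.

Hypothesis fi : (m1 \x m2)%E.-integrable setT (EFin \o f).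

Lemma integrable_Rintegral_param :
  m1.-integrable setT (EFin \o (fun x => \int[m2]_y f (x, y))).
Proof.
apply: (@le_integrable _ _ _ _ _ measurableT _ (fun x => \int[m2]_y (f (x, y))%:E)%E).
- exact/measurable_EFinP/measurable_Rintegral_param.
- move=> x _; rewrite /Rintegral /=; case: (integral _ _ _) => [r| |] //=.
  1,2: by rewrite normr0 leey.
- exact: integrable_fubini_F fi.
Qed.

(** The inner [fine] is harmless because the inner integral is finite for almost every [x]. *)
Lemma Rintegral_Rintegral_param :
  \int[m1]_x \int[m2]_y f (x, y) = \int[(m1 \x m2)%E]_z f z.
Proof.
congr fine; rewrite -(integral12_prod_meas1 fi); apply: integral_eq_ae.
apply: filterS (ae_integrable1 fi) => x /integrable_fin_num fx _.
by rewrite /Rintegral fineK// fx.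
Qed.

End Rintegral_product.

Section Rintegral_swap.
Context d1 d2 (T1 : measurableType d1) (T2 : measurableType d2) (R : realType).
Variable m1 : {sigma_finite_measure set T1 -> \bar R}.
Variable m2 : {sigma_finite_measure set T2 -> \bar R}.

Lemma Rintegral_fubini (f : T1 * T2 -> R) :
  (m1 \x m2)%E.-integrable setT (EFin \o f) ->
  \int[m1]_x \int[m2]_y f (x, y) = \int[m2]_y \int[m1]_x f (x, y).
Proof.
move=> fi; rewrite Rintegral_Rintegral_param//; congr fine.
rewrite -(integral21_prod_meas1 fi); apply: integral_eq_ae.
apply: filterS (ae_integrable2 fi) => x /integrable_fin_num fx _.
by rewrite /Rintegral fineK// fx.
Qed.

End Rintegral_swap.

Section gauss_expectation.
Context {R : realType}.
Implicit Types (g h : R -> R).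

Lemma gauss_integrable_bounded g K : measurable_fun setT g ->
  (forall y, `|g y| <= K) -> (@gauss R).-integrable setT (EFin \o g).
Proof.
move=> mg gK; apply: measurable_bounded_integrable => //.
  by apply: fin_num_fun_lty; exact: fin_num_measure.
exists K; split; first exact: num_real.
by move=> M KM y _ /=; apply: le_trans (gK y) _; exact: ltW.
Qed.

Lemma gauss_cst (K : R) : \int[@gauss R]_y K = K.
Proof.
rewrite Rintegral_cst//=.
by rewrite (_ : normal_prob _ _ _ = 1%E) ?mulr1//; exact: (@probability_setT _ _ _ (@gauss R)).
Qed.

Lemma gauss_norm_le g K : measurable_fun setT g ->
  (forall y, `|g y| <= K) -> `|\int[@gauss R]_y g y| <= K.
Proof.
move=> mg gK; apply: le_trans (le_normr_Rintegral measurableT (gauss_integrable_bounded mg gK)) _.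
rewrite -[leRHS](gauss_cst K); apply: le_Rintegral => //.
- apply: (gauss_integrable_bounded (K := K)) => [|y]; last by rewrite normr_id.
  exact: measurableT_comp.
- by apply: (gauss_integrable_bounded (K := `|K|)).
Qed.

Let EFin_gauss_addK g K : measurable_fun setT g -> (forall y, `|g y| <= K) ->
  (\int[@gauss R]_y (g y + K)%:E)%E = (\int[@gauss R]_y g y + K)%:E.
Proof.
move=> mg gK; have ig := gauss_integrable_bounded mg gK.
have iK : (@gauss R).-integrable setT (EFin \o (fun=> K)).
  by apply: (gauss_integrable_bounded (K := `|K|)).
rewrite -[in RHS](gauss_cst K) -RintegralD// /Rintegral fineK//.
have := integrable_fin_num measurableT (integrableD measurableT ig iK).
exact.
Qed.

Lemma gauss_rotation (G : measurableTypeR R * measurableTypeR R -> R) (K c s : R) :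
  measurable_fun setT G -> (forall z, `|G z| <= K) -> c ^+ 2 + s ^+ 2 = 1 ->
  \int[@gauss R]_y \int[@gauss R]_z G (c * y + s * z, - s * y + c * z) =
  \int[@gauss R]_y \int[@gauss R]_z G (y, z).
Proof.
move=> mG GK cs1.
have mrot : measurable_fun setT (fun y : measurableTypeR R * measurableTypeR R =>
      (c * y.1 + s * y.2, - s * y.1 + c * y.2) : measurableTypeR R * measurableTypeR R).
  by apply/measurable_fun_pairP; split; apply: measurable_funD; apply: measurable_funM.
(* Adding the bound [K] makes the integrand nonnegative; on a probability space this only adds [K]
   to the integral. *)
pose H z := (G z + K)%:E.
have mH : measurable_fun setT H by exact/measurable_EFinP/measurable_funD.
have H0 z : (0 <= H z)%E.
  by rewrite lee_fin -lerBlDr sub0r (lerNnormlW _)//.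
have step (G' : measurableTypeR R * measurableTypeR R -> R) : measurable_fun setT G' ->
    (forall z, `|G' z| <= K) ->
    (\int[@gauss R]_y \int[@gauss R]_z (G' (y, z) + K)%:E)%E =
    (\int[@gauss R]_y \int[@gauss R]_z G' (y, z) + K)%:E.
  move=> mG' GK'.
  have mGy y := measurableT_comp mG' (pair1_measurable y).
  transitivity (\int[@gauss R]_y (\int[@gauss R]_z G' (y, z) + K)%:E)%E.
    by apply: eq_integral => y _; exact: EFin_gauss_addK (mGy y) (fun=> GK' _).
  apply: EFin_gauss_addK.
    exact: (@measurable_Rintegral_param _ _ _ _ _ (@gauss R) G' mG').
  by move=> y; exact: gauss_norm_le (mGy y) (fun=> GK' _).
have := ge0_integral_gauss_rotation mH H0 cs1.
have /= -> := step _ (measurableT_comp mG mrot) (fun=> GK _).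
by rewrite (step G mG GK) => -[] /addIr.
Qed.

End gauss_expectation.

Section averaging.
Context {R : realType} {d : nat}.
Implicit Types (psi : 'rV[R]_d -> R) (x z v w : 'rV[R]_d) (K : R) (vs ws : seq 'rV[R]_d).

(** Bounded Lipschitz functions are measurable, integrable against any probability, and stable under
    Gaussian averages, shifts and linear combinations, so the averages below always converge. *)
Definition blip K psi := [/\ 0 <= K, forall x, `|psi x| <= K &
  forall x y, `|psi x - psi y| <= K * norm1 (x - y)].

Lemma blip_measurable K psi : blip K psi -> measurable_fun setT psi.
Proof.
move=> [K0 _ L]; apply: continuous_measurable_rV => x.
apply/(@cvgrPdist_le _ _ _ _ (nbhs_filter x)) => e e0.
have Kd : 0 < K * d%:R + 1 by rewrite ltr_pwDr// mulr_ge0.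
near=> y; apply: le_trans (L x y) _.
have xy : `|x - y| <= e / (K * d%:R + 1).
  by near: y; apply: cvgr_dist_le; rewrite ?divr_gt0//; exact: cvg_id.
apply: (@le_trans _ _ (K * (d%:R * `|x - y|))).
  rewrite ler_wpM2l// /norm1 -[d in d%:R]card_ord -sum1_card natr_sum mulr_suml.
  apply: ler_sum => i _; rewrite mul1r /Num.norm/= mx_normrE.
  exact: (le_bigmax _ (fun p => `|(x - y) p.1 p.2|) (ord0, i)).
rewrite mulrA; apply: (@le_trans _ _ ((K * d%:R + 1) * `|x - y|)).
  by rewrite ler_wpM2r// lerDl.
by rewrite mulrC -ler_pdivlMr.
Unshelve. all: by end_near. Qed.

Definition gavg v psi x : R := \int[@gauss R]_y psi (x + y *: v).

Lemma measurable_affine_rV z v :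
  measurable_fun setT (fun y : R => z + y *: v).
Proof.
apply/measurable_fun_rVP => i; under eq_fun do rewrite !mxE.
by apply: measurable_funD => //; exact: measurable_funM.
Qed.

Lemma gavg_measurable K psi z v : blip K psi -> measurable_fun setT (fun y : R => psi (z + y *: v)).
Proof. move=> /blip_measurable mpsi; exact: (measurableT_comp mpsi (measurable_affine_rV z v)). Qed.

Lemma gavg_integrable K psi z v : blip K psi ->
  (@gauss R).-integrable setT (EFin \o (fun y : R => psi (z + y *: v))).
Proof.
move=> h; apply: gauss_integrable_bounded; first exact: gavg_measurable h.
by case: h => _ + _ y; apply.
Qed.

Lemma blip_gavg K psi v : blip K psi -> blip K (gavg v psi).
Proof.
move=> h; have mp z := gavg_measurable z v h; have ip z := gavg_integrable z v h.
case: h => K0 bK lK; split=> // [x|x y]; first exact: gauss_norm_le.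
rewrite /gavg -RintegralB//; apply: gauss_norm_le; first exact: measurable_funB.
by move=> t; apply: le_trans (lK _ _) _; rewrite opprD addrACA subrr addr0.
Qed.

Lemma gavg0 psi : gavg 0 psi = psi.
Proof.
by apply/funext => x; rewrite /gavg; under eq_Rintegral do rewrite scaler0 addr0; exact: gauss_cst.
Qed.

Lemma gavg_rotation K psi v w (c s : R) : blip K psi -> c ^+ 2 + s ^+ 2 = 1 ->
  gavg (c *: v + s *: w) (gavg (- s *: v + c *: w) psi) = gavg v (gavg w psi).
Proof.
move=> h cs1; apply/funext => x; rewrite /gavg.
pose G (z : measurableTypeR R * measurableTypeR R) := psi (x + z.1 *: v + z.2 *: w).
have mG : measurable_fun setT G.
  apply: (measurableT_comp (blip_measurable h)).
  apply/measurable_fun_rVP => i; under eq_fun do rewrite !mxE.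
  by repeat (apply: measurable_funD || apply: measurable_funM).
have GK (z : measurableTypeR R * measurableTypeR R) : `|G z| <= K.
  by rewrite /G; case: h => _ bK _; exact: bK.
(* In terms of [v] and [w] the displacement has coordinates [c * y - s * z] and [s * y + c * z]: the
   rotation by the opposite angle. *)
have cs1' : c ^+ 2 + (- s) ^+ 2 = 1 by rewrite sqrrN.
apply: etrans (gauss_rotation mG GK cs1').
apply: eq_Rintegral => y _; apply: eq_Rintegral => z _; congr psi.
by apply/rowP => i; rewrite !mxE /=; ring.
Qed.

Definition gavgs vs psi := foldr gavg psi vs.

Lemma gavgs_cat vs ws psi : gavgs (vs ++ ws) psi = gavgs vs (gavgs ws psi).
Proof. exact: foldr_cat. Qed.

Lemma blip_gavgs K psi vs : blip K psi -> blip K (gavgs vs psi).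
Proof. by move=> h; elim: vs => //= v vs; exact: blip_gavg. Qed.

Lemma gavgs0 vs psi : (forall v, v \in vs -> v = 0) -> gavgs vs psi = psi.
Proof.
elim: vs => //= v vs IH vs0; rewrite IH => [|w wvs]; last by apply: vs0; rewrite inE wvs orbT.
have -> : v = 0 by apply: vs0; rewrite inE eqxx.
exact: gavg0.
Qed.

Lemma gavgsB K psi K' psi' vs x : blip K psi -> blip K' psi' ->
  gavgs vs psi x - gavgs vs psi' x = gavgs vs (psi \- psi') x.
Proof.
move=> h h'; elim: vs x => //= v vs IH x.
rewrite /gavg -RintegralB//.
- by apply: eq_Rintegral => y _; exact: IH.
- exact: gavg_integrable (blip_gavgs vs h).
- exact: gavg_integrable (blip_gavgs vs h').
Qed.

Lemma blip_lincomb K psi K' psi' a b : blip K psi -> blip K' psi' ->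
  blip (`|a| * K + `|b| * K') (fun x => a * psi x + b * psi' x).
Proof.
move=> [K0 bK lK] [K0' bK' lK']; split=> [|x|x y].
- by rewrite addr_ge0 ?mulr_ge0.
- by apply: le_trans (ler_normD _ _) _; rewrite !normrM lerD ?ler_wpM2l.
- rewrite opprD addrACA -!mulrBr; apply: le_trans (ler_normD _ _) _.
  by rewrite !normrM mulrDl -!mulrA lerD ?ler_wpM2l.
Qed.

Lemma gavgs_lincomb K psi K' psi' a b vs x : blip K psi -> blip K' psi' ->
  gavgs vs (fun x => a * psi x + b * psi' x) x = a * gavgs vs psi x + b * gavgs vs psi' x.
Proof.
move=> h h'; elim: vs x => //= v vs IH x.
have i := gavg_integrable x v (blip_gavgs vs h).
have i' := gavg_integrable x v (blip_gavgs vs h').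
rewrite /gavg -!RintegralZl// -RintegralD//.
- by apply: eq_Rintegral => y _; exact: IH.
- exact: (integrableZl measurableT a i).
- exact: (integrableZl measurableT b i').
Qed.

Lemma gavgs_le K psi vs M x : blip K psi -> (forall x, `|psi x| <= M) -> `|gavgs vs psi x| <= M.
Proof.
move=> h hM; elim: vs x => [|v vs IH] x //=.
by apply: gauss_norm_le; first exact: gavg_measurable (blip_gavgs vs h).
Qed.

Lemma gavgs_shift vs psi w x : gavgs vs (fun x => psi (x + w)) x = gavgs vs psi (x + w).
Proof.
elim: vs x => //= v vs IH x; apply: eq_Rintegral => y _.
by rewrite IH addrAC.
Qed.

End averaging.

(** * Cholesky factors *)

Section cholesky.
Context {R : realType} {d : nat}.
Implicit Types (A B : 'M[R]_d) (v w x y : 'rV[R]_d) (vs ws : seq 'rV[R]_d)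
  (k i j : 'I_d) (ks : seq 'I_d).

Definition sqmx v : 'M[R]_d := v^T *m v.

(** Up to the factor [gvar], the covariance matrix of the Gaussian combination of the directions
    [vs]. *)
Definition gram vs : 'M[R]_d := \sum_(v <- vs) sqmx v.

Lemma sqmxE v i j : sqmx v i j = v ord0 i * v ord0 j.
Proof. by rewrite !mxE big_ord1 mxE. Qed.

Lemma gram_cons v vs : gram (v :: vs) = sqmx v + gram vs.
Proof. by rewrite /gram big_cons. Qed.

Lemma gram_cat vs ws : gram (vs ++ ws) = gram vs + gram ws.
Proof. by rewrite /gram big_cat. Qed.

Lemma gramE vs i j : gram vs i j = \sum_(v <- vs) v ord0 i * v ord0 j.
Proof. by rewrite /gram summxE; apply: eq_bigr => v _; rewrite sqmxE. Qed.

Let sqmx_rotation v w (c s : R) : c ^+ 2 + s ^+ 2 = 1 ->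
  sqmx (c *: v + s *: w) + sqmx (- s *: v + c *: w) = sqmx v + sqmx w.
Proof.
move=> cs1; apply/matrixP => i j; rewrite [LHS]mxE [RHS]mxE !sqmxE !mxE.
by rewrite -[RHS]mul1r -cs1; ring.
Qed.

(** Plane rotations, applied to two directions at a time, gather the whole [k]-th coordinate in one
    vector; they preserve the average and the Gram matrix. The last clause keeps coordinates cleared
    earlier at zero. *)
Let gavgs_elim k vs : exists v ws,
  [/\ forall K (psi : 'rV[R]_d -> R), blip K psi -> gavgs vs psi = gavgs (v :: ws) psi,
      gram vs = gram (v :: ws),
      forall w, w \in ws -> w ord0 k = 0,
      0 <= v ord0 k &
      forall j, (forall w, w \in vs -> w ord0 j = 0) ->
        forall w, w \in v :: ws -> w ord0 j = 0].
Proof.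
elim: vs => [|v vs [v1 [ws [IH1 IH2 IH3 IH4 IH5]]]].
  exists 0, [::]; split => //; rewrite ?mxE//.
  - by move=> K psi _; rewrite /= gavg0.
  - by rewrite gram_cons [sqmx 0]mulmx0 add0r.
  - by move=> j _ w; rewrite inE => /eqP ->; rewrite mxE.
have h K psi : blip K psi ->
    gavgs (v :: vs) psi = gavg v (gavg v1 (gavgs ws psi)) by move=> /IH1 /= ->.
pose rho := Num.sqrt (v ord0 k ^+ 2 + v1 ord0 k ^+ 2).
have rho2 : rho ^+ 2 = v ord0 k ^+ 2 + v1 ord0 k ^+ 2.
  by rewrite sqr_sqrtr// addr_ge0// sqr_ge0.
(* If [rho = 0] both [k]-th coordinates vanish and no rotation is called for; otherwise [rho] is the
   [k]-th coordinate of the rotated first vector. *)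
have [rho0|rho0] := eqVneq rho 0.
  move: rho2; rewrite rho0 expr0n/= => /esym/eqP.
  rewrite paddr_eq0 ?sqr_ge0// !sqrf_eq0 => /andP[/eqP vk /eqP v1k].
  exists v, (v1 :: ws); split.
  - by move=> K psi hpsi; exact: (h K psi hpsi).
  - by rewrite !gram_cons IH2 gram_cons.
  - by move=> w; rewrite inE => /orP[/eqP ->//|/IH3].
  - by rewrite vk.
  - move=> j hj w; rewrite inE => /orP[/eqP ->|]; first by apply: hj; rewrite inE eqxx.
    by apply: IH5 => u uvs; apply: hj; rewrite inE uvs orbT.
pose c := v ord0 k / rho; pose s := v1 ord0 k / rho.
have cs1 : c ^+ 2 + s ^+ 2 = 1.
  by rewrite /c /s !exprMn -mulrDl -rho2 exprVn mulfV// sqrf_eq0.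
exists (c *: v + s *: v1), ((- s *: v + c *: v1) :: ws); split.
- move=> K psi hpsi; apply: etrans (h K psi hpsi) _ => /=.
  by rewrite (gavg_rotation _ _ (blip_gavgs ws hpsi)).
- by rewrite !gram_cons IH2 gram_cons !addrA sqmx_rotation.
- move=> w; rewrite inE => /orP[/eqP ->|/IH3//].
  by rewrite !mxE /s /c; field.
- rewrite !mxE /c /s mulrAC (mulrAC (v1 _ _)) -!expr2 -mulrDl -rho2.
  by rewrite expr2 mulfK// sqrtr_ge0.
- move=> j hj.
  have vj : v ord0 j = 0 by apply: hj; rewrite inE eqxx.
  have h5 : forall w, w \in v1 :: ws -> w ord0 j = 0.
    by apply: IH5 => u uvs; apply: hj; rewrite inE uvs orbT.
  have v1j : v1 ord0 j = 0 by apply: h5; rewrite inE eqxx.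
  move=> w; rewrite !inE => /or3P[/eqP ->|/eqP ->|wws]; rewrite ?mxE ?vj ?v1j ?mulr0 ?addr0//.
  by apply: h5; rewrite inE wws orbT.
Qed.

(* When the pivot [A k k] vanishes this is the zero vector, since [0^-1 = 0]. *)
Definition cvec A k : 'rV[R]_d := (Num.sqrt (A k k))^-1 *: row k A.

(** After elimination, row [k] of the Gram matrix is [v ord0 k *: v]. Since [v ord0 k >= 0], the
    vector [v] is recovered from this row when the pivot is nonzero; when it is zero, [v] joins the
    remaining directions. *)
Let gavgs_cvec k vs : exists ws,
  [/\ forall K (psi : 'rV[R]_d -> R), blip K psi ->
        gavgs vs psi = gavgs (cvec (gram vs) k :: ws) psi,
      gram ws = gram vs - sqmx (cvec (gram vs) k),
      forall w, w \in ws -> w ord0 k = 0 &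
      forall j, (forall w, w \in vs -> w ord0 j = 0) ->
        forall w, w \in ws -> w ord0 j = 0].
Proof.
have [v [ws [H1 H2 H3 H4 H5]]] := gavgs_elim k vs.
have gk j : gram vs k j = v ord0 k * v ord0 j.
  rewrite H2 gramE big_cons big_seq big1 ?addr0// => w /H3 ->.
  by rewrite mul0r.
have cE : cvec (gram vs) k = if v ord0 k == 0 then 0 else v.
  apply/rowP => j; rewrite !mxE !gk -expr2 sqrtr_sqr ger0_norm//.
  by case: eqP => [->|/eqP vk]; rewrite ?mul0r ?mulr0 ?mxE// mulKf.
rewrite cE; case: eqP => [vk|_].
  exists (v :: ws); split.
  - by move=> K psi /H1 ->; rewrite /= gavg0.
  - by rewrite -H2 [sqmx 0]mulmx0 subr0.
  - by move=> w; rewrite inE => /orP[/eqP ->|/H3].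
  - exact: H5.
exists ws; split => //.
- by rewrite H2 gram_cons addrAC subrr add0r.
- by move=> j hj w wws; apply: (H5 j hj); rewrite inE wws orbT.
Qed.

(** Cholesky factorization by successive Schur complements. A vanishing pivot contributes a zero
    vector, so the number of directions never depends on the rank. *)
Fixpoint chol_seq ks A : seq 'rV[R]_d :=
  if ks is k :: ks' then cvec A k :: chol_seq ks' (A - sqmx (cvec A k)) else [::].

Definition chol A := chol_seq (index_enum 'I_d) A.

Let gavgs_chol_seq ks vs : exists ws,
  [/\ forall K (psi : 'rV[R]_d -> R), blip K psi ->
        gavgs vs psi = gavgs (chol_seq ks (gram vs) ++ ws) psi,
      forall k w, k \in ks -> w \in ws -> w ord0 k = 0 &
      forall j, (forall w, w \in vs -> w ord0 j = 0) ->
        forall w, w \in ws -> w ord0 j = 0].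
Proof.
elim: ks vs => [|k ks IH] vs; first by exists vs.
have [ws [H1 H2 H3 H4]] := gavgs_cvec k vs.
have [us [I1 I2 I3]] := IH ws; rewrite /= -H2; exists us; split.
- by move=> K psi hpsi; rewrite (H1 K)//= (I1 K).
- move=> j w; rewrite inE => /orP[/eqP ->|jks] wus; last exact: I2.
  exact: I3 wus.
- by move=> j hj; apply: I3; exact: H4.
Qed.

(* A Gaussian average depends on its directions only through their Gram matrix. *)
Lemma gavgs_chol K (psi : 'rV[R]_d -> R) vs : blip K psi ->
  gavgs vs psi = gavgs (chol (gram vs)) psi.
Proof.
have [ws [H1 H2 _]] := gavgs_chol_seq (index_enum 'I_d) vs.
move=> hpsi; rewrite (H1 K)// gavgs_cat; congr (gavgs _ _); apply: gavgs0 => w wws.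
by apply/rowP => i; rewrite (H2 i)// ?mxE// mem_index_enum.
Qed.

Definition psd A := A^T = A /\ forall x, 0 <= (x *m A *m x^T) ord0 ord0.

Lemma psdZ (c : R) A : 0 <= c -> psd A -> psd (c *: A).
Proof.
move=> c0 [sA pA]; split=> [|x]; first by rewrite linearZ/= sA.
by rewrite -scalemxAr -scalemxAl mxE mulr_ge0.
Qed.

Let psd_sym A i j : psd A -> A i j = A j i.
Proof. by move=> [sA _]; rewrite -[in LHS]sA mxE. Qed.

(** The form on the line through [x] along axis [k]. Suitable values of [t] give the sign of the
    diagonal, the vanishing of a row with zero pivot, and the positivity of the Schur complement. *)
Let psd_line A x k (t : R) : psd A ->
  0 <= (x *m A *m x^T) ord0 ord0 + 2 * t * (row k A *m x^T) ord0 ord0 + t ^+ 2 * A k k.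
Proof.
move=> [sA pA]; pose e : 'rV[R]_d := delta_mx ord0 k; have := pA (x + t *: e).
have e1 : (x *m A *m (e)^T) ord0 ord0 = (row k A *m x^T) ord0 ord0.
  have -> : x *m A *m (e)^T = (row k A *m x^T)^T.
    by rewrite rowE -/e !trmx_mul trmxK sA mulmxA.
  by rewrite mxE.
have e2 : (e *m A *m (e)^T) ord0 ord0 = A k k.
  rewrite /e -rowE mxE (bigD1 k)//= big1 => [|i ik]; last by rewrite !mxE (negbTE ik) andbF mulr0.
  by rewrite !mxE !eqxx mulr1 addr0.
have -> : (x + t *: e) *m A *m (x + t *: e)^T =
    x *m A *m x^T + t *: (x *m A *m (e)^T)
    + (t *: (e *m A *m x^T)
    + t ^+ 2 *: (e *m A *m (e)^T)).
  rewrite linearD/= linearZ/= !mulmxDl !mulmxDr -!scalemxAl -!scalemxAr.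
  by rewrite scalerA -expr2.
move: e1 e2; rewrite /e -!rowE.
move: (x *m A *m _) (x *m A *m _) (row k A *m _) (row k A *m _) => P Q S V e1 e2.
rewrite !mxE e1 e2; congr (0 <= _); ring.
Qed.

Let psd_diag_ge0 A k : psd A -> 0 <= A k k.
Proof. by move=> /(psd_line 0 k 1); rewrite !mul0mx trmx0 mulmx0 !mxE; lra. Qed.

Let row_delta A k j : (row k A *m (delta_mx ord0 j : 'rV[R]_d)^T) ord0 ord0 = A k j.
Proof.
rewrite mxE (bigD1 j)//= big1 => [|i ij]; last by rewrite !mxE (negbTE ij) andbF mulr0.
by rewrite !mxE !eqxx mulr1 addr0.
Qed.

Let psd_diag0 A k j : psd A -> A k k = 0 -> A k j = 0.
Proof.
move=> pA Ak; have H t := psd_line (delta_mx ord0 j) k t pA.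
set q := (_ *m A *m _) ord0 ord0 in H.
(* With a zero pivot the form is affine in [t]; this [t] would give it the value -1. *)
apply: contrapT => /eqP a0; have := H (- (q + 1) / (2 * A k j)).
rewrite row_delta Ak mulr0 addr0.
have -> : 2 * (- (q + 1) / (2 * A k j)) * A k j = - (q + 1) by field.
lra.
Qed.

Let cvecE A k j : cvec A k ord0 j = (Num.sqrt (A k k))^-1 * A k j.
Proof. by rewrite !mxE. Qed.

Let schurE A k i j : psd A ->
  (A - sqmx (cvec A k)) i j = A i j - (A k k)^-1 * (A k i * A k j).
Proof.
move=> pA; rewrite [LHS]mxE [X in _ + X]mxE sqmxE !cvecE mulrACA -invfM -expr2.
by rewrite sqr_sqrtr// psd_diag_ge0.
Qed.

(** For a positive pivot the new form at [x] is the minimum of the old one on the line through [x]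
    along axis [k]; for a zero pivot nothing is subtracted. *)
Let psd_schur A k : psd A -> psd (A - sqmx (cvec A k)).
Proof.
move=> pA; split=> [|x].
  apply/matrixP => i j; rewrite mxE !schurE//.
  by rewrite (psd_sym _ _ pA) (mulrC (A k j)).
set l := (row k A *m x^T) ord0 ord0.
have -> : (x *m (A - sqmx (cvec A k)) *m x^T) ord0 ord0 =
    (x *m A *m x^T) ord0 ord0 - (A k k)^-1 * l ^+ 2.
  rewrite mulmxBr mulmxBl mxE [X in _ + X]mxE; congr (_ - _).
  have -> : x *m sqmx (cvec A k) *m x^T = (cvec A k *m x^T)^T *m (cvec A k *m x^T).
    by rewrite trmx_mul trmxK !mulmxA.
  rewrite mxE big_ord1 mxE -scalemxAl mxE -/l mulrACA -invfM -!expr2.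
  by rewrite sqr_sqrtr// psd_diag_ge0.
have := psd_line x k (- (A k k)^-1 * l) pA; rewrite -/l.
have [->|a0] := eqVneq (A k k) 0; first by rewrite invr0; congr (_ <= _); ring.
by congr (_ <= _); field.
Qed.

Let schur_row A k j : psd A -> (A - sqmx (cvec A k)) k j = 0.
Proof.
move=> pA; rewrite schurE//; have [a0|a0] := eqVneq (A k k) 0.
  by rewrite a0 mul0r mulr0 subr0 psd_diag0.
by rewrite mulKf// subrr.
Qed.

Let schur_row0 A k i : psd A -> (forall j, A i j = 0) ->
  forall j, (A - sqmx (cvec A k)) i j = 0.
Proof.
by move=> pA Ai j; rewrite schurE// Ai (psd_sym k i pA) Ai mul0r mulr0 subr0.
Qed.

Let gram_chol_seq ks A : psd A -> exists B,
  [/\ gram (chol_seq ks A) + B = A, forall k j, k \in ks -> B k j = 0 &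
      forall i, (forall j, A i j = 0) -> forall j, B i j = 0].
Proof.
elim: ks A => [|k ks IH] A pA; first by exists A; rewrite /gram big_nil add0r.
have [B [B1 B2 B3]] := IH _ (psd_schur k pA); exists B; split => [|i j|i Ai].
- by rewrite gram_cons -addrA B1 addrC subrK.
- rewrite inE => /orP[/eqP ->|iks]; last exact: B2.
  by apply: B3 => l; exact: schur_row.
- by apply: B3; exact: schur_row0.
Qed.

Lemma gram_chol A : psd A -> gram (chol A) = A.
Proof.
move=> pA; have [B [B1 B2 _]] := gram_chol_seq (index_enum 'I_d) pA.
rewrite -[RHS]B1 -[LHS]addr0; congr (_ + _); apply/matrixP => i j.
by rewrite B2 ?mem_index_enum// mxE.
Qed.

Lemma size_chol A : size (chol A) = d.
Proof.
have H ks B : size (chol_seq ks B) = size ks by elim: ks B => //= k ks IH B; rewrite IH.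
by rewrite H /index_enum -enumT size_enum_ord.
Qed.

Lemma chol0 v : v \in chol 0 -> v = 0.
Proof.
rewrite /chol; elim: (index_enum 'I_d) => //= k ks IH.
have -> : cvec 0 k = 0 by apply/rowP => j; rewrite !mxE mulr0.
by rewrite [sqmx 0]mulmx0 subr0 inE => /orP[/eqP|].
Qed.

(** Successive averages form one average over the concatenated directions, whose Gram matrix is
    [A + B]. This is the source of the semigroup law. *)
Lemma gavgs_chol_add K (psi : 'rV[R]_d -> R) A B : blip K psi -> psd A -> psd B ->
  gavgs (chol A) (gavgs (chol B) psi) = gavgs (chol (A + B)) psi.
Proof.
move=> hpsi pA pB; rewrite -gavgs_cat (gavgs_chol _ hpsi) gram_cat !gram_chol//.
Qed.

Lemma norm1_gram vs (e : R) : 0 <= e -> (forall i, gram vs i i <= e ^+ 2) ->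
  forall v, v \in vs -> norm1 v <= d%:R * e.
Proof.
move=> e0 h v vvs; rewrite /norm1 -[d in d%:R]card_ord -sum1_card natr_sum mulr_suml.
apply: ler_sum => i _; rewrite mul1r.
rewrite -(ler_pXn2r (n := 2)) ?nnegrE// real_normK ?num_real//.
apply: le_trans (h i); rewrite gramE (big_rem _ vvs)/= -expr2 lerDl.
by apply: sumr_ge0 => w _; rewrite -expr2 sqr_ge0.
Qed.

End cholesky.

(** * The heat semigroup *)

Section gauss_moments.
Context {R : realType}.

Let integrable1cube : (@gauss R).-integrable setT (fun y : R => (1 + `|y| ^+ 3)%:E).
Proof.
have h : (@gauss R).-integrable setT (EFin \o (fun=> 1)).
  by apply: (gauss_integrable_bounded (K := 1)) => // y; rewrite normr1.
by have := integrableD measurableT h gauss_moment3.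
Qed.

Let integrable_le_cube (g : R -> R) : measurable_fun setT g ->
  (forall y, `|g y| <= 1 + `|y| ^+ 3) -> (@gauss R).-integrable setT (EFin \o g).
Proof.
move=> mg gc; apply: le_integrable integrable1cube => //; first exact/measurable_EFinP.
by move=> y _; rewrite /= lee_fin; apply: le_trans (gc y) (ler_norm _).
Qed.

Let le1cube (a : R) : 0 <= a -> a <= 1 + a ^+ 3.
Proof.
move=> a0; have [a1|a1] := leP a 1; first by rewrite (le_trans a1)// lerDl exprn_ge0.
by rewrite (@le_trans _ _ (a ^+ 3)) ?lerDr// -[leLHS]expr1 ler_eXn2l// ltW.
Qed.

Let le2cube (a : R) : 0 <= a -> a ^+ 2 <= 1 + a ^+ 3.
Proof.
move=> a0; have [a1|a1] := leP a 1.
  by rewrite (@le_trans _ _ 1) ?exprn_ile1// lerDl exprn_ge0.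
by rewrite (@le_trans _ _ (a ^+ 3)) ?lerDr// ler_eXn2l// ltW.
Qed.

Lemma gauss_integrable_id : (@gauss R).-integrable setT (EFin \o (fun y : R => y)).
Proof. by apply: integrable_le_cube => // y; exact: le1cube. Qed.

Lemma gauss_integrable_norm : (@gauss R).-integrable setT (EFin \o (fun y : R => `|y|)).
Proof.
apply: integrable_le_cube => [|y]; first exact: normr_measurable.
by rewrite normr_id; exact: le1cube.
Qed.

Lemma gauss_integrable_sqr : (@gauss R).-integrable setT (EFin \o (fun y : R => y ^+ 2)).
Proof.
apply: integrable_le_cube => [|y]; first exact: measurable_funX.
by rewrite normrX; exact: le2cube.
Qed.

Lemma gauss_mean : \int[@gauss R]_y y = 0 :> R.
Proof.
rewrite /Rintegral integralE.
have -> : (\int[@gauss R]_y ((fun y : R => y%:E)^\- y) = \int[@gauss R]_y ((fun y : R => y%:E)^\+ y))%E.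
  have mp : measurable_fun setT ((fun y : R => y%:E)^\+)%E.
    by apply: measurable_funepos; exact/measurable_EFinP.
  rewrite -(ge0_integral_gaussN mp)//.
  by apply: eq_integral => y _; rewrite funeposE funenegE.
rewrite subee//; have := integrable_fin_num measurableT (integrable_funepos measurableT gauss_integrable_id).
exact.
Qed.

(** The variance is left unevaluated: only its positivity and the integrability of the square are
    used, and [heat] divides it out. *)
Definition gvar : R := \int[@gauss R]_y y ^+ 2.

Lemma gvar_gt0 : 0 < gvar.
Proof.
have h : (\int[@gauss R]_y (y ^+ 2)%:E = gvar%:E)%E.
  rewrite /gvar /Rintegral fineK//.
  by have := integrable_fin_num measurableT gauss_integrable_sqr.
have mq : measurable_fun setT (fun x : R => (x ^+ 2)%:E).
  by apply/measurable_EFinP; exact: measurable_funX.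
have q0 (x : R) : (0 <= (x ^+ 2)%:E)%E by rewrite lee_fin sqr_ge0.
rewrite -lte_fin -h (ge0_integral_gauss mq q0).
have p2 : 0 < @normal_pdf R 0 1 2.
  by rewrite normal_pdfE// mulr_gt0 ?normal_peak_gt0// expR_gt0.
(* On the interval from 1 to 2 the integrand is at least the density at 2, a positive constant. *)
apply: (@lt_le_trans _ _ (\int[lebesgue_measure]_(x in `[1%R, 2%R]) (@normal_pdf R 0 1 2)%:E)%E).
  rewrite integral_cst//= lebesgue_measure_itv/= lte_fin ltr1n -EFinB.
  by rewrite -EFinM lte_fin mulr_gt0//; lra.
have mg : measurable_fun setT (fun x : R => (x ^+ 2)%:E * (normal_pdf 0 1 x)%:E)%E.
  apply: emeasurable_funM; apply/measurable_EFinP; first exact: measurable_funX.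
  exact: measurable_normal_pdf.
apply: (@le_trans _ _ (\int[lebesgue_measure]_(x in `[1%R, 2%R]) ((x ^+ 2)%:E * (normal_pdf 0 1 x)%:E))%E).
  apply: le_integral_ge0 => x; rewrite /= in_itv/= => /andP[x1 x2].
    by rewrite lee_fin ltW.
  rewrite -EFinM lee_fin -[leLHS]mul1r ler_pM//; first exact: ltW.
    by rewrite exprn_ege1.
  rewrite !normal_pdfE// /normal_fun !subr0 ler_wpM2l ?normal_peak_ge0// ler_expR.
  rewrite ler_wpM2r// ?invr_ge0// ?expr1n// lerN2.
  by rewrite ler_pXn2r ?nnegrE//; lra.
apply: ge0_subset_integral => //.
by move=> x _; rewrite -EFinM lee_fin mulr_ge0 ?sqr_ge0// normal_pdf_ge0.
Qed.

Lemma gauss_norm_le_lin (g : R -> R) (a b : R) : measurable_fun setT g ->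
  (forall y, `|g y| <= a + b * `|y|) ->
  `|\int[@gauss R]_y g y| <= a + b * \int[@gauss R]_y `|y|.
Proof.
move=> mg gab.
have i1 : (@gauss R).-integrable setT (EFin \o (fun=> a)).
  by apply: (gauss_integrable_bounded (K := `|a|)).
have i2 := integrableZl measurableT b gauss_integrable_norm.
have i3 : (@gauss R).-integrable setT (EFin \o (fun y : R => a + b * `|y|)) by exact: (integrableD measurableT i1 i2).
have ig : (@gauss R).-integrable setT (EFin \o g).
  apply: le_integrable i3 => //; first exact/measurable_EFinP.
  by move=> y _; rewrite /= lee_fin; apply: le_trans (gab y) (ler_norm _).
apply: le_trans (le_normr_Rintegral measurableT ig) _.
rewrite -[X in X + _](gauss_cst a) -RintegralZl//; last exact: gauss_integrable_norm.
rewrite -RintegralD//; apply: le_Rintegral => //.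
exact: integrable_norm.
Qed.

Lemma gauss_norm_le_cube (g : R -> R) (b : R) : measurable_fun setT g ->
  (forall y, `|g y| <= b * `|y| ^+ 3) ->
  `|\int[@gauss R]_y g y| <= b * \int[@gauss R]_y `|y| ^+ 3.
Proof.
move=> mg gab.
have i2 := integrableZl measurableT b (@gauss_moment3 R).
have i3 : (@gauss R).-integrable setT (EFin \o (fun y : R => b * `|y| ^+ 3)) by exact: i2.
have ig : (@gauss R).-integrable setT (EFin \o g).
  apply: le_integrable i3 => //; first exact/measurable_EFinP.
  by move=> y _; rewrite /= lee_fin; apply: le_trans (gab y) (ler_norm _).
apply: le_trans (le_normr_Rintegral measurableT ig) _.
rewrite -RintegralZl//; last exact: gauss_moment3.
apply: le_Rintegral => //.
exact: integrable_norm.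
Qed.

End gauss_moments.

Section local_estimate.
Context {R : realType} {d : nat}.
Implicit Types (psi : 'rV[R]_d -> R) (x z v w : 'rV[R]_d) (K : R)
  (vs ws : seq 'rV[R]_d) (A B : 'M[R]_d).

Lemma test_function_blip n psi K : test_function psi -> 0 <= K ->
  partials_le n.+1 psi K -> blip K psi.
Proof.
move=> tp K0 pK; split=> // [x|x y]; first exact: (pK [::]).
have := lip_norm1 y (x - y) (test_function_lip (l := [::]) tp pK isT).
by rewrite (addrC y) subrK.
Qed.

Definition hess A psi x : R := \sum_i \sum_j A i j * partials [:: j; i] psi x.

Let hessD A B psi x : hess (A + B) psi x = hess A psi x + hess B psi x.
Proof.
rewrite /hess -big_split; apply: eq_bigr => i _ /=; rewrite -big_split.
by apply: eq_bigr => j _ /=; rewrite mxE mulrDl.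
Qed.

(** Integrating the Taylor expansion along [v]: the linear term has mean zero, the quadratic one
    yields [gvar / 2], and the remainder is a third moment. *)
Let gavg_local psi K v x : test_function psi -> 0 <= K -> partials_le 3 psi K ->
  `|gavg v psi x - psi x - gvar / 2 * hess (sqmx v) psi x|
    <= K * norm1 v ^+ 3 * \int[@gauss R]_y `|y| ^+ 3.
Proof.
move=> tp K0 pK.
have hpsi : blip K psi by exact: (test_function_blip (n := 2)).
pose L := \sum_i v ord0 i * partial i psi x.
pose Q := hess (sqmx v) psi x.
have iL : (@gauss R).-integrable setT (EFin \o (fun y : R => y * L)).
  by have := integrableZr measurableT L (@gauss_integrable_id R).
have iQ : (@gauss R).-integrable setT (EFin \o (fun y : R => y ^+ 2 * (Q / 2))).
  by have := integrableZr measurableT (Q / 2) (@gauss_integrable_sqr R).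
have ip := gavg_integrable x v hpsi.
have ic : (@gauss R).-integrable setT (EFin \o (fun=> psi x)).
  by apply: (gauss_integrable_bounded (K := `|psi x|)).
have i1 : (@gauss R).-integrable setT (EFin \o (fun y : R => psi (x + y *: v) - psi x)) by exact: (integrableB measurableT ip ic).
have i2 : (@gauss R).-integrable setT (EFin \o (fun y : R => psi (x + y *: v) - psi x - y * L)) by exact: (integrableB measurableT i1 iL).
have -> : gavg v psi x - psi x - gvar / 2 * Q =
    \int[@gauss R]_y (psi (x + y *: v) - psi x - y * L - y ^+ 2 * (Q / 2)).
  rewrite !RintegralB// gauss_cst RintegralZr//; last exact: gauss_integrable_id.
  rewrite gauss_mean mul0r subr0 RintegralZr//; last exact: gauss_integrable_sqr.
  by rewrite -/gvar /gavg; congr (_ - _); rewrite mulrA mulrAC.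
apply: gauss_norm_le_cube.
  by apply: measurable_funB; [apply/measurable_EFinP; exact: (measurable_int _ i2)|exact: measurable_funM].
move=> y; have := taylor2_test x (y *: v) tp K0 pK.
rewrite norm1Z exprMn.
have -> : \sum_i (y *: v) ord0 i * partial i psi x = y * L.
  by rewrite /L mulr_sumr; apply: eq_bigr => i _; rewrite mxE mulrA.
have -> : \sum_i \sum_j (y *: v) ord0 i * (y *: v) ord0 j * partials [:: j; i] psi x = y ^+ 2 * Q.
  rewrite /Q /hess mulr_sumr; apply: eq_bigr => i _; rewrite mulr_sumr.
  by apply: eq_bigr => j _; rewrite !mxE big_ord1 !mxE; ring.
by rewrite -mulrA (mulrA K) (mulrAC K) -(mulrA K).
Qed.

Let hess_lip A psi K (a : R) z w : test_function psi -> 0 <= K -> partials_le 3 psi K ->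
  (forall i j, `|A i j| <= a) ->
  `|hess A psi (z + w) - hess A psi z| <= d%:R ^+ 2 * a * K * norm1 w.
Proof.
move=> tp K0 pK Aa; rewrite /hess -sumrB.
apply: le_trans (ler_norm_sum _ _ _) _.
have -> : d%:R ^+ 2 * a * K * norm1 w = \sum_(i < d) \sum_(j < d) (a * (K * norm1 w)).
  by rewrite !sumr_const !card_ord -[RHS]mulr_natl -(mulr_natl (a * _)); ring.
apply: ler_sum => i _; rewrite -sumrB; apply: le_trans (ler_norm_sum _ _ _) _.
apply: ler_sum => j _; rewrite -mulrBr normrM ler_pM//.
exact: lip_norm1 (test_function_lip (l := [:: j; i]) tp pK _).
Qed.

(** Induction on the number of directions. The constant depends on that number but not on the
    directions, which is what a bound uniform in the matrix demands. *)
Let gavgs_local n : exists2 C : R, 0 <= C & forall vs psi K (e : R) x,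
  size vs = n -> test_function psi -> 0 <= K -> partials_le 3 psi K -> 0 <= e ->
  (forall v, v \in vs -> norm1 v <= e) ->
  `|gavgs vs psi x - psi x - gvar / 2 * hess (gram vs) psi x| <= C * K * e ^+ 3.
Proof.
have v0 := ltW (@gvar_gt0 R).
have m1 : 0 <= \int[@gauss R]_y `|y| by exact: Rintegral_ge0.
have m3 : 0 <= \int[@gauss R]_y `|y| ^+ 3 by apply: Rintegral_ge0 => y _; rewrite exprn_ge0.
elim: n => [|n [C C0 IH]].
  exists 0 => // vs psi K e x /size0nil -> tp K0 pK e0 _.
  rewrite /= subrr /hess big1 => [|i _]; first by rewrite mulr0 subrr normr0 !mul0r.
  by rewrite big1// => j _; rewrite /gram big_nil mxE mul0r.
(* [D] pays for freezing at [x] the Hessian term of the other directions: their Gram entries are at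
   most [n * e ^+ 2], and each of the [d ^+ 2] second partials is [K]-Lipschitz. *)
pose D : R := gvar / 2 * (d%:R ^+ 2 * n%:R).
have D0 : 0 <= D by rewrite !mulr_ge0// ?exprn_ge0// divr_ge0.
exists (C + D * (\int[@gauss R]_y `|y|) + \int[@gauss R]_y `|y| ^+ 3).
  by rewrite !addr_ge0// mulr_ge0.
move=> [//|v vs] psi K e x [szvs] tp K0 pK e0 hvs.
have hpsi : blip K psi by exact: (test_function_blip (n := 2)).
have ve : norm1 v <= e by apply: hvs; rewrite inE eqxx.
have hvs' w : w \in vs -> norm1 w <= e by move=> wvs; apply: hvs; rewrite inE wvs orbT.
pose Q := hess (gram vs) psi.
have Ge i j : `|gram vs i j| <= n%:R * e ^+ 2.
  rewrite gramE -szvs -(sum1_size vs) natr_sum mulr_suml.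
  apply: le_trans (ler_norm_sum _ _ _) _; rewrite big_seq [leRHS]big_seq.
  apply: ler_sum => w wvs; rewrite mul1r normrM expr2.
  have coord k : `|w ord0 k| <= e.
    apply: le_trans (hvs' w wvs); rewrite /norm1 (bigD1 k)//= lerDl.
    exact: sumr_ge0.
  exact: ler_pM.
have mp1 := gavg_integrable x v (blip_gavgs vs hpsi).
have mp2 := gavg_integrable x v hpsi.
have iQ : (@gauss R).-integrable setT (EFin \o (fun=> gvar / 2 * Q x)).
  by apply: (gauss_integrable_bounded (K := `|gvar / 2 * Q x|)).
have i1 : (@gauss R).-integrable setT (EFin \o (fun y : R => gavgs vs psi (x + y *: v) - psi (x + y *: v))) by exact: (integrableB measurableT mp1 mp2).
have H1 : `|gavg v (gavgs vs psi) x - gavg v psi x - gvar / 2 * Q x| <=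
    C * K * e ^+ 3 + D * K * e ^+ 3 * (\int[@gauss R]_y `|y|).
  have -> : gavg v (gavgs vs psi) x - gavg v psi x - gvar / 2 * Q x =
    \int[@gauss R]_y (gavgs vs psi (x + y *: v) - psi (x + y *: v) - gvar / 2 * Q x).
    by rewrite !RintegralB// gauss_cst.
  apply: gauss_norm_le_lin.
    by apply: measurable_funB => //; apply/measurable_EFinP; exact: (measurable_int _ i1).
  move=> y.
  have split3 (p q r s t : R) : p - q - t * s = (p - q - t * r) + t * (r - s) by ring.
  rewrite (split3 _ _ (Q (x + y *: v))).
  apply: le_trans (ler_normD _ _) _; apply: lerD; first exact: IH.
  rewrite normrM ger0_norm ?divr_ge0//.
  apply: (@le_trans _ _ (gvar / 2 * (d%:R ^+ 2 * (n%:R * e ^+ 2) * K * norm1 (y *: v)))).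
    by rewrite ler_wpM2l ?divr_ge0//; exact: hess_lip.
  rewrite norm1Z.
  have -> : gvar / 2 * (d%:R ^+ 2 * (n%:R * e ^+ 2) * K * (`|y| * norm1 v)) =
    (D * K * e ^+ 2 * `|y|) * norm1 v by rewrite /D; ring.
  have -> : D * K * e ^+ 3 * `|y| = (D * K * e ^+ 2 * `|y|) * e by ring.
  by rewrite ler_wpM2l// !mulr_ge0// exprn_ge0.
have H2 := gavg_local v x tp K0 pK.
rewrite gram_cons hessD /=.
have split4 (p q r s t u : R) : p - r - s * (t + u) = (p - q - s * u) + (q - r - s * t) by ring.
rewrite (split4 _ (gavg v psi x)).
apply: le_trans (ler_normD _ _) _; apply: le_trans (lerD H1 H2) _.
have alg (p q r s t u : R) : (p + s * t + u) * q * r = p * q * r + s * q * r * t + q * r * u by ring.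
rewrite alg lerD2l ler_wpM2r// ler_wpM2l// lerXn2r ?nnegrE ?norm1_ge0//.
Qed.

(* The directions are scaled so that the average is [exp (A : D^2)] formally. *)
Definition heat A psi := gavgs (chol ((2 / gvar) *: A)) psi.

Let c_ge0 : 0 <= 2 / @gvar R.
Proof. by rewrite divr_ge0// ltW// gvar_gt0. Qed.

Lemma heat_local : exists2 C : R, 0 <= C & forall A psi K (e : R) x,
  psd A -> test_function psi -> 0 <= K -> partials_le 3 psi K -> 0 <= e ->
  (forall i, A i i <= e ^+ 2) ->
  `|heat A psi x - psi x - hess A psi x| <= C * K * e ^+ 3.
Proof.
have [C C0 HC] := gavgs_local d.
have g0 := lt0r_neq0 (@gvar_gt0 R).
(* The directions factor [(2 / gvar) *: A], whose diagonal is at most [(2 / gvar) * e ^+ 2], so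
   their [norm1] is at most [r * e]. *)
pose r := d%:R * Num.sqrt (2 / @gvar R).
have r0 : 0 <= r by rewrite mulr_ge0// sqrtr_ge0.
exists (C * r ^+ 3); first by rewrite mulr_ge0// exprn_ge0.
move=> A psi K e x pA tp K0 pK e0 Ae.
have pA' := psdZ c_ge0 pA.
have := HC (chol ((2 / gvar) *: A)) psi K (r * e) x (size_chol _) tp K0 pK.
rewrite gram_chol//.
have -> : gvar / 2 * hess ((2 / gvar) *: A) psi x = hess A psi x.
  rewrite /hess mulr_sumr; apply: eq_bigr => i _; rewrite mulr_sumr.
  by apply: eq_bigr => j _; rewrite mxE; field.
have -> : C * K * (r * e) ^+ 3 = C * r ^+ 3 * K * e ^+ 3 by ring.
apply; first by rewrite mulr_ge0.
rewrite /r -mulrA; apply: norm1_gram; first by rewrite mulr_ge0// sqrtr_ge0.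
move=> i; rewrite gram_chol// mxE exprMn sqr_sqrtr// ler_wpM2l//.
Qed.

Lemma heatD K psi A B : blip K psi -> psd A -> psd B ->
  heat A (heat B psi) = heat (A + B) psi.
Proof.
by move=> hpsi pA pB; rewrite /heat (gavgs_chol_add hpsi) ?scalerDr//; exact: psdZ.
Qed.

Lemma heat0 psi : heat 0 psi = psi.
Proof. by apply: gavgs0 => v; rewrite scaler0; exact: chol0. Qed.

End local_estimate.

(** * One small step of the evolution *)

Section infinitesimal_estimate.
Context {R : realType} {d : nat}.
Implicit Types (psi phi : 'rV[R]_d -> R) (z : 'rV[R]_d).

Lemma expR_sub1_le (c E : R) : `|c| <= E -> `|expR c - 1| <= `|c| * expR E.
Proof.
move=> cE; have h1 := expR_ge1Dx c; have h2 := expR_ge1Dx (- c).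
have eE : expR `|c| <= expR E by rewrite ler_expR.
have e0 := expR_gt0 c.
have ee : expR c * expR (- c) = 1 by rewrite -expRD subrr expR0.
have [c0|c0] := leP 0 c.
  move: eE; rewrite ger0_norm// ger0_norm => [eE|]; last by rewrite subr_ge0; lra.
  apply: (@le_trans _ _ (c * expR c)); last by rewrite ler_wpM2l.
  by nra.
have E0 : 1 <= expR E.
  by rewrite -expR0 ler_expR (le_trans _ cE).
rewrite (ltr0_norm c0) ler0_norm; last by rewrite subr_le0 -expR0 ler_expR ltW.
apply: (@le_trans _ _ (- c)); first by lra.
by rewrite -[leLHS]mulr1 ler_wpM2l// oppr_ge0 ltW.
Qed.

Lemma expR_taylor1_le (c E : R) : `|c| <= E -> `|expR c - 1 - c| <= `|c| ^+ 2 * expR E.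
Proof.
move=> cE; have := @mvt_le R (fun t => expR t - t * 1) (fun t => expR t - 1) (`|c| * expR E) 0 c.
rewrite mul0r !subr0 expR0 mulr1 addrAC expr2 mulrAC; apply.
- by rewrite mulr_ge0// ?expR_ge0.
- by move=> x; exact: is_derive_sub_linear.
move=> x; rewrite subr0 => xc.
apply: le_trans (@expR_sub1_le _ E (le_trans xc cE)) _.
by rewrite ler_wpM2r// ?expR_ge0.
Qed.

Lemma hess_norm_le (A : 'M[R]_d) psi K (a : R) z : partials_le 3 psi K ->
  (forall i j, `|A i j| <= a) -> `|hess A psi z| <= d%:R ^+ 2 * a * K.
Proof.
move=> pK Aa; rewrite /hess; apply: le_trans (ler_norm_sum _ _ _) _.
have -> : d%:R ^+ 2 * a * K = \sum_(i < d) \sum_(j < d) (a * K).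
  by rewrite !sumr_const !card_ord -[RHS]mulr_natl -(mulr_natl (a * _)); ring.
apply: ler_sum => i _; apply: le_trans (ler_norm_sum _ _ _) _.
by apply: ler_sum => j _; rewrite normrM ler_pM//; exact: (pK [:: j; i]).
Qed.

Let three_le (p q r : R) : 0 <= p -> 0 <= q -> 0 <= r ->
  [/\ p <= p + q + (q + r), q <= p + q + (q + r) & q + r <= p + q + (q + r)].
Proof. by move=> *; split; lra. Qed.

(** The drift [B] is of order [e ^+ 2], so its own quadratic term and its effect on the Hessian are
    of order [e ^+ 4]; the a priori bound [e <= E] absorbs excess powers of [e] into the
    constant. *)
Let coarse phi (E : R) : test_function phi -> 0 <= E -> exists2 K : R, 0 <= K &
  forall A (B : 'rV[R]_d) (c e : R) z, psd A -> 0 <= e -> e <= E ->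
    (forall i j, `|A i j| <= e ^+ 2) -> (forall i, `|B ord0 i| <= e ^+ 2) -> `|c| <= e ^+ 2 ->
  [/\ `|heat A phi (z - B) - phi z - hess A phi z + \sum_i B ord0 i * partial i phi z| <= K * e ^+ 3,
      `|heat A phi (z - B) - phi z| <= K * e &
      `|expR c * heat A phi (z - B) - phi z| <= K * e].
Proof.
move=> tp E0; have [C C0 HC] := @heat_local R d.
have [K K0 pK] := test_function_partials_le 3 tp.
have d0 : 0 <= d%:R :> R by [].
pose K1 := C * K + (d%:R ^+ 2 * K * d%:R + K * d%:R ^+ 2) * E.
pose K2 := K1 * E ^+ 2 + d%:R ^+ 2 * K * E + d%:R * K * E.
have K10 : 0 <= K1 by rewrite addr_ge0 ?mulr_ge0// addr_ge0// !mulr_ge0// exprn_ge0.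
have K20 : 0 <= K2 by rewrite !addr_ge0 ?mulr_ge0// exprn_ge0.
have K30 : 0 <= K * E * expR (E ^+ 2) by rewrite mulr_ge0 ?expR_ge0// mulr_ge0.
exists (K1 + K2 + (K2 + K * E * expR (E ^+ 2))).
  exact: (addr_ge0 (addr_ge0 K10 K20) (addr_ge0 K20 K30)).
move=> A B c e z pA e0 eE Ae Be ce.
have Bn : norm1 (- B) <= d%:R * e ^+ 2.
  rewrite /norm1 -[d in d%:R]card_ord -sum1_card natr_sum mulr_suml.
  by apply: ler_sum => i _; rewrite mul1r mxE normrN.
have e20 : 0 <= e ^+ 2 by rewrite exprn_ge0.
have lp l : (size l < 3)%N -> lip_partials (partials l phi) K.
  exact: test_function_lip.
have H1 := HC A phi K e (z - B) pA tp K0 pK e0 (fun i => le_trans (ler_norm _) (Ae i i)).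
have H2 : `|hess A phi (z - B) - hess A phi z| <= (d%:R ^+ 2 * K * d%:R * E) * e ^+ 3.
  rewrite /hess -sumrB; apply: le_trans (ler_norm_sum _ _ _) _.
  have -> : d%:R ^+ 2 * K * d%:R * E * e ^+ 3 =
     \sum_(i < d) \sum_(j < d) (e ^+ 2 * (K * (d%:R * (E * e)))).
    by rewrite !sumr_const !card_ord -[RHS]mulr_natl -(mulr_natl (e ^+ 2 * _)); ring.
  apply: ler_sum => i _; rewrite -sumrB; apply: le_trans (ler_norm_sum _ _ _) _.
  apply: ler_sum => j _; rewrite -mulrBr normrM ler_pM//.
  apply: le_trans (lip_norm1 _ _ (lp [:: j; i] isT)) _.
  rewrite ler_wpM2l//; apply: le_trans Bn _.
  by rewrite ler_wpM2l// expr2 ler_wpM2r.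
have H3 : `|phi (z - B) - phi z + \sum_i B ord0 i * partial i phi z| <= K * d%:R ^+ 2 * E * e ^+ 3.
  have := @taylor1_norm1 R d phi K z (- B) (fun i x => test_function_derivable tp) K0 (fun i => lp [:: i] isT).
  have -> : \sum_i (- B) ord0 i * partial i phi z = - \sum_i B ord0 i * partial i phi z.
    by rewrite -sumrN; apply: eq_bigr => i _; rewrite mxE mulNr.
  rewrite opprK => /le_trans; apply.
  have -> : K * d%:R ^+ 2 * E * e ^+ 3 = K * (d%:R ^+ 2 * (E * e ^+ 3)) by ring.
  rewrite ler_wpM2l//.
  apply: (@le_trans _ _ ((d%:R * e ^+ 2) ^+ 2)).
    by rewrite lerXn2r ?nnegrE ?norm1_ge0// mulr_ge0.
  have -> : (d%:R * e ^+ 2) ^+ 2 = d%:R ^+ 2 * (e * e ^+ 3) by ring.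
  by rewrite ler_wpM2l ?exprn_ge0// ler_wpM2r// exprn_ge0.
set S := \sum_i _ in H3 *.
have X1 : `|heat A phi (z - B) - phi z - hess A phi z + S| <= K1 * e ^+ 3.
  have alg (p q r s t u : R) : p - q - r + s = (p - t - u) + (u - r) + (t - q + s) by ring.
  rewrite (alg _ _ _ _ (phi (z - B)) (hess A phi (z - B))).
  apply: le_trans (ler_normD _ _) _; apply: le_trans (lerD (ler_normD _ _) (lexx _)) _.
  apply: le_trans (lerD (lerD H1 H2) H3) _.
  by rewrite le_eqVlt; apply/orP; left; apply/eqP; rewrite /K1; ring.
have e3 : e ^+ 3 <= E ^+ 2 * e.
  by rewrite exprSr ler_wpM2r// lerXn2r ?nnegrE.
have e2 : e ^+ 2 <= E * e by rewrite expr2 ler_wpM2r.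
have X2 : `|heat A phi (z - B) - phi z| <= K2 * e.
  have alg (p q r s : R) : p - q = (p - q - r + s) + r - s by ring.
  rewrite (alg _ _ (hess A phi z) S).
  apply: le_trans (ler_normB _ _) _; apply: le_trans (lerD (ler_normD _ _) (lexx _)) _.
  rewrite /K2 2!mulrDl lerD//; first rewrite lerD//.
  - by apply: le_trans X1 _; rewrite -mulrA ler_wpM2l.
  - apply: le_trans (hess_norm_le _ pK Ae) _.
    have -> : d%:R ^+ 2 * e ^+ 2 * K = (d%:R ^+ 2 * K) * e ^+ 2 by ring.
    by rewrite -[leRHS]mulrA ler_wpM2l// mulr_ge0// exprn_ge0.
  - apply: le_trans (ler_norm_sum _ _ _) _.
    have -> : d%:R * K * E * e = \sum_(i < d) K * (E * e).
      by rewrite sumr_const card_ord -mulr_natl; ring.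
    apply: ler_sum => i _; rewrite normrM mulrC ler_pM//; first exact: (pK [:: i]).
    exact: le_trans (Be i) e2.
have X3 : `|expR c * heat A phi (z - B) - phi z| <= (K2 + K * E * expR (E ^+ 2)) * e.
  have alg (p q r : R) : p * q - r = (q - r) + (p - 1) * q by ring.
  rewrite alg; apply: le_trans (ler_normD _ _) _; rewrite [leRHS]mulrDl lerD//.
  have hb : `|heat A phi (z - B)| <= K.
    apply: (gavgs_le (K := K)); first exact: (test_function_blip (n := 2)).
    by move=> y; exact: (pK [::]).
  have cE : `|c| <= E ^+ 2 by apply: le_trans ce _; rewrite lerXn2r ?nnegrE.
  rewrite normrM; apply: (@le_trans _ _ ((`|c| * expR (E ^+ 2)) * K)).
    by rewrite ler_pM//; exact: expR_sub1_le.
  have -> : K * E * expR (E ^+ 2) * e = (E * e * expR (E ^+ 2)) * K by ring.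
  by rewrite ler_wpM2r// ler_wpM2r ?expR_ge0// (le_trans ce).
move: (K * E * expR (E ^+ 2)) K30 X3 => K3 K30 X3.
move: K1 K2 K10 K20 X1 X2 X3 => K1 K2 K10 K20 X1 X2 X3.
have [u1 u2 u3] := three_le K10 K20 K30.
split.
- by apply: le_trans X1 _; rewrite ler_wpM2r ?exprn_ge0.
- by apply: le_trans X2 _; rewrite ler_wpM2r.
- by apply: le_trans X3 _; rewrite ler_wpM2r.
Qed.

Lemma expR_heat_shift_lip phi (E : R) : test_function phi -> 0 <= E -> exists2 K : R, 0 <= K &
  forall A (B : 'rV[R]_d) (c e : R) z, psd A -> 0 <= e -> e <= E ->
    (forall i j, `|A i j| <= e ^+ 2) -> (forall i, `|B ord0 i| <= e ^+ 2) -> `|c| <= e ^+ 2 ->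
    `|expR c * heat A phi (z - B) - phi z| <= K * e.
Proof.
move=> tp E0; have [K K0 H] := coarse tp E0; exists K => // A B c e z h1 h2 h3 h4 h5 h6.
by have [] := H A B c e z h1 h2 h3 h4 h5 h6.
Qed.

Lemma expR_heat_shift_local phi (E : R) : test_function phi -> 0 <= E -> exists2 K : R, 0 <= K &
  forall A (B : 'rV[R]_d) (c e : R) z, psd A -> 0 <= e -> e <= E ->
    (forall i j, `|A i j| <= e ^+ 2) -> (forall i, `|B ord0 i| <= e ^+ 2) -> `|c| <= e ^+ 2 ->
    `|expR c * heat A phi (z - B) - (phi z + (hess A phi z - \sum_i B ord0 i * partial i phi z + c * phi z))|
       <= K * e ^+ 3.
Proof.
move=> tp E0; have [K K0 H] := coarse tp E0.
have [M M0 pM] := test_function_partials_le 3 tp.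
exists (K + M * E * expR (E ^+ 2) + K) => [|A B c e z h1 h2 h3 h4 h5 h6].
  by rewrite !addr_ge0// !mulr_ge0// ?expR_ge0.
have [X1 X2 _] := H A B c e z h1 h2 h3 h4 h5 h6.
(* The three terms are the error without the exponential, the second-order error of the exponential,
   and the product of [c] with a first-order difference: of orders 3, 4 and 3 in [e]. *)
have alg (p q r s t u : R) : p * q - (t + (r - s + u * t)) =
  (q - t - r + s) + (p - 1 - u) * q + u * (q - t) by ring.
rewrite alg; apply: le_trans (ler_normD _ _) _; apply: le_trans (lerD (ler_normD _ _) (lexx _)) _.
rewrite [leRHS]mulrDl [X in _ <= X + _]mulrDl lerD//; first rewrite lerD//.
- have hb : `|heat A phi (z - B)| <= M.
    apply: (gavgs_le (K := M)); first exact: (test_function_blip (n := 2)).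
    by move=> y; exact: (pM [::]).
  have cE : `|c| <= E ^+ 2 by apply: le_trans h6 _; rewrite lerXn2r ?nnegrE.
  rewrite normrM; apply: (@le_trans _ _ ((`|c| ^+ 2 * expR (E ^+ 2)) * M)).
    by rewrite ler_pM//; exact: expR_taylor1_le.
  have -> : M * E * expR (E ^+ 2) * e ^+ 3 = (E * e ^+ 3 * expR (E ^+ 2)) * M by ring.
  rewrite ler_wpM2r// ler_wpM2r ?expR_ge0//.
  apply: (@le_trans _ _ ((e ^+ 2) ^+ 2)); first by rewrite lerXn2r ?nnegrE ?exprn_ge0.
  have -> : (e ^+ 2) ^+ 2 = e * e ^+ 3 by ring.
  by rewrite ler_wpM2r// exprn_ge0.
- rewrite normrM; have -> : K * e ^+ 3 = e ^+ 2 * (K * e) by ring.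
  by rewrite ler_pM.
Qed.

End infinitesimal_estimate.

(** * Functions whose increments are of order 3/2 *)

Section constancy.
Context {R : realType}.

(* Halving the increment of [m] gains a factor [2^(-1/2)] in the bound. *)
Lemma constant_of_increments (D m : R -> R) (s t K : R) : s <= t ->
  {within `[s, t], continuous m} ->
  (forall r r', s <= r -> r <= r' -> r' <= t -> m r <= m r') ->
  (forall r r', s <= r -> r <= r' -> r' <= t ->
     `|D r' - D r| <= K * Num.sqrt (m r' - m r) ^+ 3) ->
  D t = D s.
Proof.
move=> st cm ndm HD.
pose q : R := Num.sqrt 2^-1.
have q2 : q ^+ 2 = 2^-1 by rewrite sqr_sqrtr// invr_ge0.
have q0 : 0 <= q by exact: sqrtr_ge0.
have P n : forall r r', s <= r -> r <= r' -> r' <= t ->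
     `|D r' - D r| <= K * q ^+ n * Num.sqrt (m r' - m r) ^+ 3.
  elim: n => [|n IH] r r' sr rr' r't.
    by rewrite expr0 mulr1; exact: HD.
  have mrr' := ndm _ _ sr rr' r't.
  have cm' : {within `[r, r'], continuous m}.
    by apply: continuous_subspaceW cm; apply: subset_itv; rewrite bnd_simp.
  have mm : Num.min (m r) (m r') <= (m r + m r') / 2 <= Num.max (m r) (m r').
    have a1 : m r <= (m r + m r') / 2 by lra.
    have a2 : (m r + m r') / 2 <= m r' by lra.
    by rewrite ge_min a1 le_max a2 orbT.
  (* The interval is split where [m] reaches its mean value, not at its midpoint in time. *)
  have [x xin mx] := @IVT R m r r' ((m r + m r') / 2) rr' cm' mm.
  move: xin; rewrite in_itv/= => /andP[rx xr'].
  have h1 := IH r x sr rx (le_trans xr' r't).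
  have h2 := IH x r' (le_trans sr rx) xr' r't.
  have e1 : m x - m r = 2^-1 * (m r' - m r) by rewrite mx; field.
  have e2 : m r' - m x = 2^-1 * (m r' - m r) by rewrite mx; field.
  rewrite e1 sqrtrM ?invr_ge0// in h1; rewrite e2 sqrtrM ?invr_ge0// in h2.
  have -> : D r' - D r = (D r' - D x) + (D x - D r) by ring.
  apply: le_trans (ler_normD _ _) _; apply: le_trans (lerD h2 h1) _.
  rewrite -/q; set w := Num.sqrt _.
  (* Two halves, each smaller by [q ^+ 3]: the net factor is [2 * q ^+ 3 = q], since [q ^+ 2] is
     1/2. *)
  have -> : K * q ^+ n * (q * w) ^+ 3 + K * q ^+ n * (q * w) ^+ 3 =
     K * q ^+ n * q * w ^+ 3 * (2 * q ^+ 2) by ring.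
  rewrite q2 mulfV ?pnatr_eq0// mulr1.
  by have -> : K * q ^+ n.+1 = K * q ^+ n * q by rewrite exprSr mulrA.
suff H0 : `|D t - D s| <= 0 by apply: subr0_eq; apply: (@normr0_eq0 R R); apply: le_anti; rewrite H0 normr_ge0.
have cv : (K * q ^+ n * Num.sqrt (m t - m s) ^+ 3) @[n --> \oo] --> K * 0 * Num.sqrt (m t - m s) ^+ 3.
  apply: cvgM; last exact: cvg_cst.
  apply: cvgM; first exact: cvg_cst.
  apply: cvg_expr; rewrite ger0_norm// -(ltr_pXn2r (n := 2)) ?nnegrE// q2 expr1n.
  by rewrite invf_lt1// ltr1n.
have := cvg_lim _ cv; rewrite mulr0 mul0r => /(_ (@norm_hausdorff _ _)) <-.
apply: limr_ge; first by apply/cvg_ex; eexists; exact: cv.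
by apply: nearW => n; apply: P.
Qed.

End constancy.

(** * Gaussian vectors *)

Section gauss_rV.
Context {R : realType}.

Definition cons_rV_mfun n : {mfun (measurableTypeR R * 'rV[R]_n)%type >-> 'rV[R]_n.+1} :=
  HB.pack (@cons_rV R n)
    (isMeasurableFun.Build _ _ _ _ (@cons_rV R n) (@measurable_cons_rV R n)).

(** The joint law of [n] independent standard Gaussians. It turns an iterated average into one
    integral against a fixed probability, with all parameters in the integrand, as measurability in
    parameters and Fubini demand. *)
Fixpoint gauss_rV n : probability 'rV[R]_n R :=
  match n with
  | 0 => @dirac _ 'rV[R]_0 (0 : 'rV[R]_0) R
  | n'.+1 => distribution (@gauss R \x gauss_rV n')%E (cons_rV_mfun n')
  end.

Lemma probability_integrable_bounded d (T : measurableType d) (P : probability T R)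
  (g : T -> R) K : measurable_fun setT g -> (forall y, `|g y| <= K) ->
  P.-integrable setT (EFin \o g).
Proof.
move=> mg gK; apply: measurable_bounded_integrable => //.
  by apply: fin_num_fun_lty; exact: fin_num_measure.
exists K; split; first exact: num_real.
by move=> M KM y _ /=; apply: le_trans (gK y) _; exact: ltW.
Qed.

Lemma Rintegral_gauss_rVS n (g : 'rV[R]_n.+1 -> R) K : measurable_fun setT g ->
  (forall y, `|g y| <= K) ->
  \int[gauss_rV n.+1]_y g y = \int[@gauss R]_t \int[gauss_rV n]_y g (cons_rV (t, y)).
Proof.
move=> mg gK.
have mgc : measurable_fun setT (g \o @cons_rV R n).
  by apply: (measurableT_comp mg); exact: measurable_cons_rV.
have ig : (@gauss R \x gauss_rV n)%E.-integrable setT (EFin \o (g \o @cons_rV R n)).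
  by apply: (@probability_integrable_bounded _ _ _ _ K) => // y; exact: gK.
rewrite (@Rintegral_Rintegral_param _ _ _ _ _ (@gauss R) (gauss_rV n) (g \o @cons_rV R n))//.
congr fine; have /= := @integral_distribution _ _ _ _ _ (@gauss R \x gauss_rV n)%E
  (cons_rV_mfun n) (EFin \o g); apply => //.
exact/measurable_EFinP.
Qed.

Section averages.
Context {d : nat}.
Implicit Types (psi : 'rV[R]_d -> R) (x : 'rV[R]_d) (vs : seq 'rV[R]_d).

Definition lincomb n vs (y : 'rV[R]_n) : 'rV[R]_d := \sum_(i < n) y ord0 i *: nth 0 vs i.

Lemma measurable_lincomb n dT (T : measurableType dT) (vs : T -> seq 'rV[R]_d) :
  (forall k i, measurable_fun setT (fun th => nth 0 (vs th) k ord0 i)) ->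
  measurable_fun setT (fun z : T * 'rV[R]_n => lincomb (vs z.1) z.2).
Proof.
move=> mvs; apply/measurable_fun_rVP => i; rewrite /lincomb.
under eq_fun do rewrite summxE; apply: measurable_sum => k.
under eq_fun do rewrite mxE; apply: measurable_funM.
  exact: (measurableT_comp (@measurable_coord _ _ n k) measurable_snd).
exact: (measurableT_comp (mvs k i) measurable_fst).
Qed.

Lemma gavgs_gauss_rV n vs psi K x : size vs = n -> blip K psi ->
  gavgs vs psi x = \int[gauss_rV n]_y psi (x + lincomb vs y).
Proof.
elim: n vs x => [|n IH] [|v vs] x //=.
  move=> _ _; under eq_Rintegral do rewrite /lincomb big_ord0 addr0.
  rewrite Rintegral_cst// [X in fine X](_ : _ = 1%E) ?mulr1//.
  exact: (@probability_setT _ _ _ (gauss_rV 0)).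
move=> [szvs] hpsi.
have mlc : measurable_fun setT (fun y : 'rV[R]_n.+1 => psi (x + lincomb (v :: vs) y)).
  apply: (measurableT_comp (blip_measurable hpsi)).
  have h := @measurable_lincomb n.+1 _ (measurableTypeR R) (fun=> v :: vs)
    (fun _ _ => measurable_cst _).
  rewrite (_ : (fun y => _) = (fun z => z + x) \o lincomb (n := n.+1) (v :: vs)); last first.
    by apply/funext => y; rewrite /= addrC.
  apply: (measurableT_comp (measurable_addv x)).
  exact: (measurableT_comp h (pair1_measurable (0 : measurableTypeR R))).
rewrite [RHS](@Rintegral_gauss_rVS _ _ K mlc); last by case: hpsi.
apply: eq_Rintegral => t _; rewrite IH//; apply: eq_Rintegral => y _.
congr psi; rewrite -addrA; congr (_ + _).
rewrite /lincomb big_ord_recl cons_rV0 /=; congr (_ + _).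
by apply: eq_bigr => i _; rewrite cons_rVS.
Qed.

Lemma measurable_inv_sqrt : measurable_fun setT (fun r : R => (Num.sqrt r)^-1).
Proof.
have -> : (fun r : R => (Num.sqrt r)^-1) = fun r : R => Num.sqrt r * ((Num.sqrt r) ^+ 2) `^ (-1).
  apply/funext => r; rewrite powR_inv1 ?sqr_ge0//.
  have [->|s0] := eqVneq (Num.sqrt r) 0; first by rewrite invr0 mul0r.
  by field.
have ms : measurable_fun [set: R] (@Num.sqrt R).
  by apply: continuous_measurable_fun; exact: sqrt_continuous.
apply: measurable_funM => //.
apply: (measurableT_comp (measurable_powR (-1))).
exact: measurable_funX.
Qed.

(** Each entry is built from those of [A] by products, differences, square roots and inverses, all
    Borel. *)
Lemma measurable_chol dT (T : measurableType dT) (A : T -> 'M[R]_d) :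
  (forall i j, measurable_fun setT (fun th => A th i j)) ->
  forall k i, measurable_fun setT (fun th => nth 0 (chol (A th)) k ord0 i).
Proof.
rewrite /chol => mA k i; elim: (index_enum 'I_d) A mA k => [|l ks IH] A mA k /=.
  by under eq_fun do rewrite nth_nil mxE; exact: measurable_cst.
have mc j : measurable_fun setT (fun th => cvec (A th) l ord0 j).
  under eq_fun do rewrite !mxE; apply: measurable_funM; last exact: mA.
  exact: (measurableT_comp measurable_inv_sqrt (mA l l)).
case: k => [|k] /=; first exact: mc.
apply: IH => i' j'; under eq_fun do rewrite mxE [X in _ + X]mxE sqmxE.
by apply: measurable_funB; [exact: mA|exact: measurable_funM].
Qed.

Definition heat_dirs (A : 'M[R]_d) : seq 'rV[R]_d := chol ((2 / gvar) *: A).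

Lemma heat_gauss_rV A psi K x : blip K psi ->
  heat A psi x = \int[gauss_rV d]_y psi (x + lincomb (heat_dirs A) y).
Proof. by move=> hpsi; apply: gavgs_gauss_rV hpsi; exact: size_chol. Qed.

Section parameters.
Context dT (T : measurableType dT) (A : T -> 'M[R]_d) (X : T -> 'rV[R]_d).
Hypothesis mA : forall i j, measurable_fun setT (fun th => A th i j).
Hypothesis mX : measurable_fun setT X.

Lemma measurable_heat_dirs :
  measurable_fun setT (fun z : T * 'rV[R]_d => X z.1 + lincomb (heat_dirs (A z.1)) z.2).
Proof.
have ml : measurable_fun setT (fun z : T * 'rV[R]_d => lincomb (heat_dirs (A z.1)) z.2).
  apply: (@measurable_lincomb d _ T (fun th => heat_dirs (A th))).
  apply: (@measurable_chol _ T (fun th => (2 / gvar) *: A th)) => i j.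
  by under eq_fun do rewrite mxE; apply: measurable_funM.
move/measurable_fun_rVP : mX => mX'; move/measurable_fun_rVP : ml => ml'.
apply/measurable_fun_rVP => i; under eq_fun do rewrite mxE.
apply: measurable_funD; last exact: ml'.
exact: (measurableT_comp (mX' i) measurable_fst).
Qed.

Lemma measurable_heat psi K : blip K psi ->
  measurable_fun setT (fun th => heat (A th) psi (X th)).
Proof.
move=> hpsi.
have -> : (fun th => heat (A th) psi (X th)) =
    (fun th => \int[gauss_rV d]_y psi (X th + lincomb (heat_dirs (A th)) y)).
  by apply/funext => th; exact: heat_gauss_rV hpsi.
apply: (@measurable_Rintegral_param _ _ _ _ _ (gauss_rV d)
  (fun z : T * 'rV[R]_d => psi (X z.1 + lincomb (heat_dirs (A z.1)) z.2))).
exact: (measurableT_comp (blip_measurable hpsi) measurable_heat_dirs).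
Qed.

End parameters.

End averages.

End gauss_rV.

Section interval_integral.
Context {R : realType}.

(** There is no orientation: the value is 0 when [t <= s]. *)
Definition itvint (f : R -> R) (s t : R) : R := \int[lebesgue_measure]_(r in `]s, t[) f r.

Lemma measurable_itv_indic : measurable_fun setT
  (fun z : (measurableTypeR R * measurableTypeR R) * measurableTypeR R =>
    (z.1.1 < z.2) && (z.2 < z.1.2)).
Proof.
apply: measurable_and; apply: measurable_fun_ltr => //.
- exact: (measurableT_comp measurable_fst measurable_fst).
- exact: (measurableT_comp measurable_snd measurable_fst).
Qed.

Lemma measurable_itvint (f : R -> R) : measurable_fun setT f ->
  measurable_fun setT (fun z : measurableTypeR R * measurableTypeR R => itvint f z.1 z.2).
Proof.
move=> mf.
have -> : (fun z : measurableTypeR R * measurableTypeR R => itvint f z.1 z.2) =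
  (fun z => \int[lebesgue_measure]_r (if (z.1 < r) && (r < z.2) then f r else 0)).
  apply/funext => z; rewrite /itvint Rintegral_mkcond; apply: eq_Rintegral => r _.
  by rewrite patchE mem_setE in_itv.
apply: (@measurable_Rintegral_param _ _ _ _ _ (@lebesgue_measure R)
  (fun z : (measurableTypeR R * measurableTypeR R) * measurableTypeR R =>
    if (z.1.1 < z.2) && (z.2 < z.1.2) then f z.2 else 0)).
apply: measurable_fun_ifT => //; first exact: measurable_itv_indic.
exact: (measurableT_comp mf measurable_snd).
Qed.

End interval_integral.

(** * The dual evolution *)

Section itvint_theory.
Context {R : realType}.
Implicit Types (f g : R -> R) (s t r : R).
Local Notation mu := (@lebesgue_measure R).

Lemma measurable_ooitv s t : measurable (`]s, t[ : set (measurableTypeR R)).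
Proof. exact: measurable_itv. Qed.

Lemma itvint_empty f s t : t <= s -> itvint f s t = 0.
Proof. by move=> ts; rewrite /itvint set_itv_ge ?Rintegral_set0// bnd_simp -leNgt. Qed.

Lemma integrable_subitv f s t s' t' : s <= s' -> t' <= t ->
  mu.-integrable `]s, t[ (EFin \o f) -> mu.-integrable `]s', t'[ (EFin \o f).
Proof.
move=> ss' tt'; apply: integrableS => //.
by apply: subset_itv; rewrite bnd_simp.
Qed.

Lemma itvint_add f s r t : s <= r -> r <= t ->
  mu.-integrable `]s, t[ (EFin \o f) ->
  itvint f s t = itvint f s r + itvint f r t.
Proof.
move=> sr; rewrite le_eqVlt => /predU1P[<-|rt] fi.
  by rewrite [X in _ + X]itvint_empty// addr0.
have h1 : (BRight s <= BRight r)%O by rewrite bnd_simp.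
have h2 : (BRight r <= BLeft t)%O by rewrite bnd_simp.
have E := Rintegral_itvB fi h1 h2.
have fi' := integrable_subitv (lexx s) (ltW rt) fi.
by rewrite /itvint -E (Rintegral_itv_bndo_bndc fi') addrC subrK.
Qed.

Lemma itvint_sum (I : Type) (l : seq I) (F : I -> R -> R) s t :
  (forall i, mu.-integrable `]s, t[ (EFin \o F i)) ->
  itvint (fun r => \sum_(i <- l) F i r) s t = \sum_(i <- l) itvint (F i) s t /\
  mu.-integrable `]s, t[ (EFin \o (fun r => \sum_(i <- l) F i r)).
Proof.
move=> Fi; elim: l => [|i l [IH1 IH2]].
  have E : (fun r => \sum_(i <- [::]) F i r) = cst 0 by apply/funext => r; rewrite big_nil.
  rewrite big_nil E; split; last exact: integrable0.
  by rewrite /itvint Rintegral_cst// mul0r.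
have E : (fun r => \sum_(j <- i :: l) F j r) = (fun r => F i r + \sum_(j <- l) F j r).
  by apply/funext => r; rewrite big_cons.
rewrite E big_cons; split; last by have := integrableD (measurable_ooitv _ _) (Fi i) IH2.
by rewrite -IH1 /itvint RintegralD.
Qed.

Lemma itvintZ f s t k : mu.-integrable `]s, t[ (EFin \o f) ->
  itvint (fun r => k * f r) s t = k * itvint f s t.
Proof. by move=> fi; rewrite /itvint RintegralZl. Qed.

Lemma integrable_dominated f g s t : measurable_fun setT f ->
  (forall r, s < r < t -> `|f r| <= g r) -> mu.-integrable `]s, t[ (EFin \o g) ->
  mu.-integrable `]s, t[ (EFin \o f).
Proof.
move=> mf fg; apply: le_integrable => //.
  by apply/measurable_EFinP; exact: measurable_funS mf.
move=> r; rewrite /= in_itv/= => rst; rewrite lee_fin.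
exact: le_trans (fg _ rst) (ler_norm _).
Qed.

Lemma itvint_norm_le f g s t : measurable_fun setT f ->
  (forall r, s < r < t -> `|f r| <= g r) -> mu.-integrable `]s, t[ (EFin \o g) ->
  `|itvint f s t| <= itvint g s t.
Proof.
move=> mf fg ig; have fi := integrable_dominated mf fg ig.
apply: le_trans (le_normr_Rintegral (measurable_ooitv _ _) fi) _.
by apply: le_Rintegral => //; exact: (integrable_norm fi).
Qed.

Lemma itvint_continuous g s t : s <= t -> measurable_fun setT g ->
  mu.-integrable `]s, t[ (EFin \o g) ->
  {within `[s, t], continuous (itvint g s)}.
Proof.
move=> st mg ig.
have mg' (D : set R) : measurable_fun D (EFin \o g).
  by apply/measurable_EFinP; exact: measurable_funS mg.
have -> : itvint g s = (fun x => parameterized_integral mu s x g).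
  apply/funext => x; rewrite /itvint /parameterized_integral /Rintegral.
  by congr fine; rewrite (@integral_itv_bndoo R s x (EFin \o g) true false).
apply: parameterized_integral_continuous => //.
apply/integrableP; split; first exact: mg'.
have /integrableP[_] := ig.
rewrite -(@integral_itv_bndoo R s t _ true false)//.
by apply: measurableT_comp => //; exact: mg'.
Qed.

End itvint_theory.

Section evolution.
Context {R : realType} {d : nat}.
Variables (a : 'I_d -> 'I_d -> R -> R) (b : 'I_d -> R -> R) (c : R -> R).
Implicit Types (phi psi : 'rV[R]_d -> R) (s t r : R) (x z : 'rV[R]_d).
Local Notation lam := (@lebesgue_measure R).

(** A Gram matrix is symmetric, and second derivatives of a test function see only the symmetric
    part of [a]. *)
Definition diffusion_mx s t : 'M[R]_d :=
  \matrix_(i, j) ((itvint (a i j) s t + itvint (a j i) s t) / 2).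

Definition drift_vec s t : 'rV[R]_d := \row_i itvint (b i) s t.

(* The dual evolution: formally the adjoint of the solution operator from [s] to [t]. *)
Definition evol phi s t x : R :=
  expR (itvint c s t) * heat (diffusion_mx s t) phi (x - drift_vec s t).

(* Index of the terms of the adjoint operator: second order, first order, zeroth order. *)
Definition term : Type := ('I_d * 'I_d) + ('I_d + 'I_1).
HB.instance Definition _ := Finite.on term.

Definition coef (k : term) : R -> R :=
  match k with
  | inl ij => a ij.1 ij.2
  | inr (inl i) => fun r => - b i r
  | inr (inr _) => c
  end.

Definition term_fun phi (k : term) : 'rV[R]_d -> R :=
  match k with
  | inl ij => partials [:: ij.2; ij.1] phi
  | inr (inl i) => partial i phi
  | inr (inr _) => phi
  end.

Lemma sum_term (F : term -> R) : \sum_k F k =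
  \sum_i \sum_j F (inl (i, j)) + (\sum_i F (inr (inl i)) + F (inr (inr ord0))).
Proof.
rewrite -[LHS]/(\sum_(k : ('I_d * 'I_d) + ('I_d + 'I_1)) F k) big_sumType /= big_sumType /= big_ord1.
by congr (_ + _); rewrite pair_bigA; apply: eq_bigr => -[].
Qed.

Lemma adjoint_term r phi x : adjoint a b c r phi x = \sum_k coef k r * term_fun phi k x.
Proof.
rewrite sum_term /adjoint -addrA; congr (_ + (_ + _)).
by rewrite -sumrN; apply: eq_bigr => i _; rewrite mulNr.
Qed.

Lemma test_function_term phi k : test_function phi -> test_function (term_fun phi k).
Proof.
by move=> tp; case: k => [ij|[i|_]] //=; do ?apply: test_function_partial.
Qed.

End evolution.

(** * The integral equation of the dual evolution *)

Section kolmogorov.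
Context {R : realType} {d : nat}.
Variables (a : 'I_d -> 'I_d -> R -> R) (b : 'I_d -> R -> R) (c mu : R -> R).
Implicit Types (phi psi : 'rV[R]_d -> R) (x z : 'rV[R]_d).
Local Notation lam := (@lebesgue_measure R).
Hypothesis ma : forall i j, measurable_fun setT (a i j).
Hypothesis mb : forall i, measurable_fun setT (b i).
Hypothesis mc : measurable_fun setT c.
Hypothesis mmu : measurable_fun setT mu.
Hypothesis amu : forall i j r, `|a i j r| <= mu r.
Hypothesis bmu : forall i r, `|b i r| <= mu r.
Hypothesis cmu : forall r, `|c r| <= mu r.
Hypothesis a_ge0 : forall r (xi : 'rV[R]_d),
  0 <= \sum_i \sum_j a i j r * xi ord0 i * xi ord0 j.

Local Notation A := (diffusion_mx a).
Local Notation B := (drift_vec b).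
Local Notation term := (@term d).

Lemma measurable_coef k : measurable_fun setT (coef a b c k).
Proof. by case: k => [ij|[i|_]] //=; exact: measurableT_comp. Qed.

Lemma coef_le k r : `|coef a b c k r| <= mu r.
Proof. by case: k => [ij|[i|_]] //=; rewrite normrN. Qed.

Lemma measurable_evol K phi (dT : measure_display) (T : measurableType dT) (s t : T -> R)
   (X : T -> 'rV[R]_d) : blip K phi ->
  measurable_fun setT s -> measurable_fun setT t -> measurable_fun setT X ->
  measurable_fun setT (fun th => evol a b c phi (s th) (t th) (X th)).
Proof.
move=> hphi ms mt mX.
have mI f : measurable_fun setT f -> measurable_fun setT (fun th => itvint f (s th) (t th)).
  move=> mf; have mst : measurable_fun setT (fun th => (s th, t th) : measurableTypeR R * measurableTypeR R).
    by apply/measurable_fun_pairP; split.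
  exact: (measurableT_comp (measurable_itvint mf) mst).
apply: measurable_funM.
  by apply: (measurableT_comp (@measurable_expR R)); exact: mI.
apply: (@measurable_heat _ _ _ _ (fun th => A (s th) (t th)) (fun th => X th - B (s th) (t th)) _ _ _ _ hphi).
- move=> i j; under eq_fun do rewrite mxE.
  by apply: measurable_funM => //; apply: measurable_funD; exact: mI.
- move/measurable_fun_rVP : mX => mX'; apply/measurable_fun_rVP => i.
  under eq_fun do rewrite !mxE; apply: measurable_funB; first exact: mX'.
  exact: mI.
Qed.

Section fixed_start.
Variables (s t : R).
Hypothesis st : s <= t.
Hypothesis imu : lam.-integrable `]s, t[ (EFin \o mu).

Let mu_ge0 r : 0 <= mu r. Proof. exact: le_trans (normr_ge0 _) (cmu r). Qed.

Let isub (f : R -> R) r r' : measurable_fun setT f -> (forall r, `|f r| <= mu r) ->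
  s <= r -> r' <= t -> lam.-integrable `]r, r'[ (EFin \o f).
Proof.
move=> mf fmu sr r't; apply: (integrable_subitv sr r't).
by apply: (integrable_dominated mf _ imu) => q _; exact: fmu.
Qed.

Let ile (f : R -> R) r r' : measurable_fun setT f -> (forall r, `|f r| <= mu r) ->
  s <= r -> r' <= t -> `|itvint f r r'| <= itvint mu r r'.
Proof.
move=> mf fmu sr r't; apply: itvint_norm_le => //.
exact: (integrable_subitv sr r't).
Qed.

Let iadd (f : R -> R) r r' r'' : measurable_fun setT f -> (forall r, `|f r| <= mu r) ->
  s <= r -> r <= r' -> r' <= r'' -> r'' <= t -> itvint f r r'' = itvint f r r' + itvint f r' r''.
Proof. by move=> mf fmu sr rr' r'r'' r''t; apply: itvint_add => //; exact: isub. Qed.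

Let nmu r : `|mu r| <= mu r. Proof. by rewrite ger0_norm. Qed.

Let half (p : R) : p / 2 + p / 2 = p. Proof. by field. Qed.

(** The antisymmetric part cancels in the quadratic form, which is then the integral of a
    nonnegative function. *)
Lemma psd_diffusion_mx r r' : s <= r -> r' <= t -> psd (A r r').
Proof.
move=> sr r't; split; first by apply/matrixP => i j; rewrite !mxE addrC.
move=> x.
have -> : (x *m A r r' *m x^T) ord0 ord0 =
    \sum_i \sum_j itvint (a i j) r r' * (x ord0 i * x ord0 j).
  transitivity (\sum_i \sum_j A r r' i j * (x ord0 i * x ord0 j)).
    rewrite mxE exchange_big /=; apply: eq_bigr => j _; rewrite !mxE mulr_suml.
    by apply: eq_bigr => i _; ring.
  transitivity (\sum_i \sum_j (itvint (a i j) r r' * (x ord0 i * x ord0 j)) / 2 +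
     \sum_i \sum_j (itvint (a j i) r r' * (x ord0 i * x ord0 j)) / 2).
    rewrite -big_split; apply: eq_bigr => i _ /=; rewrite -big_split; apply: eq_bigr => j _ /=.
    by rewrite mxE; ring.
  rewrite [X in _ + X]exchange_big /= -big_split; apply: eq_bigr => i _ /=.
  rewrite -big_split; apply: eq_bigr => j _ /=.
  by rewrite (mulrC (x ord0 j)) half.
pose F (p : 'I_d * 'I_d) (q : R) := (x ord0 p.1 * x ord0 p.2) * a p.1 p.2 q.
have iF p : lam.-integrable `]r, r'[ (EFin \o F p).
  have := integrableZl (measurable_ooitv _ _) (x ord0 p.1 * x ord0 p.2)
     (isub (ma p.1 p.2) (amu p.1 p.2) sr r't).
  exact.
have [E _] := itvint_sum (index_enum ('I_d * 'I_d)%type) iF.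
have -> : \sum_i \sum_j itvint (a i j) r r' * (x ord0 i * x ord0 j) =
   itvint (fun q => \sum_p F p q) r r'.
  rewrite E pair_bigA /=; apply: eq_bigr => p _.
  by rewrite mulrC /F itvintZ//; exact: isub.
apply: Rintegral_ge0 => q _; have := a_ge0 q x.
rewrite pair_bigA /=; congr (0 <= _); apply: eq_bigr => p _.
by rewrite /F; ring.
Qed.

Let blip_shift K psi w : blip K psi -> blip K (fun z => psi (z - w)).
Proof.
move=> [K0 bK lK]; split => // x y; apply: le_trans (lK _ _) _.
by rewrite opprB addrA subrK.
Qed.

Lemma blip_sum (I : Type) (l : seq I) (u : I -> R) (psi : I -> 'rV[R]_d -> R) (K : I -> R) :
  (forall i, blip (K i) (psi i)) -> exists K', blip K' (fun z => \sum_(i <- l) u i * psi i z).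
Proof.
move=> h; elim: l => [|i l [K' IH]].
  by exists 0; split => // *; rewrite !big_nil ?subrr normr0 ?mul0r.
exists (`|u i| * K i + `|1| * K').
rewrite (_ : (fun z => _) = fun z => u i * psi i z + 1 * \sum_(j <- l) u j * psi j z).
  exact: blip_lincomb.
by apply/funext => z; rewrite big_cons mul1r.
Qed.

Lemma gavgs_sum (I : Type) (l : seq I) (u : I -> R) (psi : I -> 'rV[R]_d -> R) (K : I -> R) vs x :
  (forall i, blip (K i) (psi i)) ->
  gavgs vs (fun z => \sum_(i <- l) u i * psi i z) x = \sum_(i <- l) u i * gavgs vs (psi i) x.
Proof.
move=> h; elim: l => [|i l IH].
  rewrite big_nil (_ : (fun z => _) = cst 0); last by apply/funext => z; rewrite big_nil.
  elim: vs x {h} => //= v vs IH x; rewrite /gavg.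
  by under eq_Rintegral do rewrite IH; exact: gauss_cst.
have [K' hK'] := blip_sum l u h.
rewrite (_ : (fun z => _) = fun z => u i * psi i z + 1 * \sum_(j <- l) u j * psi j z).
  by rewrite (gavgs_lincomb _ _ _ _ (h i) hK') IH mul1r big_cons.
by apply/funext => z; rewrite big_cons mul1r.
Qed.

Let Eb : R := Num.sqrt (itvint mu s t).

(** The step size [e] of the local estimates: its square bounds the integral of every coefficient
    over []r, r'[]. *)
Let emu r r' := Num.sqrt (itvint mu r r').

Let itv_ge0 r r' : 0 <= itvint mu r r'. Proof. exact: Rintegral_ge0. Qed.

Let emu2 r r' : emu r r' ^+ 2 = itvint mu r r'. Proof. exact: sqr_sqrtr. Qed.

Let emu_le r r' q q' : s <= r -> r <= q -> q <= q' -> q' <= r' -> r' <= t -> emu q q' <= emu r r'.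
Proof.
move=> sr rq qq' q'r' r't; rewrite ler_wsqrtr//.
have sq := le_trans sr rq.
rewrite (iadd mmu nmu sr rq (le_trans qq' q'r') r't) (iadd mmu nmu sq qq' q'r' r't).
by rewrite addrCA lerDl addr_ge0.
Qed.

(** Evolution composes: the integrals of the coefficients add, [heatD] composes the averages, and
    averages commute with shifts. The step from [r] to [r'] sits innermost, next to [phi]. *)
Let evol_step phi K r r' x : blip K phi -> s <= r -> r <= r' -> r' <= t ->
  evol a b c phi s r' x = expR (itvint c s r) *
    gavgs (heat_dirs (A s r))
     (fun z => expR (itvint c r r') * heat (A r r') phi (z - B r r')) (x - B s r).
Proof.
move=> hphi sr rr' r't.
have AE : A s r' = A s r + A r r'.
  apply/matrixP => i j; rewrite !mxE (iadd (ma i j) (amu i j) (lexx s) sr rr' r't).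
  by rewrite (iadd (ma j i) (amu j i) (lexx s) sr rr' r't); ring.
have BE : B s r' = B s r + B r r'.
  by apply/rowP => i; rewrite !mxE (iadd (mb i) (bmu i) (lexx s) sr rr' r't).
have p1 : psd (A s r) by apply: psd_diffusion_mx => //; exact: le_trans r't.
have p2 : psd (A r r') by exact: psd_diffusion_mx.
rewrite /evol (iadd mc cmu (lexx s) sr rr' r't) expRD -mulrA; congr (_ * _).
rewrite AE BE -(heatD hphi p1 p2) opprD addrA.
rewrite -[heat (A s r) _ _](gavgs_shift (heat_dirs (A s r)) (heat (A r r') phi) (- B r r')).
have h1 := blip_shift (B r r') (blip_gavgs (heat_dirs (A r r')) hphi).
have E1 : (fun z => expR (itvint c r r') * heat (A r r') phi (z - B r r')) =
  (fun z => expR (itvint c r r') * gavgs (heat_dirs (A r r')) phi (z - B r r') + 0 *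
     gavgs (heat_dirs (A r r')) phi (z - B r r')).
  by apply/funext => z; rewrite mul0r addr0.
by rewrite E1 (gavgs_lincomb _ _ _ _ h1 h1) mul0r addr0.
Qed.

Let expR_le r : s <= r -> r <= t -> expR (itvint c s r) <= expR (Eb ^+ 2).
Proof.
move=> sr rt; rewrite ler_expR; apply: le_trans (ler_norm _) _.
apply: le_trans (ile mc cmu (lexx s) rt) _.
by rewrite -emu2 lerXn2r ?nnegrE ?sqrtr_ge0//; exact: emu_le.
Qed.

Let bounds r r' : s <= r -> r <= r' -> r' <= t ->
  [/\ psd (A r r'), emu r r' <= Eb, forall i j, `|A r r' i j| <= emu r r' ^+ 2,
     forall i, `|B r r' ord0 i| <= emu r r' ^+ 2 & `|itvint c r r'| <= emu r r' ^+ 2].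
Proof.
move=> sr rr' r't; split.
- exact: psd_diffusion_mx.
- exact: emu_le.
- move=> i j; rewrite mxE emu2 normrM [X in _ * X]ger0_norm ?invr_ge0//.
  have h1 := ile (ma i j) (amu i j) sr r't; have h2 := ile (ma j i) (amu j i) sr r't.
  rewrite ler_pdivrMr//; apply: le_trans (ler_normD _ _) _.
  by apply: le_trans (lerD h1 h2) _; rewrite -mulr2n mulr_natr.
- by move=> i; rewrite mxE emu2; exact: ile.
- by rewrite emu2; exact: ile.
Qed.

(** First order in [emu] is enough: this difference is later multiplied by a coefficient whose
    integral is of order [emu r r' ^+ 2]. *)
Let evol_lip phi x : test_function phi -> exists2 K, 0 <= K &
  forall r r', s <= r -> r <= r' -> r' <= t ->
  `|evol a b c phi s r' x - evol a b c phi s r x| <= K * emu r r'.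
Proof.
move=> tp; have E0 : 0 <= Eb by exact: sqrtr_ge0.
have [K K0 HK] := expR_heat_shift_lip tp E0.
have [M M0 pM] := test_function_partials_le 3 tp.
have hphi : blip M phi by exact: (test_function_blip (n := 2)).
exists (expR (Eb ^+ 2) * K) => [|r r' sr rr' r't]; first by rewrite mulr_ge0// expR_ge0.
have [pA eE hA hB hC] := bounds sr rr' r't.
rewrite (evol_step x hphi sr rr' r't) /evol -mulrBr normrM (ger0_norm (expR_ge0 _)) -mulrA.
apply: ler_pM => //; first by rewrite expR_le// (le_trans rr').
have h1 := blip_shift (B r r') (blip_gavgs (heat_dirs (A r r')) hphi).
have h2 := blip_lincomb (expR (itvint c r r')) 0 h1 h1.
have E1 : (fun z => expR (itvint c r r') * heat (A r r') phi (z - B r r')) =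
  (fun z => expR (itvint c r r') * gavgs (heat_dirs (A r r')) phi (z - B r r') + 0 *
     gavgs (heat_dirs (A r r')) phi (z - B r r')).
  by apply/funext => z; rewrite mul0r addr0.
rewrite -E1 in h2.
rewrite -[heat _ _ _]/(gavgs (heat_dirs (A s r)) phi (x - B s r)) (gavgsB _ _ h2 hphi).
have h3 := blip_lincomb 1 (-1) h2 hphi.
apply: (gavgs_le (K := _)); last by move=> z; exact: HK (sqrtr_ge0 _) eE hA hB hC.
rewrite (_ : (_ \- _) = (fun z => 1 * (expR (itvint c r r') * heat (A r r') phi (z - B r r')) + -1 * phi z)).
  exact: h3.
by apply/funext => z /=; rewrite mul1r mulN1r.
Qed.

(** Symmetry of second partials undoes the symmetrization in [diffusion_mx] and leaves the
    integrated coefficients of the adjoint operator. *)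
Let main_term phi r r' z : test_function phi -> s <= r -> r <= r' -> r' <= t ->
  hess (A r r') phi z - \sum_i B r r' ord0 i * partial i phi z + itvint c r r' * phi z =
  \sum_k itvint (coef a b c k) r r' * term_fun phi k z.
Proof.
move=> tp sr rr' r't; rewrite sum_term -addrA; congr (_ + (_ + _)).
  rewrite /hess.
  transitivity (\sum_i \sum_j (itvint (a i j) r r' * partials [:: j; i] phi z) / 2 +
     \sum_i \sum_j (itvint (a j i) r r' * partials [:: i; j] phi z) / 2).
    rewrite -big_split; apply: eq_bigr => i _; rewrite -big_split; apply: eq_bigr => j _.
    have alg (p q w : R) : (p + q) / 2 * w = p * w / 2 + q * w / 2 by ring.
    by rewrite mxE alg (partials_sym i j tp).
  rewrite [X in _ + X]exchange_big -big_split; apply: eq_bigr => i _.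
  rewrite -big_split; apply: eq_bigr => j _.
  exact: half.
rewrite -sumrN; apply: eq_bigr => i _; rewrite mxE -mulNr; congr (_ * _).
rewrite -mulN1r -itvintZ; last exact: isub.
by apply: eq_Rintegral => q _; rewrite mulN1r.
Qed.

(** The one-step estimate is uniform in space, so the outer average from [s] to [r] preserves it, up
    to the bounded exponential. *)
Let evol_local phi x : test_function phi -> exists2 K, 0 <= K &
  forall r r', s <= r -> r <= r' -> r' <= t ->
  `|evol a b c phi s r' x - (evol a b c phi s r x
      + \sum_k itvint (coef a b c k) r r' * evol a b c (term_fun phi k) s r x)|
    <= K * emu r r' ^+ 3.
Proof.
move=> tp; have E0 : 0 <= Eb by exact: sqrtr_ge0.
have [K K0 HK] := expR_heat_shift_local tp E0.
have [M M0 pM] := test_function_partials_le 3 tp.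
have hphi : blip M phi by exact: (test_function_blip (n := 2)).
have hk k : {M' | blip M' (term_fun phi k)}.
  apply: cid; have tk := test_function_term k tp.
  have [M' M'0 pM'] := test_function_partials_le 3 tk.
  by exists M'; exact: (test_function_blip (n := 2)).
exists (expR (Eb ^+ 2) * K) => [|r r' sr rr' r't]; first by rewrite mulr_ge0// expR_ge0.
have [pA eE hA hB hC] := bounds sr rr' r't.
have rt := le_trans rr' r't.
pose Psi z := expR (itvint c r r') * heat (A r r') phi (z - B r r').
pose S z := \sum_k itvint (coef a b c k) r r' * term_fun phi k z.
have [MS hS] := blip_sum (index_enum term) (fun k => itvint (coef a b c k) r r') (fun k => svalP (hk k)).
have hPhi := blip_lincomb 1 1 hphi hS.
have h1 := blip_shift (B r r') (blip_gavgs (heat_dirs (A r r')) hphi).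
have hPsi := blip_lincomb (expR (itvint c r r')) 0 h1 h1.
have E1 : (fun z => expR (itvint c r r') * gavgs (heat_dirs (A r r')) phi (z - B r r') + 0 *
     gavgs (heat_dirs (A r r')) phi (z - B r r')) = Psi.
  by apply/funext => z; rewrite mul0r addr0.
rewrite E1 in hPsi.
have -> : evol a b c phi s r x + \sum_k itvint (coef a b c k) r r' * evol a b c (term_fun phi k) s r x
  = expR (itvint c s r) * gavgs (heat_dirs (A s r)) (fun z => 1 * phi z + 1 * S z) (x - B s r).
  rewrite (gavgs_lincomb _ _ _ _ hphi hS) !mul1r mulrDr; congr (_ + _).
  rewrite (gavgs_sum _ _ _ _ (fun k => svalP (hk k))) mulr_sumr; apply: eq_bigr => k _.
  by rewrite mulrCA.
rewrite (evol_step x hphi sr rr' r't) -mulrBr normrM (ger0_norm (expR_ge0 _)) -mulrA.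
apply: ler_pM => //; first by rewrite expR_le.
rewrite (gavgsB _ _ hPsi hPhi).
have h3 := blip_lincomb 1 (-1) hPsi hPhi.
apply: (gavgs_le (K := _)) => [|z].
  rewrite (_ : (_ \- _) = (fun z => 1 * Psi z + -1 * (1 * phi z + 1 * S z))); first exact: h3.
  by apply/funext => z /=; rewrite !mul1r mulN1r.
rewrite /= /S -(main_term z tp sr rr' r't) !mul1r.
exact: HK pA (sqrtr_ge0 _) eE hA hB hC.
Qed.

(** The difference [D] of [evol] and the integral up to [r] has increments bounded by [emu] cubed,
    hence is constant; at [r = s] it is [phi x]. *)
Lemma evol_integral phi x : test_function phi ->
  evol a b c phi s t x = phi x +
    itvint (fun r => \sum_k coef a b c k r * evol a b c (term_fun phi k) s r x) s t.
Proof.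
move=> tp; have [K K0 HK] := evol_local x tp.
have hl k : {M | 0 <= M & forall r r', s <= r -> r <= r' -> r' <= t ->
    `|evol a b c (term_fun phi k) s r' x - evol a b c (term_fun phi k) s r x| <= M * emu r r'}.
  by apply: cid2; apply: evol_lip; exact: test_function_term.
have hb k : {M | blip M (term_fun phi k)}.
  apply: cid; have tk := test_function_term k tp.
  have [M' M'0 pM'] := test_function_partials_le 3 tk.
  by exists M'; exact: (test_function_blip (n := 2)).
pose G k r := evol a b c (term_fun phi k) s r x.
have mG k : measurable_fun setT (G k).
  exact: (@measurable_evol _ _ _ (measurableTypeR R) (fun=> s) id (fun=> x) (svalP (hb k))).
have Gle k r : s <= r -> r <= t -> `|G k r| <= expR (Eb ^+ 2) * sval (hb k).
  move=> sr rt; rewrite /G /evol normrM (ger0_norm (expR_ge0 _)); apply: ler_pM => //.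
    exact: expR_le.
  have h := svalP (hb k); rewrite /heat.
  by apply: (gavgs_le _ _ h) => z; case: h => _ bh _; exact: bh.
pose F k r := coef a b c k r * G k r.
have mF k : measurable_fun setT (F k) by apply: measurable_funM => //; exact: measurable_coef.
have imuZ r r' w : s <= r -> r' <= t -> lam.-integrable `]r, r'[ (EFin \o (fun q => w * mu q)).
  by move=> sr r't; have := integrableZl (measurable_ooitv _ _) w (integrable_subitv sr r't imu).
have iF r r' k : s <= r -> r' <= t -> lam.-integrable `]r, r'[ (EFin \o F k).
  move=> sr r't; apply: (integrable_dominated (mF k) _ (imuZ _ _ (expR (Eb ^+ 2) * sval (hb k)) sr r't)).
  move=> q /andP[rq qr']; rewrite normrM mulrC; apply: ler_pM => //; last exact: coef_le.
  by apply: Gle; [exact: le_trans (ltW rq)|exact: le_trans (ltW qr') r't].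
pose h r := \sum_k F k r.
have ih r r' : s <= r -> r' <= t -> lam.-integrable `]r, r'[ (EFin \o h).
  by move=> sr r't; have [_] := itvint_sum (index_enum term) (fun k => iF r r' k sr r't).
have hE r r' : s <= r -> r' <= t -> itvint h r r' = \sum_k itvint (F k) r r'.
  by move=> sr r't; have [] := itvint_sum (index_enum term) (fun k => iF r r' k sr r't).
pose D r := evol a b c phi s r x - itvint h s r.
suff DD : D t = D s.
  have Ds : D s = phi x.
    have z f : itvint f s s = 0 by exact: itvint_empty.
    rewrite /D z subr0 /evol z expR0 mul1r.
    have -> : A s s = 0 by apply/matrixP => i j; rewrite !mxE !z addr0 mul0r.
    have -> : B s s = 0 by apply/rowP => i; rewrite !mxE z.
    by rewrite heat0 subr0.
  by rewrite -Ds -DD /D subrK.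
apply: (@constant_of_increments R D (itvint mu s) s t (K + \sum_k s2val (hl k))) => //.
- exact: itvint_continuous.
- by move=> r r' sr rr' r't; rewrite (iadd mmu nmu (lexx s) sr rr' r't) lerDl.
move=> r r' sr rr' r't.
have -> : itvint mu s r' - itvint mu s r = itvint mu r r'.
  by rewrite (iadd mmu nmu (lexx s) sr rr' r't) addrC addKr.
rewrite -/(emu r r').
have Dh : itvint h s r' = itvint h s r + itvint h r r'.
  by apply: itvint_add => //; exact: ih.
have H1 := HK r r' sr rr' r't.
set P := evol a b c phi s r' x in H1 *; set Q := evol a b c phi s r x in H1 *.
set S := \sum_k _ in H1.
have alg (p q w v u : R) : p - (v + u) - (q - v) = (p - (q + w)) + (w - u) by ring.
rewrite /D -/P -/Q Dh (alg _ _ S) mulrDl.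
apply: le_trans (ler_normD _ _) _; apply: lerD => //.
(* In each term the evolution is frozen at [r]; the error is the coefficient, of mass at most
   [emu r r' ^+ 2], times the increment bounded by [evol_lip]. *)
rewrite hE// /S -sumrB; apply: le_trans (ler_norm_sum _ _ _) _; rewrite mulr_suml.
apply: ler_sum => k _.
have M0 : 0 <= s2val (hl k) by case: (hl k).
have ick := isub (measurable_coef k) (coef_le k) sr r't.
have -> : itvint (coef a b c k) r r' * evol a b c (term_fun phi k) s r x - itvint (F k) r r' =
    - itvint (fun q => coef a b c k q * (G k q - G k r)) r r'.
  have -> : itvint (fun q => coef a b c k q * (G k q - G k r)) r r' =
     itvint (F k) r r' - itvint (fun q => G k r * coef a b c k q) r r'.
    rewrite /itvint -RintegralB//.
    - by apply: eq_Rintegral => q _; rewrite /F; ring.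
    - exact: iF.
    - by have := integrableZl (measurable_ooitv _ _) (G k r) ick.
  by rewrite itvintZ// opprB mulrC.
rewrite normrN.
have mFG : measurable_fun setT (fun q => coef a b c k q * (G k q - G k r)).
  by apply: measurable_funM; [exact: measurable_coef|exact: measurable_funB].
apply: le_trans (itvint_norm_le mFG _ (imuZ _ _ (s2val (hl k) * emu r r') sr r't)) _.
  move=> q /andP[rq qr']; rewrite normrM mulrC; apply: ler_pM => //; last exact: coef_le.
  have h2 : `|G k q - G k r| <= s2val (hl k) * emu r q.
    case: (hl k) => M /= _; apply => //; first exact: ltW.
    exact: le_trans (ltW qr') r't.
  apply: le_trans h2 _; rewrite ler_wpM2l//; apply: emu_le => //; exact: ltW.
rewrite itvintZ; last exact: (integrable_subitv sr r't).
by rewrite -emu2 -mulrA -exprS.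
Qed.

End fixed_start.
End kolmogorov.

(** * Bounds in L^p *)

Section weighted_hoelder.
Context dT (T : measurableType dT) {R : realType}.
Variable m : {measure set T -> \bar R}.
Implicit Types (h w : T -> R) (r W : R).

Lemma ge0_le_poweR r (x y : \bar R) : 0 <= r -> (0 <= x)%E -> (x <= y)%E -> (x `^ r <= y `^ r)%E.
Proof.
move=> r0 x0 xy; apply: gt0_ler_poweR => //; rewrite in_itv/= leey andbT//.
exact: le_trans xy.
Qed.

Lemma powR_mulr r W : 0 < r -> 0 <= W -> W `^ (r - 1) * W = W `^ r.
Proof.
move=> r0 W0; rewrite -[X in _ * X](powRr1 W0) -powRD; first by rewrite subrK.
by rewrite subrK (gt_eqF r0).
Qed.

(** Hoelder with conjugate exponents [r] and [q], where [h] is written as [h] times the power -1/q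
    of [w], times the power 1/q of [w]. Keeping the weight inside the integral of the [r]-th power
    is what lets Tonelli finish Minkowski's inequality. *)
Lemma hoelder_weight r h w W : 1 <= r -> measurable_fun setT h -> measurable_fun setT w ->
  (forall th, 0 <= h th) -> (forall th, 0 <= w th) -> (forall th, w th = 0 -> h th = 0) ->
  (\int[m]_th (w th)%:E <= W%:E)%E ->
  ((\int[m]_th (h th)%:E) `^ r <=
   (\int[m]_th (h th `^ r * w th `^ (1 - r))%:E) * (W `^ (r - 1))%:E)%E.
Proof.
move=> r1 mh mw h0 w0 wh wW.
have ih : (0 <= \int[m]_th (h th)%:E)%E by apply: integral_ge0 => th _; rewrite lee_fin.
have iw : (0 <= \int[m]_th (w th)%:E)%E by apply: integral_ge0 => th _; rewrite lee_fin.
have W0 : 0 <= W by rewrite -lee_fin (le_trans iw).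
(* For [r = 1] the conjugate exponent is infinite, and both powers with exponent 0 are 1. *)
move: r1; rewrite le_eqVlt => /predU1P[<-|r1].
  rewrite subrr powRr0 mule1 poweRe1//; apply: le_integral_ge0 => th _; rewrite lee_fin//.
  by rewrite powRr0 mulr1 powRr1.
have r0 : 0 < r by exact: lt_trans r1.
have rn0 : r != 0 by rewrite gt_eqF.
have r10 : 0 < r - 1 by rewrite subr_gt0.
have r1n0 : r - 1 != 0 by rewrite gt_eqF.
pose q := r / (r - 1).
have q0 : 0 < q by rewrite divr_gt0.
have rq : r^-1 + q^-1 = 1 by rewrite /q invf_div; field; rewrite rn0.
have rqE : r * q^-1 = r - 1 by rewrite /q invf_div; field.
pose F th := h th * w th `^ (- q^-1).
pose G th := w th `^ q^-1.
have mG : measurable_fun setT G by exact: (measurableT_comp (measurable_powR _) mw).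
have mF : measurable_fun setT F.
  by apply: measurable_funM => //; exact: (measurableT_comp (measurable_powR _) mw).
have F0 th : 0 <= F th by rewrite mulr_ge0// powR_ge0.
have := hoelder m mF mG r0 q0 rq; rewrite Lnorm1.
have -> : (\int[m]_th `|(EFin \o (F \* G)%R) th| = \int[m]_th (h th)%:E)%E.
  apply: eq_integral => th _ /=; rewrite ger0_norm ?mulr_ge0 ?powR_ge0// /F /G.
  have [w1|w1] := eqVneq (w th) 0; first by rewrite (wh _ w1) !mul0r.
  by rewrite -mulrA powRN mulVf ?mulr1// powR_eq0 (negbTE w1).
move=> /(ge0_le_poweR (ltW r0) ih) /le_trans; apply.
rewrite poweRM ?Lnorm_ge0// poweR_Lnorm//.
apply: lee_pmul.
- by apply: integral_ge0 => th _; rewrite lee_fin powR_ge0.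
- exact: poweR_ge0.
- apply: le_integral_ge0 => th _ /=; first by rewrite lee_fin powR_ge0.
  rewrite lee_fin /F ger0_norm ?mulr_ge0 ?powR_ge0// powRM// ?powR_ge0// -powRrM.
  by rewrite mulNr mulrC [_ * r]mulrC rqE opprB mulrC.
- rewrite unlock -poweRrM mulrC rqE.
  have -> : (\int[m]_th (`|(EFin \o G) th| `^ q) = \int[m]_th (w th)%:E)%E.
    apply: eq_integral => th _ /=; rewrite ger0_norm ?powR_ge0// /G -powRrM.
    by rewrite mulVf ?gt_eqF// powRr1.
  by rewrite -poweR_EFin; apply: ge0_le_poweR => //; exact: ltW.
Qed.

End weighted_hoelder.

Section lp_bound.
Context {R : realType} {dX : measure_display} {X : measurableType dX}.
Variable (nu : {sigma_finite_measure set X -> \bar R}).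
Implicit Types (p : \bar R) (g : X -> R) (N : R).

(* Bound of the L^p norm of [g] by [N]; for [p = +oo] the bound holds everywhere, not just
   almost everywhere, so that it survives integration against a parameter. *)
Definition lp_bound p g N : Prop :=
  match p with
  | r%:E => (\int[nu]_x (`|g x| `^ r)%:E <= (N `^ r)%:E)%E
  | _ => forall x, `|g x| <= N
  end.

Lemma lp_bound_Lnorm p g N : (1 <= p)%E -> 0 <= N -> lp_bound p g N ->
  ('N[nu]_p[EFin \o g] <= N%:E)%E.
Proof.
case: p => [r| |] //= p1 N0; last first.
  move=> gN; rewrite unlock; case: ifPn => // mu0.
  by apply/ess_supP; apply: nearW => x /=; rewrite lee_fin.
have r0 : 0 < r by apply: (lt_le_trans ltr01); rewrite -lee_fin.
move=> h; rewrite unlock.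
apply: le_trans (ge0_le_poweR _ _ h) _; first by rewrite invr_ge0 ltW.
  by apply: integral_ge0 => x _; rewrite lee_fin powR_ge0.
by rewrite poweR_EFin -powRrM mulfV ?gt_eqF// powRr1.
Qed.

Lemma lp_bound0 p : (1 <= p)%E -> lp_bound p (fun=> 0) 0.
Proof.
case: p => [r| |] //= p1; last by move=> x; rewrite normr0.
have rn0 : r != 0 by rewrite gt_eqF// (lt_le_trans ltr01)// -lee_fin.
by rewrite integral0_eq ?powR0// => x _; rewrite normr0 powR0.
Qed.

Lemma lp_boundZ p g N k : (1 <= p)%E -> measurable_fun setT g -> 0 <= N -> 0 <= k ->
  lp_bound p g N -> lp_bound p (fun x => k * g x) (k * N).
Proof.
case: p => [r| |] //= p1 mg N0 k0 h; last first.
  by move=> x; rewrite normrM (ger0_norm k0) ler_wpM2l.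
rewrite powRM// EFinM.
under eq_integral do rewrite normrM (ger0_norm k0) powRM// EFinM.
rewrite ge0_integralZl//.
- by rewrite lee_wpmul2l// lee_fin powR_ge0.
- apply/measurable_EFinP; apply: (measurableT_comp (measurable_powR _)).
  exact: measurableT_comp.
- by rewrite lee_fin powR_ge0.
Qed.

(** On a set of finite measure the L^p norm controls the L^1 norm: [hoelder_weight] with the
    indicator of [D] as weight. *)
Lemma lp_bound_finite_measure p (D : set X) : (1 <= p)%E -> measurable D -> (nu D < +oo)%E ->
  exists2 K, 0 <= K & forall g N, measurable_fun setT g -> 0 <= N -> lp_bound p g N ->
  (\int[nu]_(x in D) `|g x|%:E <= (K * N)%:E)%E.
Proof.
move=> p1 mD Doo.
have Dfin : nu D \is a fin_num by rewrite ge0_fin_numE.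
have W0 : 0 <= fine (nu D) by rewrite fine_ge0.
case: p p1 => [r| |] // p1.
  have r0 : 0 < r by apply: (lt_le_trans ltr01); rewrite -lee_fin.
  have rn0 : r != 0 by rewrite gt_eqF.
  have r1 : 1 <= r by rewrite -lee_fin.
  exists ((fine (nu D) `^ (r - 1)) `^ r^-1) => [|g N mg N0 h]; first exact: powR_ge0.
  pose w x : R := \1_D x.
  pose H x : R := `|g x| * \1_D x.
  have mw : measurable_fun setT w by exact: measurable_indic.
  have mH : measurable_fun setT H by apply: measurable_funM => //; exact: measurableT_comp.
  have HE : (\int[nu]_(x in D) `|g x|%:E = \int[nu]_x (H x)%:E)%E.
    rewrite integral_mkcond; apply: eq_integral => x _; rewrite patchE /H indicE.
    by case: ifPn => _; rewrite ?mulr1 ?mulr0.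
  have H0 x : 0 <= H x by rewrite mulr_ge0.
  have w0 x : 0 <= w x by [].
  have wH x : w x = 0 -> H x = 0 by rewrite /H /w => ->; rewrite mulr0.
  have wW : (\int[nu]_x (w x)%:E <= (fine (nu D))%:E)%E.
    by rewrite integral_indic// setIT fineK.
  have i0 : (0 <= \int[nu]_x (H x)%:E)%E by apply: integral_ge0 => x _; rewrite lee_fin.
  have h1 : ((\int[nu]_x (H x)%:E) `^ r <= (N `^ r)%:E * (fine (nu D) `^ (r - 1))%:E)%E.
    apply: le_trans (hoelder_weight r1 mH mw H0 w0 wH wW) _.
    rewrite lee_wpmul2r ?lee_fin ?powR_ge0//; apply: le_trans _ h.
    apply: le_integral_ge0 => x _; rewrite lee_fin ?mulr_ge0 ?powR_ge0//.
    rewrite /H /w indicE; case: (x \in D); first by rewrite mulr1 powR1 mulr1.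
    by rewrite mulr0 powR0// mul0r powR_ge0.
  rewrite HE -[leLHS]poweRe1// -(mulfV rn0) poweRrM.
  apply: le_trans (ge0_le_poweR _ (poweR_ge0 _ _) h1) _; first by rewrite invr_ge0 ltW.
  by rewrite -EFinM poweR_EFin powRM ?powR_ge0// -(powRrM N) mulfV// powRr1// mulrC.
exists (fine (nu D)) => // g N mg N0 /= gN.
rewrite EFinM fineK// muleC -integral_cst//.
by apply: le_integral_ge0 => x _; rewrite lee_fin.
Qed.

(* Minkowski's integral inequality: Hoelder with the weight [w], then Tonelli. *)
Lemma lp_bound_integral dT (T : measurableType dT) (m : {sigma_finite_measure set T -> \bar R})
  p (h : T * X -> R) (w : T -> R) g W : (1 <= p)%E ->
  measurable_fun setT h -> measurable_fun setT w -> measurable_fun setT g ->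
  (forall th, 0 <= w th) -> (forall th x, w th = 0 -> h (th, x) = 0) ->
  (forall th, lp_bound p (fun x => h (th, x)) (w th)) ->
  (\int[m]_th (w th)%:E <= W%:E)%E ->
  (forall x, (`|g x|%:E <= \int[m]_th `|h (th, x)|%:E)%E) ->
  lp_bound p g W.
Proof.
move=> p1 mh mw mg w0 wh hw wW gh.
have iw : (0 <= \int[m]_th (w th)%:E)%E by apply: integral_ge0 => th _; rewrite lee_fin.
have W0 : 0 <= W by rewrite -lee_fin (le_trans iw).
case: p p1 hw => [r| |] //= p1 hw; last first.
  move=> x; rewrite -lee_fin; apply: le_trans (gh x) _; apply: le_trans _ wW.
  by apply: le_integral_ge0 => th _; rewrite lee_fin.
have r1 : 1 <= r by rewrite -lee_fin.
have r0 : 0 < r by apply: (lt_le_trans ltr01); rewrite -lee_fin.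
(* At fixed [th] the integral of the [r]-th power over [x] is at most [w th] to the [r], so the
   factor with exponent [1 - r] leaves [w th], of total mass at most [W]. The factor from Hoelder,
   [W] to the [r - 1], completes the power [r]. *)
pose k (z : X * T) := `|h (z.2, z.1)| `^ r * w z.2 `^ (1 - r).
have k0 z : (0 <= (k z)%:E)%E by rewrite lee_fin mulr_ge0// powR_ge0.
have mk : measurable_fun setT (EFin \o k).
  apply/measurable_EFinP; apply: measurable_funM.
    apply: (measurableT_comp (measurable_powR _)); apply: measurableT_comp => //.
    apply: (measurableT_comp mh); apply/measurable_fun_pairP; split; first exact: measurable_snd.
    exact: measurable_fst.
  apply: (measurableT_comp (measurable_powR _)).
  exact: (measurableT_comp mw measurable_snd).
have mhx x : measurable_fun setT (fun th => `|h (th, x)|).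
  by apply: measurableT_comp => //; exact: measurable_fun_pair1.
apply: (@le_trans _ _ (\int[nu]_x ((\int[m]_th (k (x, th))%:E) * (W `^ (r - 1))%:E))%E).
  apply: le_integral_ge0 => x _; first by rewrite lee_fin powR_ge0.
  rewrite -poweR_EFin; apply: le_trans (ge0_le_poweR (ltW r0) _ (gh x)) _; first by rewrite lee_fin.
  by apply: (hoelder_weight r1 (mhx x) mw) => // th wth; rewrite wh// normr0.
rewrite ge0_integralZr//; first last.
- by rewrite lee_fin powR_ge0.
- by move=> x _; apply: integral_ge0.
- exact: (measurable_fun_fubini_tonelli_F (EFin \o k)).
have E := fubini_tonelli (m1 := nu) (m2 := m) (EFin \o k) mk k0.
have -> : (\int[nu]_x \int[m]_th (k (x, th))%:E = \int[m]_th \int[nu]_x (k (x, th))%:E)%E by exact: E.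
apply: (@le_trans _ _ (W%:E * (W `^ (r - 1))%:E)%E); last first.
  by rewrite -EFinM lee_fin mulrC powR_mulr.
rewrite lee_wpmul2r ?lee_fin ?powR_ge0//; apply: le_trans _ wW.
apply: le_integral_ge0 => th _; first by apply: integral_ge0.
rewrite /k /=; under eq_integral do rewrite mulrC EFinM.
have mhth : measurable_fun setT (fun x => (`|h (th, x)| `^ r)%:E).
  apply/measurable_EFinP; apply: (measurableT_comp (measurable_powR _)).
  by apply: measurableT_comp => //; exact: measurable_fun_pair2.
rewrite ge0_integralZl//; last by rewrite lee_fin powR_ge0.
apply: le_trans (lee_wpmul2l _ (hw th)) _; first by rewrite lee_fin powR_ge0.
rewrite -EFinM lee_fin; have [w1|w1] := eqVneq (w th) 0.
  by rewrite w1 [X in _ * X]powR0 ?mulr0// gt_eqF.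
have wE : w th `^ (1 - r) * w th `^ r = w th.
  by rewrite -powRD; [rewrite subrK powRr1|rewrite w1 implybT].
by rewrite wE.
Qed.

End lp_bound.

Section lp_bound_rV.
Context {R : realType} {d : nat}.

Lemma lp_bound_shift p (g : 'rV[R]_d -> R) N v : measurable_fun setT g ->
  lp_bound (lebesgue_rV d) p g N -> lp_bound (lebesgue_rV d) p (fun x => g (x + v)) N.
Proof.
case: p => [r| |] mg h; [|by move=> x; exact: h..].
rewrite /lp_bound (@ge0_integral_rV_shift _ _ (fun x => (`|g x| `^ r)%:E))//.
apply/measurable_EFinP; apply: (measurableT_comp (measurable_powR _)).
exact: measurableT_comp.
Qed.

Definition box (r : R) : set 'rV[R]_d := [set x | forall i, x ord0 i \in `[- r, r]].

Lemma measurable_box r : measurable (box r).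
Proof.
have -> : box r = \bigcap_(i in [set: 'I_d])
    ((fun x : 'rV[R]_d => x ord0 i) @^-1` [set` `[- r, r]]).
  by apply/seteqP; split => x /= Bx i; [move=> _|]; exact: Bx.
apply: fin_bigcap_measurable => // i _.
rewrite -[X in measurable X]setTI.
by apply: (@measurable_coord _ (measurableTypeR R) d i measurableT); exact: measurable_itv.
Qed.

Lemma box_finite r : (lebesgue_rV d (box r) < +oo)%E.
Proof.
have E := @lebesgue_rV_box R d (fun=> [set` `[- r, r]]) (fun=> measurable_itv _).
rewrite [X in (X < _)%E](_ : _ = (\prod_(i < d) lebesgue_measure [set` `[(- r)%R, r]])%E) //.
rewrite -ge0_fin_numE; last by rewrite -E.
elim/big_ind: _ => // [x y x0 y0|i _]; first exact: fin_numM.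
by rewrite lebesgue_measure_itv/=; case: ifP => _; rewrite -?EFinB.
Qed.

Lemma eball_box r : eball r `<=` box r.
Proof.
move=> x /= xr i; rewrite in_itv/= -ler_norml -sqrtr_sqr.
apply: le_trans _ (ltW xr); rewrite ler_wsqrtr// (bigD1 i)//= lerDl sumr_ge0// => j _.
exact: sqr_ge0.
Qed.

End lp_bound_rV.

(** * Propagators *)

Section Rintegral_measurable.
Context dT (T : measurableType dT) {R : realType}.
Variable m : {measure set T -> \bar R}.

Lemma norm_Rintegral_le (f : T -> R) : measurable_fun setT f ->
  (`|\int[m]_x f x|%:E <= \int[m]_x `|f x|%:E)%E.
Proof.
move=> mf; have mEf : measurable_fun setT (EFin \o f) by exact/measurable_EFinP.
apply: le_trans (le_abse_integral m measurableT mEf).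
by rewrite /Rintegral; case: integral => [r| |] //=; rewrite normr0 leey.
Qed.

(** If the two parts are not both finite, their extended difference is infinite and [fine] sends it
    to 0. *)
Lemma Rintegral_non_integrable (f : T -> R) : measurable_fun setT f ->
  ~ m.-integrable setT (EFin \o f) -> \int[m]_x f x = 0.
Proof.
move=> mf nf; have mEf : measurable_fun setT (EFin \o f) by exact/measurable_EFinP.
have [fin|] := boolP ((\int[m]_x (f x)%:E)%E \is a fin_num); last first.
  by rewrite /Rintegral; case: integral.
case: nf; apply/integrableP; split => //.
under eq_integral => x _ do rewrite -[`|_|%E]/((abse \o (EFin \o f)) x) fune_abse.
have p0 : (0 <= \int[m]_x (EFin \o f)^\+ x)%E by apply: integral_ge0.
have n0 : (0 <= \int[m]_x (EFin \o f)^\- x)%E by apply: integral_ge0.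
rewrite ge0_integralD//; last 2 first.
- exact: measurable_funepos.
- exact: measurable_funeneg.
move: fin; rewrite integralE.
by case: integral p0 => [r| |] // _; case: integral n0 => [q| |] // _ _; rewrite ltry.
Qed.

(* Without integrability both sides are 0: the integral is infinite, and [fine] sends it to 0. *)
Lemma measurable_RintegralZl (f : T -> R) k : measurable_fun setT f ->
  \int[m]_x (k * f x) = k * \int[m]_x f x.
Proof.
move=> mf; have [->|k0] := eqVneq k 0.
  by rewrite mul0r; under eq_Rintegral do rewrite mul0r; rewrite Rintegral_cst// mul0r.
have [fi|nfi] := pselect (m.-integrable setT (EFin \o f)).
  by rewrite -RintegralZl.
rewrite [X in _ = _ * X]Rintegral_non_integrable// mulr0; apply: Rintegral_non_integrable.
  exact: measurable_funM.
move=> kfi; apply: nfi.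
rewrite (_ : EFin \o f = (fun x => (k^-1)%:E * (EFin \o (fun x => k * f x)%R) x)%E).
  exact: integrableZl.
by apply/funext => x /=; rewrite -EFinM mulrA mulVf// mul1r.
Qed.

End Rintegral_measurable.

Lemma Rintegral_rV_shift {R : realType} d (g : 'rV[R]_d -> R) v : measurable_fun setT g ->
  \int[lebesgue_rV d]_x g (x + v) = \int[lebesgue_rV d]_x g x.
Proof.
move=> mg; congr fine; rewrite [LHS]integralE [RHS]integralE.
have mE : measurable_fun setT (EFin \o g) by exact/measurable_EFinP.
congr (_ - _)%E.
  rewrite -(@ge0_integral_rV_shift _ _ _ v (measurable_funepos mE)) => [|x]; last exact: funepos_ge0.
  by apply: eq_integral => x _; rewrite !funeposE.
rewrite -(@ge0_integral_rV_shift _ _ _ v (measurable_funeneg mE)) => [|x]; last exact: funeneg_ge0.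
by apply: eq_integral => x _; rewrite !funenegE.
Qed.

(** The constant depends only on [p], [d] and the box, so a single [K] serves all times and all
    terms of the adjoint operator. *)
Lemma lp_bound_pairing {R : realType} {d : nat} p (r : R) : (1 <= p)%E ->
  exists2 K, 0 <= K & forall (g psi : 'rV[R]_d -> R) N M,
  measurable_fun setT g -> 0 <= N -> 0 <= M -> lp_bound (lebesgue_rV d) p g N ->
  (forall x, `|psi x| <= M) -> (forall x, psi x != 0 -> box r x) ->
  (\int[lebesgue_rV d]_x `|g x * psi x|%:E <= (K * M * N)%:E)%E.
Proof.
move=> p1.
have [K K0 HK] := lp_bound_finite_measure p1 (measurable_box r) (box_finite (d := d) r).
exists K => // g psi N M mg N0 M0 gN psiM suppsi.
rewrite mulrAC EFinM.
apply: le_trans (lee_wpmul2r _ (HK _ _ mg N0 gN)); last by rewrite lee_fin.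
have mgb : measurable_fun (box r) (fun x : 'rV[R]_d => `|g x|%:E).
  by apply: measurable_funTS; apply/measurable_EFinP; exact: measurableT_comp.
rewrite -(ge0_integralZr _ (measurable_box r) mgb)//.
rewrite [leRHS]integral_mkcond; apply: le_integral_ge0 => x _; first by rewrite lee_fin.
rewrite patchE normrM; case: ifPn => [_|]; first by rewrite -EFinM lee_fin ler_wpM2l.
rewrite notin_setE => nbx; rewrite [psi x](_ : _ = 0) ?normr0 ?mulr0//.
by apply/eqP; apply: contra_notT nbx; exact: suppsi.
Qed.

Section propagator.
Context {R : realType} {d : nat}.
Variables (A : 'M[R]_d) (B : 'rV[R]_d) (C : R).
Implicit Types (G psi : 'rV[R]_d -> R) (x : 'rV[R]_d) (N M : R).
Local Notation lam := (lebesgue_rV d).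
Local Notation gam := (@gauss_rV R d).

Definition gauss_disp (y : 'rV[R]_d) : 'rV[R]_d := lincomb (heat_dirs A) y - B.

(** [propag] moves sources forward and [propag_adj] acts on test functions, where it is [evol];
    translation invariance flips the sign of the displacement between them. *)
Definition propag G x : R := expR C * \int[gam]_y G (x - gauss_disp y).

Definition propag_adj psi x : R := expR C * \int[gam]_y psi (x + gauss_disp y).

Lemma propag_adjE psi K x : blip K psi -> propag_adj psi x = expR C * heat A psi (x - B).
Proof.
move=> hpsi; rewrite /propag_adj (heat_gauss_rV _ _ hpsi); congr (_ * _).
by apply: eq_Rintegral => y _; rewrite /gauss_disp addrA addrAC.
Qed.

Lemma measurable_gauss_disp : measurable_fun setT gauss_disp.
Proof.
have mz : measurable_fun setT (fun z : 'rV[R]_d * 'rV[R]_d => lincomb (heat_dirs A) z.2).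
  apply: (@measurable_lincomb _ d d _ _ (fun=> heat_dirs A)) => k i; exact: measurable_cst.
apply: (measurableT_comp (measurable_addv (- B))).
exact: (measurable_fun_pair2 (f := fun z : 'rV[R]_d * 'rV[R]_d => lincomb (heat_dirs A) z.2) 0).
Qed.

Lemma measurable_rV_addf dT (T : measurableType dT) (f g : T -> 'rV[R]_d) :
  measurable_fun setT f -> measurable_fun setT g -> measurable_fun setT (fun z => f z + g z).
Proof.
move=> /measurable_fun_rVP mf /measurable_fun_rVP mg; apply/measurable_fun_rVP => i.
by under eq_fun do rewrite mxE; exact: measurable_funD.
Qed.

Lemma measurable_rV_oppf dT (T : measurableType dT) (f : T -> 'rV[R]_d) :
  measurable_fun setT f -> measurable_fun setT (fun z => - f z).
Proof.
move=> /measurable_fun_rVP mf; apply/measurable_fun_rVP => i.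
by under eq_fun do rewrite mxE; exact: measurableT_comp.
Qed.

Let mdisp (z : 'rV[R]_d * 'rV[R]_d -> 'rV[R]_d) : measurable_fun setT z ->
  measurable_fun setT (fun t => gauss_disp (z t)).
Proof. exact: (measurableT_comp measurable_gauss_disp). Qed.

Section lp.
Variables (p : \bar R) (G psi : 'rV[R]_d -> R) (N M r L : R).
Hypothesis p1 : (1 <= p)%E.
Hypothesis mG : measurable_fun setT G.
Hypothesis N0 : 0 <= N.
Hypothesis NG : N = 0 -> forall x, G x = 0.
Hypothesis GN : lp_bound lam p G N.

Let mGy : measurable_fun setT (fun z : 'rV[R]_d * 'rV[R]_d => G (z.2 - gauss_disp z.1)).
Proof.
apply: (measurableT_comp mG); apply: measurable_rV_addf; first exact: measurable_snd.
by apply: measurable_rV_oppf; apply: mdisp; exact: measurable_fst.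
Qed.

Let mGx : measurable_fun setT (fun z : 'rV[R]_d * 'rV[R]_d => G (z.1 - gauss_disp z.2)).
Proof.
apply: (measurableT_comp mG); apply: measurable_rV_addf; first exact: measurable_fst.
by apply: measurable_rV_oppf; apply: mdisp; exact: measurable_snd.
Qed.

Let mGint : measurable_fun setT (fun x => \int[gam]_y G (x - gauss_disp y)).
Proof. exact: (@measurable_Rintegral_param _ _ _ _ _ gam _ mGx). Qed.

Lemma lp_bound_propag : lp_bound lam p (propag G) (expR C * N).
Proof.
apply: lp_boundZ => //.
apply: (@lp_bound_integral _ _ _ lam _ _ gam p _ (fun=> N) _ _ p1 mGy) => //.
- by move=> y x /NG.
- by move=> y; exact: (lp_bound_shift (- gauss_disp y) mG GN).
- by rewrite integral_cst//= probability_setT mule1.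
- move=> x; apply: norm_Rintegral_le.
  exact: (measurable_fun_pair2 x mGx).
Qed.

Hypothesis hpsi : blip L psi.
Hypothesis M0 : 0 <= M.
Hypothesis psiM : forall x, `|psi x| <= M.
Hypothesis suppsi : forall x, psi x != 0 -> box r x.

Let mpsi : measurable_fun setT psi. Proof. exact: blip_measurable hpsi. Qed.

Let mGpsi : measurable_fun setT
  (fun z : 'rV[R]_d * 'rV[R]_d => G (z.2 - gauss_disp z.1) * psi z.2).
Proof. by apply: measurable_funM => //; exact: (measurableT_comp mpsi measurable_snd). Qed.

Let mGpsi' : measurable_fun setT
  (fun z : 'rV[R]_d * 'rV[R]_d => G z.2 * psi (z.2 + gauss_disp z.1)).
Proof.
apply: measurable_funM; first exact: (measurableT_comp mG measurable_snd).
apply: (measurableT_comp mpsi); apply: measurable_rV_addf; first exact: measurable_snd.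
by apply: mdisp; exact: measurable_fst.
Qed.

Section bound.
Variable K : R.
Hypothesis HK : forall g, measurable_fun setT g -> lp_bound lam p g N ->
  (\int[lam]_x `|g x * psi x|%:E <= (K * M * N)%:E)%E.

Let bound1 y : (\int[lam]_x `|(G (x - gauss_disp y) * psi x)%R|%:E <= (K * M * N)%:E)%E.
Proof.
apply: HK; last exact: (lp_bound_shift (- gauss_disp y) mG GN).
exact: (measurable_fun_pair2 y mGy).
Qed.

Let shift1 y : (\int[lam]_x `|(G x * psi (x + gauss_disp y))%R|%:E =
  \int[lam]_x `|(G (x - gauss_disp y) * psi x)%R|%:E)%E.
Proof.
rewrite -(@ge0_integral_rV_shift _ _
  (fun x => `|(G (x - gauss_disp y) * psi x)%R|%:E) (gauss_disp y))//.
  by apply: eq_integral => x _; rewrite addrK.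
apply/measurable_EFinP; apply: measurableT_comp => //.
exact: (measurable_fun_pair2 y mGpsi).
Qed.

Let bound2 : (\int[gam]_y \int[lam]_x `|(G x * psi (x + gauss_disp y))%R|%:E <= (K * M * N)%:E)%E.
Proof.
apply: (@le_trans _ _ (\int[gam]_y (K * M * N)%:E)%E).
  apply: le_integral_ge0 => y _; first by apply: integral_ge0.
  by rewrite shift1.
by rewrite integral_cst//= probability_setT mule1.
Qed.

(** The function [propag_adj psi] need not have bounded support, so the bound [HK] cannot be applied
    to it. Instead each displacement is moved onto [G], whose L^p bound is translation invariant,
    and [HK] is used with [psi] itself. *)
Lemma propag_adj_bound : (\int[lam]_x `|G x * propag_adj psi x|%:E <= (K * (expR C * M) * N)%:E)%E.
Proof.
have mh : measurable_fun setT
    (fun z : 'rV[R]_d * 'rV[R]_d => `|(G z.2 * psi (z.2 + gauss_disp z.1))%R|%:E).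
  by apply/measurable_EFinP; exact: measurableT_comp.
have h0 (z : 'rV[R]_d * 'rV[R]_d) : (0 <= `|(G z.2 * psi (z.2 + gauss_disp z.1))%R|%:E)%E by [].
have E := fubini_tonelli (m1 := gam) (m2 := lam) _ mh h0.
have -> : K * (expR C * M) * N = expR C * (K * M * N) by ring.
rewrite EFinM.
apply: le_trans (lee_wpmul2l _ bound2); last by rewrite lee_fin expR_ge0.
have -> : (\int[gam]_y \int[lam]_x `|(G x * psi (x + gauss_disp y))%R|%:E =
  \int[lam]_x \int[gam]_y `|(G x * psi (x + gauss_disp y))%R|%:E)%E by exact: E.
rewrite -ge0_integralZl//; last 2 first.
- exact: (measurable_fun_fubini_tonelli_G (m1 := gam) _ mh h0).
- by move=> x _; apply: integral_ge0.
apply: le_integral_ge0 => x _; first by rewrite lee_fin.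
have mx : measurable_fun setT (fun y => G x * psi (x + gauss_disp y)).
  exact: (measurable_fun_pair1 x mGpsi').
rewrite /propag_adj mulrCA normrM ger0_norm ?expR_ge0// EFinM lee_wpmul2l ?lee_fin ?expR_ge0//.
rewrite -measurable_RintegralZl; first exact: norm_Rintegral_le.
apply: (measurableT_comp mpsi).
apply: measurable_rV_addf; [exact: measurable_cst|exact: measurable_gauss_disp].
Qed.

(** Fubini in the displacement [y] and the point [x], with a translation in [x] at each fixed
    [y]. *)
Lemma propag_duality : \int[lam]_x (propag G x * psi x) = \int[lam]_x (G x * propag_adj psi x).
Proof.
have fin2 : (\int[gam]_y \int[lam]_x `|(G x * psi (x + gauss_disp y))%R|%:E < +oo)%E.
  exact: le_lt_trans bound2 (ltry _).
have i2 : (gam \x lam)%E.-integrable setT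
    (EFin \o (fun z : 'rV[R]_d * 'rV[R]_d => G z.2 * psi (z.2 + gauss_disp z.1))).
  by apply/integrable12ltyP; [exact/measurable_EFinP|exact: fin2].
have i1 : (gam \x lam)%E.-integrable setT
    (EFin \o (fun z : 'rV[R]_d * 'rV[R]_d => G (z.2 - gauss_disp z.1) * psi z.2)).
  apply/integrable12ltyP; first exact/measurable_EFinP.
  apply: le_lt_trans fin2; apply: le_integral_ge0 => y _ /=; first exact: integral_ge0.
  by rewrite shift1.
transitivity (expR C * \int[lam]_x \int[gam]_y (G (x - gauss_disp y) * psi x)).
  rewrite -measurable_RintegralZl; last first.
    have m' : measurable_fun setT
      (fun z : 'rV[R]_d * 'rV[R]_d => G (z.1 - gauss_disp z.2) * psi z.1).
      by apply: measurable_funM => //; exact: (measurableT_comp mpsi measurable_fst).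
    exact: (@measurable_Rintegral_param _ _ _ _ _ gam _ m').
  apply: eq_Rintegral => x _; rewrite /propag -mulrA; congr (_ * _).
  rewrite mulrC -measurable_RintegralZl; first by apply: eq_Rintegral => y _; rewrite mulrC.
  exact: (measurable_fun_pair2 x mGx).
rewrite -(Rintegral_fubini i1).
transitivity (expR C * \int[gam]_y \int[lam]_x (G x * psi (x + gauss_disp y))).
  congr (_ * _); apply: eq_Rintegral => y _.
  rewrite -(@Rintegral_rV_shift _ _ (fun x => G (x - gauss_disp y) * psi x) (gauss_disp y)).
    by apply: eq_Rintegral => x _; rewrite addrK.
  exact: (measurable_fun_pair2 y mGpsi).
rewrite (Rintegral_fubini i2).
have mq : measurable_fun setT (fun z : 'rV[R]_d * 'rV[R]_d => psi (z.1 + gauss_disp z.2)).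
  apply: (measurableT_comp mpsi); apply: measurable_rV_addf; first exact: measurable_fst.
  by apply: mdisp; exact: measurable_snd.
have mpx x : measurable_fun setT (fun y => psi (x + gauss_disp y)).
  exact: (measurable_fun_pair2 x mq).
rewrite -measurable_RintegralZl.
  apply: eq_Rintegral => x _; rewrite /propag_adj mulrCA; congr (_ * _).
  by rewrite -measurable_RintegralZl.
have m' : measurable_fun setT
    (fun z : 'rV[R]_d * 'rV[R]_d => G z.1 * psi (z.1 + gauss_disp z.2)).
  by apply: measurable_funM => //; exact: (measurableT_comp mG measurable_fst).
exact: (@measurable_Rintegral_param _ _ _ _ _ gam _ m').
Qed.

End bound.
End lp.
End propagator.

Section measurable_propagators.
Context {R : realType} {d : nat}.

Lemma measurable_propag_param dT (T : measurableType dT) (A : T -> 'M[R]_d)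
    (B : T -> 'rV[R]_d) (C : T -> R) (G : T -> 'rV[R]_d -> R) :
  (forall i j, measurable_fun setT (fun th => A th i j)) -> measurable_fun setT B ->
  measurable_fun setT C -> measurable_fun setT (fun z : T * 'rV[R]_d => G z.1 z.2) ->
  measurable_fun setT (fun z : T * 'rV[R]_d => propag (A z.1) (B z.1) (C z.1) (G z.1) z.2).
Proof.
move=> mA mB mC mG.
(* The signs are arranged so that the shifted point is the opposite of a point of the form treated
   by [measurable_heat_dirs]. *)
have mX : measurable_fun setT (fun z : T * 'rV[R]_d => - (z.2 + B z.1)).
  apply: measurable_rV_oppf; apply: measurable_rV_addf; first exact: measurable_snd.
  exact: (measurableT_comp mB measurable_fst).
have mA' i j : measurable_fun setT (fun z : T * 'rV[R]_d => A z.1 i j).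
  exact: (measurableT_comp (mA i j) measurable_fst).
have mD := measurable_heat_dirs mA' mX.
have mh : measurable_fun setT (fun w : (T * 'rV[R]_d) * 'rV[R]_d =>
    G w.1.1 (w.1.2 - gauss_disp (A w.1.1) (B w.1.1) w.2)).
  have -> : (fun w : (T * 'rV[R]_d) * 'rV[R]_d =>
    G w.1.1 (w.1.2 - gauss_disp (A w.1.1) (B w.1.1) w.2)) =
    (fun z : T * 'rV[R]_d => G z.1 z.2) \o (fun w : (T * 'rV[R]_d) * 'rV[R]_d =>
      (w.1.1, - (- (w.1.2 + B w.1.1) + lincomb (heat_dirs (A w.1.1)) w.2))).
    apply/funext => w /=; congr G; rewrite /gauss_disp; apply/rowP => i; rewrite !mxE.
    have alg (x l b : R) : x - (l - b) = - (- (x + b) + l) by ring.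
    exact: alg.
  apply: (measurableT_comp mG); apply: measurable_fun_pair.
    exact: (measurableT_comp measurable_fst measurable_fst).
  exact: measurable_rV_oppf.
apply: measurable_funM.
  by apply: measurableT_comp => //; exact: (measurableT_comp mC measurable_fst).
exact: (@measurable_Rintegral_param _ _ _ _ _ (gauss_rV d) _ mh).
Qed.

Lemma Rintegral_oo (f : R -> R) s t : \int[lebesgue_measure]_(r in `]s, t[) f r =
  \int[lebesgue_measure]_r (if (s < r) && (r < t) then f r else 0).
Proof.
rewrite Rintegral_mkcond; apply: eq_Rintegral => r _.
by rewrite patchE mem_setE in_itv.
Qed.

Lemma integral_oo (f : R -> \bar R) s t : (\int[lebesgue_measure]_(r in `]s, t[) f r =
  \int[lebesgue_measure]_r (if (s < r)%R && (r < t)%R then f r else 0%E))%E.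
Proof.
rewrite integral_mkcond; apply: eq_integral => r _.
by rewrite patchE mem_setE in_itv.
Qed.

Lemma measurable_between dT (T : measurableType dT) (f g h : T -> R) :
  measurable_fun setT f -> measurable_fun setT g -> measurable_fun setT h ->
  measurable_fun setT (fun z => (f z < g z) && (g z < h z)).
Proof. by move=> mf mg mh; apply: measurable_and; exact: measurable_fun_ltr. Qed.

Variables (a : 'I_d -> 'I_d -> R -> R) (b : 'I_d -> R -> R) (c : R -> R).
Hypothesis ma : forall i j, measurable_fun setT (a i j).
Hypothesis mb : forall i, measurable_fun setT (b i).
Hypothesis mc : measurable_fun setT c.

Lemma measurable_itvint_param dT (T : measurableType dT) (f : R -> R) (s t : T -> R) :
  measurable_fun setT f -> measurable_fun setT s -> measurable_fun setT t ->
  measurable_fun setT (fun th => itvint f (s th) (t th)).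
Proof.
move=> mf ms mt.
have mst : measurable_fun setT (fun th => (s th, t th) : measurableTypeR R * measurableTypeR R).
  by apply: measurable_fun_pair.
exact: (measurableT_comp (measurable_itvint mf) mst).
Qed.

Definition prop_st s t (G : 'rV[R]_d -> R) : 'rV[R]_d -> R :=
  propag (diffusion_mx a s t) (drift_vec b s t) (itvint c s t) G.

Lemma measurable_prop_st dT (T : measurableType dT) (s t : T -> R) (G : T -> 'rV[R]_d -> R) :
  measurable_fun setT s -> measurable_fun setT t ->
  measurable_fun setT (fun z : T * 'rV[R]_d => G z.1 z.2) ->
  measurable_fun setT (fun z : T * 'rV[R]_d => prop_st (s z.1) (t z.1) (G z.1) z.2).
Proof.
move=> ms mt mG.
apply: (@measurable_propag_param _ T (fun th => diffusion_mx a (s th) (t th))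
  (fun th => drift_vec b (s th) (t th)) (fun th => itvint c (s th) (t th)) G) => //.
- move=> i j; under eq_fun do rewrite mxE; apply: measurable_funM => //.
  by apply: measurable_funD; exact: measurable_itvint_param.
- apply/measurable_fun_rVP => i; under eq_fun do rewrite mxE.
  exact: measurable_itvint_param.
- exact: measurable_itvint_param.
Qed.

Lemma evol_propag_adj K psi s t x : blip K psi ->
  evol a b c psi s t x =
  propag_adj (diffusion_mx a s t) (drift_vec b s t) (itvint c s t) psi x.
Proof. by move=> hpsi; rewrite (propag_adjE _ _ _ _ hpsi). Qed.

End measurable_propagators.

(** * Integrating the dual integral equation against the source *)

Section duhamel_fubini.
Context {R : realType} {dX : measure_display} {X : measurableType dX}.
Variable nu : {sigma_finite_measure set X -> \bar R}.
Local Notation lam := (@lebesgue_measure R).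
Variables (F : R -> X -> R) (phi : X -> R) (E : R -> X -> R) (Q : R -> R -> X -> R).
Variables (n : R -> R) (w : R -> R -> R) (t : R).
Hypothesis mF : measurable_fun setT (fun z : measurableTypeR R * X => F z.1 z.2).
Hypothesis mphi : measurable_fun setT phi.
Hypothesis mQ : measurable_fun setT
  (fun z : (measurableTypeR R * measurableTypeR R) * X => Q z.1.1 z.1.2 z.2).
Hypothesis EQ : forall s x, 0 < s < t -> E s x = phi x + itvint (fun q => Q s q x) s t.
Hypothesis Fphi : forall s, (\int[nu]_x `|F s x * phi x|%:E <= (n s)%:E)%E.
Hypothesis FQ : forall s q, (\int[nu]_x `|F s x * Q s q x|%:E <= (w s q)%:E)%E.
Hypothesis int_n : (\int[lam]_(s in `]0%R, t[) (n s)%:E < +oo)%E.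
Hypothesis int_w : forall s, 0 < s < t -> (\int[lam]_(q in `]s, t[) (w s q)%:E < +oo)%E.
Hypothesis int_w2 : (\int[lam]_(q in `]0%R, t[) \int[lam]_(s in `]0%R, q[) (w s q)%:E < +oo)%E.

Let P s q := \int[nu]_x (F s x * Q s q x).

Let w0 s q : 0 <= w s q.
Proof. by rewrite -lee_fin; apply: le_trans (FQ s q); apply: integral_ge0. Qed.

Let n0 s : 0 <= n s.
Proof. by rewrite -lee_fin; apply: le_trans (Fphi s); apply: integral_ge0. Qed.

Let mFQ : measurable_fun setT (fun z : (measurableTypeR R * measurableTypeR R) * X =>
  F z.1.1 z.2 * Q z.1.1 z.1.2 z.2).
Proof.
apply: measurable_funM; last exact: mQ.
apply: (measurableT_comp mF (g := fun z : (measurableTypeR R * measurableTypeR R) * X =>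
  (z.1.1, z.2))).
apply: measurable_fun_pair; last exact: measurable_snd.
exact: (measurableT_comp measurable_fst measurable_fst).
Qed.

Let mFphi : measurable_fun setT (fun z : measurableTypeR R * X => F z.1 z.2 * phi z.2).
Proof. by apply: measurable_funM; [exact: mF|exact: (measurableT_comp mphi measurable_snd)]. Qed.

Let mP : measurable_fun setT (fun z : measurableTypeR R * measurableTypeR R => P z.1 z.2).
Proof. exact: (@measurable_Rintegral_param _ _ _ _ _ nu _ mFQ). Qed.

Let P_le s q : `|P s q| <= w s q.
Proof.
rewrite -lee_fin; apply: le_trans (FQ s q); apply: norm_Rintegral_le.
exact: (measurable_fun_pair2 ((s, q) : measurableTypeR R * measurableTypeR R) mFQ).
Qed.

Let mFphis s : measurable_fun setT (fun x => F s x * phi x).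
Proof. exact: (measurable_fun_pair2 s mFphi). Qed.

Let iFphi s : nu.-integrable setT (EFin \o (fun x => F s x * phi x)).
Proof.
apply/integrableP; split; first exact/measurable_EFinP.
exact: le_lt_trans (Fphi s) (ltry _).
Qed.

(** Fubini in [(x, q)] at one fixed [s]; the bound [int_w] holds for every [s] in the interval, so
    no exceptional set of starting times arises. *)
Let slice s : 0 < s < t ->
  \int[nu]_x (F s x * E s x) = \int[nu]_x (F s x * phi x) + itvint (P s) s t.
Proof.
move=> st.
pose H (z : X * measurableTypeR R) : R :=
  if (s < z.2) && (z.2 < t) then F s z.1 * Q s z.2 z.1 else 0.
have mH : measurable_fun setT H.
  apply: measurable_fun_ifT; last exact: measurable_cst.
    by apply: measurable_between => //; exact: measurable_snd.
  apply: (measurableT_comp mFQ (g := fun z : X * measurableTypeR R =>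
    (((s : measurableTypeR R), z.2), z.1))).
  apply: measurable_fun_pair; last exact: measurable_fst.
  by apply: measurable_fun_pair; [exact: measurable_cst|exact: measurable_snd].
have iH : (nu \x lam)%E.-integrable setT (EFin \o H).
  apply/integrable21ltyP; first exact/measurable_EFinP.
  apply: le_lt_trans (int_w st); rewrite integral_oo; apply: le_integral_ge0 => q _.
    exact: integral_ge0.
  rewrite /H /=; case: (_ && _); first exact: FQ.
  by rewrite integral0_eq// => x _; rewrite normr0.
have HE x : \int[lam]_q H (x, q) = F s x * itvint (fun q => Q s q x) s t.
  rewrite /itvint Rintegral_oo -measurable_RintegralZl.
    by apply: eq_Rintegral => q _; rewrite /H /=; case: (_ && _) => //; rewrite mulr0.
  apply: measurable_fun_ifT; last exact: measurable_cst.
    by apply: measurable_between.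
  apply: (measurableT_comp mQ (g := fun q : measurableTypeR R => (((s : measurableTypeR R), q), x))).
  by apply: measurable_fun_pair; [exact: measurable_fun_pair|exact: measurable_cst].
transitivity (\int[nu]_x (F s x * phi x + \int[lam]_q H (x, q))).
  by apply: eq_Rintegral => x _; rewrite EQ// mulrDr HE.
rewrite RintegralD//; last exact: integrable_Rintegral_param.
congr (_ + _); rewrite (Rintegral_fubini iH) /itvint Rintegral_oo.
apply: eq_Rintegral => q _; rewrite /H /=; case: (_ && _) => //.
by rewrite Rintegral_cst// mul0r.
Qed.

(** With the slices at hand only the triangle [0 < s < q < t] has to be swapped; [int_w2] makes its
    integrand absolutely integrable. *)
Lemma duhamel_fubini :
  \int[lam]_(s in `]0, t[) \int[nu]_x (F s x * E s x) =
  \int[lam]_(q in `]0, t[) \int[lam]_(s in `]0, q[) P s q +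
  \int[lam]_(s in `]0, t[) \int[nu]_x (F s x * phi x).
Proof.
pose G (z : measurableTypeR R * measurableTypeR R) : R :=
  if (0 < z.2) && (z.2 < t) then if (0 < z.1) && (z.1 < z.2) then P z.1 z.2 else 0 else 0.
have mG : measurable_fun setT G.
  apply: measurable_fun_ifT; last exact: measurable_cst.
    by apply: measurable_between => //; exact: measurable_snd.
  apply: measurable_fun_ifT; [|exact: mP|exact: measurable_cst].
  by apply: measurable_between; [exact: measurable_cst|exact: measurable_fst|exact: measurable_snd].
have iG : (lam \x lam)%E.-integrable setT (EFin \o G).
  apply/integrable21ltyP; first exact/measurable_EFinP.
  apply: le_lt_trans int_w2; rewrite integral_oo; apply: le_integral_ge0 => q _.
    exact: integral_ge0.
  rewrite /G /=; case: (_ && _); last by rewrite integral0_eq// => s _; rewrite normr0.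
  rewrite integral_oo; apply: le_integral_ge0 => s _ //.
  by case: (_ && _); rewrite lee_fin ?normr0.
have -> : \int[lam]_(q in `]0, t[) \int[lam]_(s in `]0, q[) P s q = \int[lam]_q \int[lam]_s G (s, q).
  rewrite Rintegral_oo; apply: eq_Rintegral => q _; rewrite /G /=.
  case: ((0 < q) && (q < t)); first by rewrite Rintegral_oo.
  by rewrite Rintegral_cst// mul0r.
rewrite -(Rintegral_fubini iG).
have nfi : lam.-integrable setT (EFin \o (fun s => if (0 < s) && (s < t) then
    \int[nu]_x (F s x * phi x) else 0)).
  apply/integrableP; split.
    apply/measurable_EFinP; apply: measurable_fun_ifT; last exact: measurable_cst.
      exact: measurable_between.
    exact: (@measurable_Rintegral_param _ _ _ _ _ nu _ mFphi).
  apply: le_lt_trans int_n; rewrite integral_oo; apply: le_integral_ge0 => s _ //=.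
  case: (_ && _); last by rewrite normr0.
  exact: le_trans (norm_Rintegral_le nu (mFphis s)) (Fphi s).
rewrite addrC [X in _ = X + _]Rintegral_oo -RintegralD//; last exact: integrable_Rintegral_param.
rewrite Rintegral_oo; apply: eq_Rintegral => s _.
case: ifPn => [st|nst]; last first.
  rewrite add0r (_ : (fun q => G (s, q)) = cst 0) ?Rintegral_cst ?mul0r//.
  apply/funext => q; rewrite /G /=; case: ifPn => // /andP[q0 qt].
  case: ifPn => // /andP[s0 sq]; move: nst; rewrite s0 /= -leNgt => ts.
  by have := lt_le_trans (lt_trans sq qt) ts; rewrite ltxx.
rewrite slice//; congr (_ + _); rewrite /itvint Rintegral_oo.
apply: eq_Rintegral => q _; rewrite /G /=; case/andP: st => s0 st.
rewrite s0 /=; case: (ltP s q) => sq /=; last by case: (_ && _).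
by rewrite (lt_trans s0 sq).
Qed.

End duhamel_fubini.

(** * The Cauchy problem with Borel data *)

Section borel_problem.
Context {R : realType} {d : nat}.
Variables (a : 'I_d -> 'I_d -> R -> R) (b : 'I_d -> R -> R) (c mu : R -> R).
Implicit Types (phi psi : 'rV[R]_d -> R) (x z : 'rV[R]_d).
Local Notation lam := (@lebesgue_measure R).
Local Notation lamd := (@lebesgue_rV R d).
Hypothesis ma : forall i j, measurable_fun setT (a i j).
Hypothesis mb : forall i, measurable_fun setT (b i).
Hypothesis mc : measurable_fun setT c.
Hypothesis mmu : measurable_fun setT mu.
Hypothesis amu : forall i j r, `|a i j r| <= mu r.
Hypothesis bmu : forall i r, `|b i r| <= mu r.
Hypothesis cmu : forall r, `|c r| <= mu r.
Hypothesis a_ge0 : forall r (xi : 'rV[R]_d),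
  0 <= \sum_i \sum_j a i j r * xi ord0 i * xi ord0 j.
Variables (T : R) (p : \bar R) (F : R -> 'rV[R]_d -> R) (nf : R -> R).
Hypothesis p1 : (1 <= p)%E.
Hypothesis mF : measurable_fun setT (fun w : measurableTypeR R * 'rV[R]_d => F w.1 w.2).
Hypothesis mnf : measurable_fun setT nf.
Hypothesis nf0 : forall s, 0 <= nf s.
Hypothesis nfF : forall s, nf s = 0 -> forall x, F s x = 0.
Hypothesis Fnf : forall s, lp_bound lamd p (F s) (nf s).
Hypothesis imu : forall s t, 0 < s -> s < t -> t < T -> lam.-integrable `]s, t[ (EFin \o mu).

(** A bound for the L^p norm at time [t] of the source slice released at time [s]. *)
Definition weight s t : R := expR (itvint c s t) * nf s.

Definition total_weight t : \bar R := \int[lam]_(s in `]0%R, t[) (weight s t)%:E.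

Hypothesis iabs : forall t, 0 < t < T -> (\int[lam]_(s in `]0%R, t[)
  (expR (itvint (fun r => `|c r|) s t) * nf s)%:E < +oo)%E.
Hypothesis imuW : forall t, 0 < t < T ->
  (\int[lam]_(s in `]0%R, t[) ((mu s)%:E * total_weight s) < +oo)%E.

Local Notation prop_st := (prop_st a b c).
Local Notation evol := (evol a b c).

Definition solution t x : R := \int[lam]_(s in `]0, t[) prop_st s t (F s) x.

Let mu0 r : 0 <= mu r. Proof. exact: le_trans (normr_ge0 _) (cmu r). Qed.

Let weight0 s t : 0 <= weight s t. Proof. by rewrite mulr_ge0// expR_ge0. Qed.

Lemma total_weight_ge0 t : (0 <= total_weight t)%E.
Proof. by apply: integral_ge0 => s _; rewrite lee_fin. Qed.

Let weight_le s q t : 0 < s -> s < q -> q <= t -> t < T ->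
  weight s q <= expR (itvint (fun r => `|c r|) s t) * nf s.
Proof.
move=> s0 sq qt tT; rewrite /weight ler_wpM2r// ler_expR; apply: le_trans (ler_norm _) _.
have mabs : measurable_fun setT (fun r => `|c r|) by exact: measurableT_comp.
have iac : lam.-integrable `]s, t[ (EFin \o (fun r => `|c r|)).
  apply: (integrable_dominated mabs _ (imu s0 (lt_le_trans sq qt) tT)) => r _.
  by rewrite normr_id.
apply: (@le_trans _ _ (itvint (fun r => `|c r|) s q)).
  by apply: itvint_norm_le => //; exact: (integrable_subitv (lexx s) qt).
by rewrite (itvint_add (ltW sq) qt iac) lerDl /itvint Rintegral_ge0.
Qed.

Let iW t : 0 < t < T -> (total_weight t < +oo)%E.
Proof.
move=> tT; apply: le_lt_trans (iabs tT).
apply: le_integral_ge0 => s; first by rewrite lee_fin.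
rewrite /= in_itv/= => /andP[s0 st]; rewrite lee_fin.
by apply: (weight_le s0 st (lexx t)); case/andP: tT.
Qed.

Let inf t : 0 < t < T -> (\int[lam]_(s in `]0%R, t[) (nf s)%:E < +oo)%E.
Proof.
move=> tT; apply: le_lt_trans (iabs tT).
apply: le_integral_ge0 => s _; first by rewrite lee_fin.
rewrite lee_fin ler_peMl// -expR0 ler_expR /itvint Rintegral_ge0//.
Qed.

(** With [|c|] in the exponent, the integrand for [t] dominates [weight s q] for every [q <= t], so
    [total_weight] is bounded on []0, t[] by one finite constant. *)
Lemma integral_total_weight t : 0 < t < T -> (\int[lam]_(q in `]0%R, t[) total_weight q < +oo)%E.
Proof.
move=> tT; have [t0 tT'] := andP tT.
set I := (\int[lam]_(s in `]0%R, t[) (expR (itvint (fun r => `|c r|) s t) * nf s)%:E)%E.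
have I0 : (0 <= I)%E by apply: integral_ge0 => s _; rewrite lee_fin mulr_ge0// expR_ge0.
apply: (@le_lt_trans _ _ (\int[lam]_(q in `]0%R, t[) I)%E); last first.
  rewrite integral_cst; last exact: measurable_ooitv.
  apply: lte_mul_pinfty => //; first by rewrite ge0_fin_numE// iabs.
  have E : lebesgue_measure [set` `]0%R, t[] = t%:E :> \bar R.
    by rewrite lebesgue_measure_itv/= lte_fin t0 -EFinB subr0.
  by move: (ltry t); rewrite -E.
apply: le_integral_ge0 => q; first by move=> _; exact: total_weight_ge0.
rewrite /= in_itv/= => /andP[q0 qt].
apply: (@le_trans _ _ (\int[lam]_(s in `]0%R, q[)
  (expR (itvint (fun r => `|c r|) s t) * nf s)%:E)%E).
  apply: le_integral_ge0 => s; first by rewrite lee_fin.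
  by rewrite /= in_itv/= => /andP[s0 sq]; rewrite lee_fin (weight_le s0 sq (ltW qt)).
rewrite /I !integral_oo; apply: le_integral_ge0 => s _.
  by case: (_ && _) => //; rewrite lee_fin mulr_ge0// expR_ge0.
case: ifP => [/andP[s0 sq]|_]; first by rewrite s0 (lt_trans sq qt).
by case: (_ && _) => //; rewrite lee_fin mulr_ge0// expR_ge0.
Qed.

Let W t : R := fine (total_weight t).

Let WE t : 0 < t < T -> (W t)%:E = total_weight t.
Proof. by move=> tT; rewrite /W fineK// ge0_fin_numE ?total_weight_ge0// iW. Qed.

Let mFs s : measurable_fun setT (F s).
Proof. exact: (measurable_fun_pair2 s mF). Qed.

Let mweight dT (U : measurableType dT) (s t : U -> R) : measurable_fun setT s ->
  measurable_fun setT t -> measurable_fun setT (fun u => weight (s u) (t u)).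
Proof.
move=> ms mt; apply: measurable_funM; last exact: (measurableT_comp mnf ms).
by apply: measurableT_comp => //; exact: measurable_itvint_param.
Qed.

(** The integrand of [solution] extended by 0, so that the domain of integration no longer depends
    on [t]. *)
Let h (w : (R * 'rV[R]_d) * R) : R :=
  if (0 < w.2) && (w.2 < w.1.1) then prop_st w.2 w.1.1 (F w.2) w.1.2 else 0.

Let mh : measurable_fun setT
  (h : (measurableTypeR R * 'rV[R]_d) * measurableTypeR R -> R).
Proof.
have m1 : measurable_fun setT
    (fun w : (measurableTypeR R * 'rV[R]_d) * measurableTypeR R => w.1.1).
  exact: (measurableT_comp measurable_fst measurable_fst).
have m2 : measurable_fun setT
    (fun w : (measurableTypeR R * 'rV[R]_d) * measurableTypeR R => w.1.2).
  exact: (measurableT_comp measurable_snd measurable_fst).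
apply: measurable_fun_ifT => //.
  by apply: measurable_between => //; exact: measurable_snd.
pose q (w : (measurableTypeR R * 'rV[R]_d) * measurableTypeR R) :
  (measurableTypeR R * measurableTypeR R) * 'rV[R]_d := ((w.2, w.1.1), w.1.2).
have mq : measurable_fun setT q.
  apply: measurable_fun_pair => //; apply: measurable_fun_pair => //; exact: measurable_snd.
have mF' : measurable_fun setT (fun z : (measurableTypeR R * measurableTypeR R) * 'rV[R]_d =>
    F z.1.1 z.2).
  apply: (measurableT_comp mF (g := fun z : (measurableTypeR R * measurableTypeR R) * 'rV[R]_d =>
    (z.1.1, z.2))).
  apply: measurable_fun_pair; last exact: measurable_snd.
  exact: (measurableT_comp measurable_fst measurable_fst).
pose TT := (measurableTypeR R * measurableTypeR R)%type.
have mp := measurable_prop_st ma mb mc (s := fun z : TT => z.1) (t := fun z : TT => z.2)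
  (G := fun z : TT => F z.1) measurable_fst measurable_snd mF'.
have mpq : measurable_fun setT ((fun z : (measurableTypeR R * measurableTypeR R) * 'rV[R]_d =>
  prop_st z.1.1 z.1.2 (F z.1.1) z.2) \o q).
  apply: measurableT_comp.
    exact: mp.
  exact: mq.
apply: mpq.
Qed.

Let solutionE t x : solution t x = \int[lam]_s h ((t, x), s).
Proof. exact: Rintegral_oo. Qed.

Lemma measurable_solution :
  measurable_fun setT (fun w : measurableTypeR R * 'rV[R]_d => solution w.1 w.2).
Proof.
have -> : (fun w : measurableTypeR R * 'rV[R]_d => solution w.1 w.2) =
    (fun w => \int[lam]_s h (w, s)).
  by apply/funext => -[t x]; exact: solutionE.
exact: (@measurable_Rintegral_param _ _ _ _ _ lam _ mh).
Qed.

Let mst t : measurable_fun setT (solution t).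
Proof. exact: (measurable_fun_pair2 t measurable_solution). Qed.

Let ht t : measurable_fun setT (fun w : measurableTypeR R * 'rV[R]_d => h ((t, w.2), w.1)).
Proof.
apply: (measurableT_comp mh (g := fun w : measurableTypeR R * 'rV[R]_d =>
  (((t : measurableTypeR R), w.2), w.1))).
apply: measurable_fun_pair; last exact: measurable_fst.
by apply: measurable_fun_pair => //; exact: measurable_snd.
Qed.

Let wt t s := if (0 < s) && (s < t) then weight s t else 0.

Let wt0 t s : 0 <= wt t s. Proof. by rewrite /wt; case: ifP. Qed.

Let mwt t : measurable_fun setT (wt t).
Proof.
apply: measurable_fun_ifT => //; last exact: mweight.
exact: measurable_between.
Qed.

Let iwt t : (\int[lam]_s (wt t s)%:E = total_weight t)%E.
Proof. by rewrite /total_weight integral_oo; apply: eq_integral => s _; rewrite /wt; case: ifP. Qed.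

Lemma measurable_total_weight :
  measurable_fun setT (total_weight : measurableTypeR R -> \bar R).
Proof.
have mw : measurable_fun setT
    (fun z : measurableTypeR R * measurableTypeR R => (wt z.1 z.2)%:E).
  apply/measurable_EFinP; apply: measurable_fun_ifT; last exact: measurable_cst.
    by apply: measurable_between; [exact: measurable_cst|exact: measurable_snd|exact: measurable_fst].
  by apply: mweight; [exact: measurable_snd|exact: measurable_fst].
have -> : total_weight = fubini_F lam (fun z : measurableTypeR R * measurableTypeR R =>
    (wt z.1 z.2)%:E) by apply/funext => t; rewrite -iwt.
by apply: measurable_fun_fubini_tonelli_F => // z; rewrite lee_fin.
Qed.

Let h_bound t s : lp_bound lamd p (fun x => h ((t, x), s)) (wt t s).
Proof.
rewrite /wt /h /=; case: ifP => _; last exact: lp_bound0.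
exact: (lp_bound_propag (diffusion_mx a s t) (drift_vec b s t) (itvint c s t)
  p1 (mFs s) (nf0 s) (nfF (s := s)) (Fnf s)).
Qed.

Lemma lp_bound_solution t : 0 < t < T -> lp_bound lamd p (solution t) (W t).
Proof.
move=> tT.
apply: (@lp_bound_integral _ _ _ lamd _ _ lam p _ (wt t) _ _ p1 (ht t)) => //.
- exact: mwt.
(* Exponentials are positive, so a vanishing weight forces [nf s = 0], and then the whole source
   slice is 0. *)
- move=> s x; rewrite /wt /h /=; case: ((0 < s) && (s < t)) => // /eqP.
  rewrite mulf_eq0 (gt_eqF (expR_gt0 _)) /= => /eqP nfs.
  have -> : F s = cst 0 by apply/funext => y; exact: nfF.
  by rewrite /prop_st /propag Rintegral_cst// mul0r mulr0.
- by move=> s; exact: h_bound.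
- by rewrite iwt WE.
- move=> x; rewrite solutionE; apply: norm_Rintegral_le.
  exact: (measurable_fun_pair2 (t, x) mh).
Qed.

Section pairing.
Variables (K r : R).
Hypothesis K0 : 0 <= K.
Hypothesis HK : forall (g psi : 'rV[R]_d -> R) N M,
  measurable_fun setT g -> 0 <= N -> 0 <= M -> lp_bound lamd p g N ->
  (forall x, `|psi x| <= M) -> (forall x, psi x != 0 -> box r x) ->
  (\int[lamd]_x `|g x * psi x|%:E <= (K * M * N)%:E)%E.

Section dual.
Variables (psi : 'rV[R]_d -> R) (L M : R).
Hypothesis hpsi : blip L psi.
Hypothesis M0 : 0 <= M.
Hypothesis psiM : forall x, `|psi x| <= M.
Hypothesis suppsi : forall x, psi x != 0 -> box r x.

Lemma source_evol_bound s t :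
  (\int[lamd]_x `|F s x * evol psi s t x|%:E <= (K * (expR (itvint c s t) * M) * nf s)%:E)%E.
Proof.
under eq_integral do rewrite (evol_propag_adj _ _ _ _ _ _ hpsi).
apply: (propag_adj_bound (diffusion_mx a s t) (drift_vec b s t) (itvint c s t)
  (mFs s) (Fnf s) hpsi) => g mg gN.
exact: HK.
Qed.

Lemma solution_pairing_bound t : 0 < t < T ->
  (\int[lamd]_x `|solution t x * psi x|%:E <= (K * M * W t)%:E)%E.
Proof.
move=> tT; apply: HK => //; last exact: lp_bound_solution.
by rewrite /W fine_ge0// total_weight_ge0.
Qed.

(** Fubini in [(s, x)], then [propag_duality] for each [s]. *)
Lemma solution_duality t : 0 < t < T ->
  \int[lamd]_x (solution t x * psi x) =
  \int[lam]_(s in `]0, t[) \int[lamd]_x (F s x * evol psi s t x).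
Proof.
move=> tT; rewrite Rintegral_oo.
have mpsi := blip_measurable hpsi.
pose g (w : measurableTypeR R * 'rV[R]_d) := h ((t, w.2), w.1) * psi w.2.
have mg : measurable_fun setT g.
  by apply: measurable_funM; [exact: ht|exact: (measurableT_comp mpsi measurable_snd)].
have gi : (lam \x lamd)%E.-integrable setT (EFin \o g).
  apply/integrable12ltyP; first exact/measurable_EFinP.
  apply: (@le_lt_trans _ _ ((K * M)%:E * total_weight t)%E).
    have mE : measurable_fun setT (fun s : measurableTypeR R => (wt t s)%:E).
      by apply/measurable_EFinP; exact: mwt.
    rewrite -iwt -(ge0_integralZl _ measurableT mE); last 2 first.
    - by move=> s _; rewrite lee_fin.
    - by rewrite lee_fin mulr_ge0.
    apply: le_integral_ge0 => s _; first exact: integral_ge0.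
    exact: (HK (measurable_fun_pair2 s (ht t)) (wt0 t s) M0 (h_bound t s) psiM suppsi).
  by rewrite -WE// -EFinM ltry.
transitivity (\int[lamd]_x \int[lam]_s g (s, x)).
  apply: eq_Rintegral => x _; rewrite solutionE mulrC -measurable_RintegralZl.
    by apply: eq_Rintegral => s _; rewrite mulrC.
  exact: (measurable_fun_pair2 (t, x) mh).
rewrite -(Rintegral_fubini gi); apply: eq_Rintegral => s _.
rewrite /g /h /=; case: ifP => _; last first.
  by under eq_Rintegral do rewrite mul0r; rewrite Rintegral_cst// mul0r.
rewrite (propag_duality (diffusion_mx a s t) (drift_vec b s t) (itvint c s t) (mFs s) (Fnf s) hpsi (M := M) (K := K)).
  by apply: eq_Rintegral => x _; rewrite (evol_propag_adj _ _ _ _ _ _ hpsi).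
by move=> *; exact: HK.
Qed.

End dual.

Section weak.
Variables (phi : 'rV[R]_d -> R) (M : R) (L : @term d -> R).
Hypothesis M0 : 0 <= M.
Hypothesis tphi : test_function phi.
Hypothesis tfL : forall k, blip (L k) (term_fun phi k).
Hypothesis tfM : forall k x, `|term_fun phi k x| <= M.
Hypothesis supptf : forall k x, term_fun phi k x != 0 -> box r x.
Local Notation adj q := (adjoint a b c q phi).

Let M' : R := #|{: @term d}|%:R * M.

Let M'0 : 0 <= M'. Proof. by rewrite mulr_ge0. Qed.

Let adjE q : adj q = fun x => \sum_k coef a b c k q * term_fun phi k x.
Proof. by apply/funext => x; exact: adjoint_term. Qed.

Let adj_le q x : `|adj q x| <= M' * mu q.
Proof.
rewrite adjE; apply: le_trans (ler_norm_sum _ _ _) _.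
rewrite /M' -mulrA mulr_natl -sumr_const; apply: ler_sum => k _.
by rewrite normrM mulrC ler_pM// (coef_le amu bmu cmu).
Qed.

Let adj_supp q x : adj q x != 0 -> box r x.
Proof.
rewrite adjE; apply: contraNP => /= nbx; rewrite big1// => k _.
rewrite [X in _ * X](_ : _ = 0) ?mulr0//.
by apply/eqP; apply: contra_notT nbx; exact: supptf.
Qed.

Let adj_blip q : exists K', blip K' (adj q).
Proof. by rewrite adjE; exact: blip_sum tfL. Qed.

(** At a fixed time [q] the coefficients are constants, so the integrand of [evol_integral] is the
    evolution of one test function, [adj q], to which duality applies. *)
Let evol_adj s q x : evol (adj q) s q x =
  \sum_k coef a b c k q * evol (term_fun phi k) s q x.
Proof.
rewrite /evol /heat adjE (gavgs_sum _ _ _ _ tfL) mulr_sumr; apply: eq_bigr => k _.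
by rewrite mulrCA.
Qed.

Let mevol : measurable_fun setT (fun z : (measurableTypeR R * measurableTypeR R) * 'rV[R]_d =>
  evol (adj z.1.2) z.1.1 z.1.2 z.2).
Proof.
under eq_fun do rewrite evol_adj; apply: measurable_sum => k.
apply: measurable_funM.
  apply: (measurableT_comp (measurable_coef ma mb mc k)).
  exact: (measurableT_comp measurable_snd measurable_fst).
apply: (measurable_evol ma mb mc (tfL k)); last exact: measurable_snd.
  exact: (measurableT_comp measurable_fst measurable_fst).
exact: (measurableT_comp measurable_snd measurable_fst).
Qed.

Let phiM x : `|phi x| <= M. Proof. exact: (tfM (inr (inr ord0))). Qed.

Let phisupp x : phi x != 0 -> box r x. Proof. exact: (supptf (k := inr (inr ord0))). Qed.

Let phiL : blip (L (inr (inr ord0))) phi. Proof. exact: (tfL (inr (inr ord0))). Qed.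

Lemma solution_adjoint_bound q : 0 < q < T ->
  (\int[lamd]_x `|(solution q x * adj q x)%R|%:E <= (K * M')%:E * ((mu q)%:E * total_weight q))%E.
Proof.
move=> qT; have [K' hK'] := adj_blip q.
apply: le_trans (solution_pairing_bound (mulr_ge0 M'0 (mu0 q)) (adj_le q) (@adj_supp q) qT) _.
by rewrite -WE// -!EFinM lee_fin !mulrA.
Qed.

(** Here mu is integrated down to time 0, where it may fail to be integrable by itself; [imuW]
    supplies the compensation by [total_weight]. *)
Let int_mu_weight t : 0 < t < T ->
  (\int[lam]_(q in `]0%R, t[) ((K * M')%:E * ((mu q)%:E * total_weight q)) < +oo)%E.
Proof.
move=> tT; rewrite ge0_integralZl; first by rewrite lte_mul_pinfty// ?lee_fin ?mulr_ge0// imuW.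
- exact: measurable_ooitv.
- apply: measurable_funTS; apply: emeasurable_funM; last exact: measurable_total_weight.
  exact/measurable_EFinP.
- by move=> q _; rewrite mule_ge0 ?lee_fin ?total_weight_ge0.
- by rewrite lee_fin mulr_ge0.
Qed.

Lemma solution_weak_bound t : 0 < t < T ->
  (\int[lam]_(q in `]0%R, t[) \int[lamd]_x `|(solution q x * adj q x)%R|%:E < +oo)%E.
Proof.
move=> tT; apply: le_lt_trans (int_mu_weight tT).
apply: le_integral_ge0 => q; rewrite /= in_itv/= => /andP[q0 qt]; first exact: integral_ge0.
by apply: solution_adjoint_bound; rewrite q0 (lt_trans qt)//; case/andP: tT.
Qed.

(** For [s > 0] mu is integrable over []s, t[], which bounds the exponential and then the
    integral. *)
Let int_weight_slice s t : 0 < s < t -> t < T ->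
  (\int[lam]_(q in `]s, t[) (K * (expR (itvint c s q) * (M' * mu q)) * nf s)%:E < +oo)%E.
Proof.
move=> /andP[s0 st] tT; have im := imu s0 st tT.
have nmu r' : `|mu r'| <= mu r' by rewrite ger0_norm.
pose k := K * expR (itvint mu s t) * M' * nf s.
have k0 : 0 <= k by rewrite !mulr_ge0// expR_ge0.
apply: (@le_lt_trans _ _ (\int[lam]_(q in `]s, t[) (k%:E * (mu q)%:E))%E).
  apply: le_integral_ge0 => q; rewrite /= in_itv/= => /andP[sq qt].
    by rewrite lee_fin !mulr_ge0// expR_ge0.
  rewrite -EFinM lee_fin.
  have -> : K * (expR (itvint c s q) * (M' * mu q)) * nf s =
    expR (itvint c s q) * (K * M' * nf s * mu q) by ring.
  have -> : k * mu q = expR (itvint mu s t) * (K * M' * nf s * mu q) by rewrite /k; ring.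
  apply: ler_wpM2r; first by rewrite !mulr_ge0.
  have imq := integrable_subitv (lexx s) (ltW qt) im.
  rewrite ler_expR; apply: le_trans (ler_norm _) _.
  apply: (@le_trans _ _ (itvint mu s q)).
    by apply: itvint_norm_le => // r' _; exact: cmu.
  rewrite (itvint_add (ltW sq) (ltW qt) im) lerDl /itvint Rintegral_ge0//.
rewrite ge0_integralZl.
- rewrite lte_mul_pinfty// ?lee_fin//.
  case/integrableP : im => _; apply: le_lt_trans.
  by apply: le_integral_ge0 => q _; rewrite lee_fin// ler_norm.
- exact: measurable_ooitv.
- by apply: measurable_funTS; exact/measurable_EFinP.
- by move=> q _; rewrite lee_fin.
- by rewrite lee_fin.
Qed.

Let int_weight2 t : 0 < t < T ->
  (\int[lam]_(q in `]0%R, t[) \int[lam]_(s in `]0%R, q[)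
    (K * (expR (itvint c s q) * (M' * mu q)) * nf s)%:E < +oo)%E.
Proof.
move=> tT; apply: le_lt_trans (int_mu_weight tT).
apply: le_integral_ge0 => q qt.
  by apply: integral_ge0 => s _; rewrite lee_fin !mulr_ge0// expR_ge0.
rewrite muleA -EFinM /total_weight -ge0_integralZl.
- apply: le_integral_ge0 => s _; first by rewrite lee_fin !mulr_ge0// expR_ge0.
  rewrite -EFinM lee_fin /weight.
  have alg (e k m v n : R) : k * (e * (m * v)) * n = k * m * v * (e * n) by ring.
  by rewrite alg.
- exact: measurable_ooitv.
- apply: measurable_funTS; apply/measurable_EFinP; exact: mweight.
- by move=> s _; rewrite lee_fin.
- by rewrite lee_fin !mulr_ge0.
Qed.

(** Duality moves the propagators onto [phi], [evol_integral] expands the result, and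
    [duhamel_fubini] exchanges the integrals; duality at each time [q], now tested against [adj q],
    reassembles the solution. *)
Lemma solution_weak t : 0 < t < T ->
  \int[lamd]_x (solution t x * phi x) =
  \int[lam]_(q in `]0, t[) \int[lamd]_x (solution q x * adj q x) +
  \int[lam]_(s in `]0, t[) \int[lamd]_x (F s x * phi x).
Proof.
move=> tT; have [t0 tT'] := andP tT.
have qT q : 0 < q < t -> 0 < q < T by case/andP => -> /lt_trans; exact.
rewrite (solution_duality phiL M0 phiM phisupp tT).
rewrite (@duhamel_fubini _ _ _ lamd F phi (fun s x => evol phi s t x)
  (fun s q x => evol (adj q) s q x) (fun s => K * M * nf s)
  (fun s q => K * (expR (itvint c s q) * (M' * mu q)) * nf s) t) //.
- congr (_ + _); rewrite !Rintegral_oo; apply: eq_Rintegral => q _.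
  case: ifP => // qt; have [K' hK'] := adj_blip q.
  by rewrite (solution_duality hK' (mulr_ge0 M'0 (mu0 q)) (adj_le q) (@adj_supp q) (qT _ qt)).
- exact: blip_measurable phiL.
- move=> s x /andP[s0 st].
  rewrite (evol_integral ma mb mc mmu amu bmu cmu a_ge0 (ltW st) (imu s0 st tT') x tphi).
  by congr (_ + _); apply: eq_Rintegral => q _; rewrite evol_adj.
- by move=> s; apply: HK.
- move=> s q; have [K' hK'] := adj_blip q.
  exact: (source_evol_bound hK' (mulr_ge0 M'0 (mu0 q)) (adj_le q) (@adj_supp q)).
- under eq_integral do rewrite EFinM.
  rewrite ge0_integralZl; first by rewrite lte_mul_pinfty// ?lee_fin ?mulr_ge0// inf.
  + exact: measurable_ooitv.
  + by apply: measurable_funTS; exact/measurable_EFinP.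
  + by move=> s _; rewrite lee_fin.
  + by rewrite lee_fin mulr_ge0.
- by move=> s st; exact: int_weight_slice.
- exact: int_weight2.
Qed.

End weak.
End pairing.

Lemma solution_locally_integrable t (r : R) : 0 < t < T ->
  (\int[lam]_(s in `]0%R, t[) \int[lamd]_(x in eball r) `|solution s x|%:E < +oo)%E.
Proof.
move=> tT; have [t0 tT'] := andP tT.
have [K K0 HK] := lp_bound_finite_measure p1 (measurable_box r) (box_finite (d := d) r).
apply: (@le_lt_trans _ _ (\int[lam]_(s in `]0%R, t[) (K%:E * total_weight s))%E).
  apply: le_integral_ge0 => s; rewrite /= in_itv/= => /andP[s0 st].
    exact: integral_ge0.
  have sT : 0 < s < T by rewrite s0 (lt_trans st).
  rewrite -WE// -EFinM.
  apply: le_trans (HK _ _ (mst s) _ (lp_bound_solution sT)); last first.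
    by rewrite /W fine_ge0// total_weight_ge0.
  rewrite [leLHS]integral_mkcond [leRHS]integral_mkcond; apply: le_integral_ge0 => x _.
    by rewrite patchE; case: ifP.
  rewrite !patchE; case: (boolP (x \in eball r)) => [|_]; last by case: (x \in box r); rewrite ?lee_fin.
  by rewrite inE => /eball_box bx; rewrite mem_set.
rewrite ge0_integralZl.
- by rewrite lte_mul_pinfty// ?lee_fin// integral_total_weight.
- exact: measurable_ooitv.
- by apply: measurable_funTS; exact: measurable_total_weight.
- by move=> q _; exact: total_weight_ge0.
- by rewrite lee_fin.
Qed.

Lemma solution_Lp_norm t : 0 < t < T -> (Lp_norm p (solution t) <= total_weight t)%E.
Proof.
move=> tT; rewrite -WE//; apply: lp_bound_Lnorm => //; last exact: lp_bound_solution.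
by rewrite /W fine_ge0// total_weight_ge0.
Qed.

Lemma solution_weak_formulation phi t : test_function phi -> 0 < t < T ->
  [/\ (\int[lamd]_x `|(solution t x * phi x)%R|%:E < +oo)%E,
    (\int[lam]_(q in `]0%R, t[)
      \int[lamd]_x `|(solution q x * adjoint a b c q phi x)%R|%:E < +oo)%E &
    \int[lamd]_x (solution t x * phi x) =
    \int[lam]_(q in `]0, t[) \int[lamd]_x (solution q x * adjoint a b c q phi x) +
    \int[lam]_(s in `]0, t[) \int[lamd]_x (F s x * phi x)].
Proof.
move=> tphi tT.
have tk (k : @term d) : test_function (term_fun phi k) by exact: test_function_term.
have /fin_all_exists[L hL] (k : @term d) : exists L, blip L (term_fun phi k).
  have [L L0 pL] := test_function_partials_le 1 (tk k).
  by exists L; exact: (test_function_blip (n := 0)).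
have /fin_all_exists[r hr] (k : @term d) :
    exists r : R, 0 <= r /\ forall x, term_fun phi k x != 0 -> forall i, `|x ord0 i| <= r.
  by have [r r0 hr] := test_function_box (tk k); exists r; split => //; exact: ltW.
have L0 k : 0 <= L k by case: (hL k).
(* Sums over the finitely many terms serve as common bounds for the sizes and the supports. *)
have le_sum (f : @term d -> R) k : (forall k, 0 <= f k) -> f k <= \sum_j f j.
  by move=> f0; rewrite (bigD1 k) //= lerDl; apply: sumr_ge0 => j _; exact: f0.
have M0 : 0 <= \sum_k L k by by apply: sumr_ge0 => j _; exact: L0.
have tM k x : `|term_fun phi k x| <= \sum_j L j.
  by apply: le_trans (le_sum _ k L0); case: (hL k).
have supp k x : term_fun phi k x != 0 -> box (\sum_j r j) x.
  move=> kx i; rewrite in_itv/= -ler_norml.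
  by apply: le_trans ((hr k).2 _ kx i) (le_sum _ _ _) => j; exact: (hr j).1.
have [K K0 HK] := lp_bound_pairing (d := d) (\sum_j r j) p1.
split.
- apply: le_lt_trans (solution_pairing_bound HK M0 (tM (inr (inr ord0)))
    (supp (inr (inr ord0))) tT) (ltry _).
- exact: (solution_weak_bound K0 HK M0 hL tM supp tT).
- exact: (solution_weak K0 HK M0 tphi hL tM supp tT).
Qed.

Lemma measurable_solution_adjoint phi : test_function phi ->
  measurable_fun setT (fun z : measurableTypeR R * 'rV[R]_d =>
    solution z.1 z.2 * adjoint a b c z.1 phi z.2).
Proof.
move=> tphi; apply: measurable_funM; first exact: measurable_solution.
under eq_fun do rewrite adjoint_term; apply: measurable_sum => k; apply: measurable_funM.
  exact: (measurableT_comp (measurable_coef ma mb mc k) measurable_fst).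
have tk : test_function (term_fun phi k) by exact: test_function_term.
apply: (measurableT_comp _ measurable_snd); apply: continuous_measurable_rV.
exact: test_function_continuous.
Qed.

End borel_problem.

(** * Reduction to Borel data *)

Section borel_coefficients.
Context {R : realType}.
Local Notation lam := (@lebesgue_measure R).

Lemma ae_forall_fin dT (T : measurableType dT) (m : {measure set T -> \bar R}) (I : finType)
    (P : I -> T -> Prop) :
  (forall i, \forall x \ae m, P i x) -> \forall x \ae m, forall i, P i x.
Proof.
move=> aeP.
suff aes (s : seq I) : \forall x \ae m, forall i, i \in s -> P i x.
  by apply: filterS (aes (enum I)) => x h i; apply: h; rewrite mem_enum.
elim: s => [|i s IH]; first by apply: aeW => x i.
apply: filterS2 (aeP i) IH => x Pi Ps j; rewrite inE => /predU1P[->//|]; exact: Ps.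
Qed.

Lemma ae_and dT (T : measurableType dT) (m : {measure set T -> \bar R}) (P Q : T -> Prop) :
  (\forall x \ae m, P x) -> (\forall x \ae m, Q x) -> \forall x \ae m, P x /\ Q x.
Proof. by move=> aeP aeQ; apply: filterS2 aeP aeQ. Qed.

Lemma ae_imp dT (T : measurableType dT) (m : {measure set T -> \bar R}) (P Q : T -> Prop) :
  (forall x, P x -> Q x) -> (\forall x \ae m, P x) -> \forall x \ae m, Q x.
Proof. by move=> PQ; apply: filterS. Qed.

Lemma null_set_ae dT (T : measurableType dT) (m : {measure set T -> \bar R}) (Z : set T) :
  measurable Z -> m Z = 0 :> \bar R -> \forall x \ae m, ~ Z x.
Proof. by move=> mZ Z0; exists Z; split => // x /= /contrapT. Qed.

(** One set [G] serves the whole finite family, so all its members are set to 0 at the same points;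
    separate modifications could destroy an inequality that relates them. *)
Lemma borel_modification dT (T : measurableType dT) (m : {measure set T -> \bar R})
    (I : finType) (D : set T) (g : I -> T -> R) : measurable D ->
  (forall i, lebesgue_measurable_fun m D (g i)) ->
  exists G : set T, [/\ G `<=` D, forall i, measurable_fun setT (g i \_ G) &
    \forall x \ae m, D x -> G x].
Proof.
move=> mD mg.
have /fin_all_exists[Z hZ] i := lebesgue_measurable_fun_borel (mg i).
pose G := D `&` \bigcap_(i in [set: I]) (D `\` Z i).
have mG : measurable G.
  apply: measurableI => //; apply: fin_bigcap_measurable => [|i _]; first exact: finite_finset.
  by case: (hZ i).
exists G; split => [x []//|i|].
  apply/(measurable_restrictT _ mG); case: (hZ i) => _ _ mDZ; apply: measurable_funS => //.
  by move=> x [_ /(_ i)]; exact.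
have : \forall x \ae m, forall i, ~ Z i x.
  by apply: ae_forall_fin => i; case: (hZ i) => mZ Z0 _ _; exact: null_set_ae.
by apply: filterS => x nZ Dx; split => // i _; split.
Qed.

Lemma measurable_bigmaxr dT (T : measurableType dT) (I : finType) (f : I -> T -> R) :
  (forall i, measurable_fun setT (f i)) ->
  measurable_fun setT (fun x => \big[Num.max/0]_i f i x).
Proof.
move=> mf; elim: (index_enum I) => [|i s IH].
  by under eq_fun do rewrite big_nil; exact: measurable_cst.
by under eq_fun do rewrite big_cons; exact: measurable_maxr.
Qed.

Context {d : nat}.
Implicit Types (a : 'I_d -> 'I_d -> R -> R) (b : 'I_d -> R -> R) (c : R -> R).

Lemma mu_abc_dominates a b c r : [/\ forall i j, `|a i j r| <= mu_abc a b c r,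
  forall i, `|b i r| <= mu_abc a b c r & `|c r| <= mu_abc a b c r].
Proof.
have le_max (f : 'I_d -> R) i : f i <= \big[Num.max/0]_j f j by exact: le_bigmax.
have max0 (f : 'I_d -> R) : 0 <= \big[Num.max/0]_j f j by exact: bigmax_ge_id.
split => [i j|i|]; rewrite /mu_abc.
- rewrite -addrA; apply: ler_wpDr; first by rewrite addr_ge0.
  exact: le_trans (le_max (fun j => `|a i j r|) j) (le_max (fun i => \big[Num.max/0]_j `|a i j r|) i).
- apply: ler_wpDr => //; apply: ler_wpDl; first exact: max0.
  exact: (le_max (fun i => `|b i r|)).
- by apply: ler_wpDl => //; apply: addr_ge0; exact: max0.
Qed.

Lemma measurable_mu_abc a b c : (forall i j, measurable_fun setT (a i j)) ->
  (forall i, measurable_fun setT (b i)) -> measurable_fun setT c ->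
  measurable_fun setT (mu_abc a b c).
Proof.
move=> ma mb mc; apply: measurable_funD; last exact: measurableT_comp.
apply: measurable_funD.
  do 2 (apply: measurable_bigmaxr => ?); exact: measurableT_comp.
by apply: measurable_bigmaxr => i; exact: measurableT_comp.
Qed.

Lemma borel_coefficients a b c (T : R) :
  (forall i j, lebesgue_measurable_fun lam `]0, T[ (a i j)) ->
  (forall i, lebesgue_measurable_fun lam `]0, T[ (b i)) ->
  lebesgue_measurable_fun lam `]0, T[ c ->
  (forall (t : R) (xi : 'rV[R]_d), 0 < t < T ->
    0 <= \sum_i \sum_j a i j t * xi ord0 i * xi ord0 j) ->
  exists a' b' c',
  [/\ (forall i j, measurable_fun setT (a' i j)) /\ (forall i, measurable_fun setT (b' i)),
   measurable_fun setT c',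
   forall (t : R) (xi : 'rV[R]_d), 0 <= \sum_i \sum_j a' i j t * xi ord0 i * xi ord0 j &
   \forall r \ae lam, 0 < r < T ->
     [/\ forall i j, a i j r = a' i j r, forall i, b i r = b' i r & c r = c' r]].
Proof.
move=> ma mb mc a0.
pose g (k : ('I_d * 'I_d) + ('I_d + 'I_1)) : R -> R :=
  match k with inl ij => a ij.1 ij.2 | inr (inl i) => b i | inr (inr _) => c end.
have mg k : lebesgue_measurable_fun lam `]0, T[ (g k) by case: k => [ij|[i|_]] /=.
have [G [GD mG aeG]] := borel_modification (measurable_ooitv 0 T) mg.
exists (fun i j => a i j \_ G), (fun i => b i \_ G), (c \_ G); split.
- split => [i j|i]; first exact: (mG (inl (i, j))).
  exact: (mG (inr (inl i))).
- exact: (mG (inr (inr ord0))).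
(* On [G] the form is the original one; off [G] all coefficients vanish together and the form is
   0. *)
- move=> t xi; have [tG|tG] := boolP (t \in G).
    under eq_bigr do under eq_bigr do rewrite patchE tG.
    by apply: a0; move: tG; rewrite inE => /GD; rewrite /= in_itv.
  by rewrite big1// => i _; rewrite big1// => j _; rewrite patchE (negbTE tG) !mul0r.
- apply: filterS aeG => r Gr r0T.
  have rG : r \in G by rewrite inE; apply: Gr; rewrite /= in_itv.
  by split => *; rewrite patchE rG.
Qed.

End borel_coefficients.

Section borel_source.
Context {R : realType} {d : nat}.
Local Notation lam := (@lebesgue_measure R).
Local Notation lamd := (@lebesgue_rV R d).

Lemma product_null_xsection (Z : set (measurableTypeR R * 'rV[R]_d)) :
  measurable Z -> (lam \x lamd)%E Z = 0%E -> \forall s \ae lam, lamd (xsection Z s) = 0%E.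
Proof.
move=> mZ Z0.
have mx : measurable_fun setT (lamd \o xsection Z) by exact: measurable_fun_xsection.
have : (\int[lam]_s `|(lamd \o xsection Z) s| = 0)%E.
  rewrite -[RHS]Z0; apply: eq_integral => s _ /=; exact: gee0_abs.
by move=> /(ae_eq_integral_abs lam measurableT mx); apply: filterS => s; exact.
Qed.

(** For [p = +oo] the essential supremum exceeds [y] exactly when the section of the set where
    [|f| > y] has nonzero measure, a measurable condition on [s]. *)
Lemma measurable_Lp_norm (p : \bar R) (f : measurableTypeR R * 'rV[R]_d -> R) : (1 <= p)%E ->
  measurable_fun setT f -> measurable_fun setT (fun s => Lp_norm p (fun x => f (s, x))).
Proof.
move=> p1 mf; rewrite /Lp_norm unlock.
case: p p1 => [r| |] // p1.
  apply: (measurableT_comp (measurable_poweR _)).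
  apply: (measurable_fun_fubini_tonelli_F (fun z => (`|f z| `^ r)%:E)).
    apply/measurable_EFinP; apply: (measurableT_comp (measurable_powR _)).
    exact: measurableT_comp.
  by move=> z; rewrite lee_fin powR_ge0.
case: (0 < lamd setT)%E; last exact: measurable_cst.
apply: (measurability _ (ErealGenOInfty.measurableE R)) => // _ [_ [y ->] <-].
rewrite setTI.
pose Z := [set z : measurableTypeR R * 'rV[R]_d | (y < `|f z|)%R].
have mZ : measurable Z.
  have mn : measurable_fun setT (fun z => `|f z|)%R by exact: measurableT_comp.
  have := measurable_fun_ltr (measurable_cst y) mn.
  by move=> /(_ measurableT [set true] I); rewrite setTI.
have mx : measurable_fun setT (lamd \o xsection Z) by exact: measurable_fun_xsection.
rewrite (_ : _ @^-1` _ = (lamd \o xsection Z) @^-1` (~` [set 0%E])); last first.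
  apply/seteqP; split => s /=; rewrite in_itv/= andbT.
    rewrite ltNge => /negP; apply: contra_not => Z0; apply/ess_supP.
    exists (xsection Z s); split => //; first exact: measurable_xsection.
    move=> x /= /negP; rewrite /xsection/= inE /Z/= -ltNge lte_fin; exact.
  apply: contra_notT; rewrite -leNgt => /ess_supP [N [mN N0 sN]].
  apply/eqP; rewrite -measure_le0 -N0; apply: le_measure; rewrite ?inE//.
    exact: measurable_xsection.
  apply: subset_trans sN => x; rewrite /xsection/= inE /Z/= => yx.
  by apply/negP; rewrite -ltNge lte_fin.
rewrite -[X in measurable X]setTI; apply: (mx measurableT).
by apply: measurableC; exact: emeasurable_set1.
Qed.

(** Integrability is known only on intervals ending before [T], so []0, T[] is exhausted by the
    intervals up to [T - 1 / (n + 1)]. *)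
Lemma ae_finite_integral (N : R -> \bar R) (T : R) :
  measurable_fun setT (N : measurableTypeR R -> \bar R) -> (forall s, 0 <= N s)%E ->
  (forall t, 0 < t < T -> (\int[lam]_(s in `]0%R, t[) N s < +oo)%E) ->
  \forall s \ae lam, 0 < s < T -> (N s < +oo)%E.
Proof.
move=> mN N0 iN.
have h n : \forall s \ae lam, 0 < s < T - n.+1%:R^-1 -> (N s < +oo)%E.
  have [T0|T0] := leP (T - n.+1%:R^-1) 0.
    by apply: aeW => s /andP[s0 /lt_le_trans/(_ T0)/(lt_trans s0)]; rewrite ltxx.
  have iNt : lam.-integrable `]0, T - n.+1%:R^-1[ N.
    apply/integrableP; split; first exact: measurable_funTS.
    under eq_integral do rewrite gee0_abs//; apply: iN.
    by rewrite T0 /= gtrBl invr_gt0.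
  have := integrable_ae (measurable_ooitv _ _) iNt.
  apply: filterS => s + st; rewrite -ge0_fin_numE//; apply.
  by rewrite /= in_itv.
apply: filterS (ae_foralln h) => s {}h /andP[s0 sT].
have [n hn] := ltr_add_invr sT; apply: (h n).
by rewrite s0 ltrBrDr.
Qed.

Lemma Lp_norm_lp_bound (p : \bar R) (g : 'rV[R]_d -> R) N : (1 <= p)%E -> p != +oo%E ->
  Lp_norm p g = N%:E -> lp_bound lamd p g N.
Proof.
case: p => [r| |] // p1 _ gN; rewrite /lp_bound -poweR_EFin -gN.
have rn0 : r != 0 by rewrite gt_eqF// (lt_le_trans ltr01)// -lee_fin.
by rewrite /Lp_norm poweR_Lnorm.
Qed.

Lemma ae_le_Linf (g : 'rV[R]_d -> R) M : (Lp_norm +oo%E g <= M%:E)%E ->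
  \forall x \ae lamd, `|g x| <= M.
Proof.
rewrite /Lp_norm unlock; case: ifPn => [_ /ess_supP|mu0 _].
  by apply: ae_imp => x /=; rewrite lee_fin.
exists setT; split => //; apply/eqP; rewrite -measure_le0 leNgt; exact: mu0.
Qed.

(** The slices of [F] are controlled at every [s], which frees the Borel problem from exceptional
    times; the original slices and their norms are recovered at almost every [s]. *)
Lemma borel_source (p : \bar R) (f : R -> 'rV[R]_d -> R) (T : R) : (1 <= p)%E ->
  lebesgue_measurable_fun (lam \x lamd)%E (`[0, T[ `*` setT) (fun z => f z.1 z.2) ->
  (forall t, 0 < t < T -> (\int[lam]_(s in `]0%R, t[) Lp_norm p (f s) < +oo)%E) ->
  exists (F : R -> 'rV[R]_d -> R) (nf : R -> R),
  [/\ measurable_fun setT (fun z : measurableTypeR R * 'rV[R]_d => F z.1 z.2),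
   measurable_fun setT nf /\ (forall s, 0 <= nf s),
   forall s, nf s = 0 -> forall x, F s x = 0,
   forall s, lp_bound lamd p (F s) (nf s) &
   \forall s \ae lam, 0 < s < T ->
     (\forall x \ae lamd, f s x = F s x) /\ Lp_norm p (f s) = (nf s)%:E].
Proof.
move=> p1 mf fin_f.
have p0 : (0 < p)%E by exact: lt_le_trans p1.
have [Z [mZ Z0 mDZ mfDZ]] := lebesgue_measurable_fun_borel mf.
set D := (`[0, T[ `*` setT) `\` Z in mDZ mfDZ.
pose f1 : measurableTypeR R * 'rV[R]_d -> R := (fun z => f z.1 z.2) \_ D.
have mf1 : measurable_fun setT f1 by exact/(measurable_restrictT _ mDZ).
pose N (s : R) : \bar R := Lp_norm p (fun x => f1 (s, x)).
have mN : measurable_fun setT (N : measurableTypeR R -> \bar R) by exact: measurable_Lp_norm.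
have N0 s : (0 <= N s)%E by exact: Lnorm_ge0.
have ff1 : \forall s \ae lam, 0 < s < T -> \forall x \ae lamd, f s x = f1 (s, x).
  move: (product_null_xsection mZ Z0); apply: ae_imp => s Zs /andP[s0 sT].
  exists (xsection Z s); split => //; first exact: measurable_xsection.
  move=> x /= fx; rewrite /xsection/= inE; apply: contrapT => nZ; apply: fx.
  rewrite /f1 patchE mem_set//; split => //; split => //=.
  by rewrite in_itv/= (ltW s0).
have fN : \forall s \ae lam, 0 < s < T -> Lp_norm p (f s) = N s.
  move: ff1; apply: ae_imp => s h /h fs; apply: Lnorm_eq_ae.
  by move: fs; apply: ae_imp => x /= ->.
have finN : \forall s \ae lam, 0 < s < T -> (N s < +oo)%E.
  apply: (ae_finite_integral mN N0) => t tT.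
  apply: le_lt_trans (fin_f t tT); rewrite le_eqVlt; apply/orP; left; apply/eqP.
  apply: integral_eq_ae; move: fN; apply: ae_imp => s h; rewrite /= in_itv/= => /andP[s0 st].
  by rewrite h// s0 (lt_trans st)//; case/andP: tT.
pose nf s := fine (N s).
(* The source is cut off on null sets only, so that [lp_bound] holds for every [s], and
   so that it vanishes wherever its norm does. *)
pose keep s x := (nf s != 0) && ((p == +oo%E) ==> (`|f1 (s, x)| <= nf s)).
pose F s x := if keep s x then f1 (s, x) else 0.
have mnf : measurable_fun setT nf by exact: measurableT_comp.
have nf0 s : 0 <= nf s by exact: fine_ge0.
exists F, nf; split=> //.
- apply: measurable_fun_ifT => //; last by under eq_fun do rewrite -surjective_pairing.
  have mnf1 : measurable_fun setT (fun z : measurableTypeR R * 'rV[R]_d => nf z.1).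
    exact: (measurableT_comp mnf measurable_fst).
  apply: measurable_and.
    by apply: measurable_neg; apply: measurable_fun_eqr.
  have mle : measurable_fun setT
      (fun z : measurableTypeR R * 'rV[R]_d => `|f1 (z.1, z.2)| <= nf z.1).
    apply: measurable_fun_ler => //; under eq_fun do rewrite -surjective_pairing.
    exact: measurableT_comp.
  by case: (p == +oo%E) => //=; exact: measurable_cst.
- by move=> s nfs x; rewrite /F /keep nfs eqxx.
- move=> s; have [nfs|nfs] := eqVneq (nf s) 0.
    rewrite nfs (_ : F s = fun=> 0); first exact: lp_bound0.
    by apply/funext => x; rewrite /F /keep nfs eqxx.
  (* [fine] sends [+oo] to 0, so a nonzero [nf s] is the true norm; slices of infinite norm were
     replaced by 0. *)
  have Nfin : N s = (nf s)%:E.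
    by rewrite /nf in nfs *; case: (N s) (N0 s) nfs => [r| |] //=; rewrite eqxx.
  have [poo|poo] := eqVneq p +oo%E.
    rewrite poo => x; rewrite /F /keep poo eqxx /=.
    by case: ifP => [/andP[]//|_]; rewrite normr0.
  rewrite (_ : F s = fun x => f1 (s, x)); first exact: (Lp_norm_lp_bound p1 poo Nfin).
  by apply/funext => x; rewrite /F /keep nfs (negbTE poo).
- move: (ae_and ff1 (ae_and fN finN)); apply: ae_imp => s [h1 [h2 h3]] sT.
  have Nfin : N s = (nf s)%:E by rewrite /nf fineK// ge0_fin_numE// h3.
  split; last by rewrite h2.
  have f1F : \forall x \ae lamd, f1 (s, x) = F s x.
    have [nfs|nfs] := eqVneq (nf s) 0.
      have mf1s : measurable_fun setT (EFin \o (fun x => f1 (s, x))).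
        by apply/measurable_EFinP; exact: measurable_fun_pair2.
      have Ns0 : N s = 0%E by rewrite Nfin nfs.
      move: (Lnorm_eq0_eq0 mf1s p0 Ns0); apply: ae_imp => x h.
      have E : (f1 (s, x))%:E = 0%:E := h I.
      case: E => ->.
      by rewrite /F /keep nfs eqxx.
    have [poo|poo] := eqVneq p +oo%E; last first.
      by apply: aeW => x; rewrite /F /keep nfs (negbTE poo).
    have : (N s <= (nf s)%:E)%E by rewrite Nfin.
    rewrite /N poo => /ae_le_Linf; apply: ae_imp => x le_x.
    by rewrite /F /keep nfs poo eqxx le_x.
  by move: (ae_and (h1 sT) f1F); apply: ae_imp => x [-> ->].
Qed.

End borel_source.

Theorem theorem2p7 (R : realType) (d : nat) (hd : (0 < d)%N)
    (T : R) (hT : 0 < T)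
    (a : 'I_d -> 'I_d -> R -> R) (b : 'I_d -> R -> R) (c : R -> R)
    (ma : forall i j, lebesgue_measurable_fun lebesgue_measure `]0, T[ (a i j))
    (mb : forall i, lebesgue_measurable_fun lebesgue_measure `]0, T[ (b i))
    (mc : lebesgue_measurable_fun lebesgue_measure `]0, T[ c)
    (f : R -> 'rV[R]_d -> R) (hf : locally_integrable_cyl T f)
    (p : \bar R) (hp : (1 <= p)%E)
    (ha : forall (t : R) (xi : 'rV[R]_d), 0 < t < T ->
      0 <= \sum_(i < d) \sum_(j < d) a i j t * xi ord0 i * xi ord0 j)
    (habc : forall s t : R, 0 < s -> s < t -> t < T ->
      (\int[lebesgue_measure]_(r in `]s, t[) (mu_abc a b c r)%:E < +oo)%E)
    (hi : forall s t : R, 0 < s -> s < t -> t < T ->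
      (\int[lebesgue_measure]_(r in `]s, t[)
         (exp_int c s r * max_a a r)%:E < +oo)%E)
    (hii : forall t : R, 0 < t < T ->
      (\int[lebesgue_measure]_(s in `]0%R, t[)
         ((exp_int (fun r => `|c r|%R) s t)%:E * Lp_norm p (f s)) < +oo)%E)
    (hiii : forall T' : R, 0 < T' < T ->
      (\int[lebesgue_measure]_(t in `]0%R, T'[)
         ((mu_abc a b c t)%:E *
          \int[lebesgue_measure]_(s in `]0%R, t[)
            ((exp_int c s t)%:E * Lp_norm p (f s))) < +oo)%E) :
  exists u : R -> 'rV[R]_d -> R,
    weak_solution T a b c f u /\
    forall t : R, 0 < t < T ->
      (Lp_norm p (u t) <=
         \int[lebesgue_measure]_(s in `]0%R, t[)
           ((exp_int c s t)%:E * Lp_norm p (f s)))%E /\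
      (\int[lebesgue_measure]_(s in `]0%R, t[)
           ((mu_abc a b c s)%:E * Lp_norm p (u s)) <=
         \int[lebesgue_measure]_(s in `]0%R, t[)
           ((mu_abc a b c s)%:E *
            \int[lebesgue_measure]_(r in `]0%R, s[)
              ((exp_int c r s)%:E * Lp_norm p (f r))))%E.
Proof.
have [a' [b' [c' [[ma' mb'] mc' ha' aeabc]]]] := borel_coefficients ma mb mc ha.
(* The exponential of the integral of [|c|] is at least 1. *)
have finf t : 0 < t < T ->
    (\int[lebesgue_measure]_(s in `]0%R, t[) Lp_norm p (f s) < +oo)%E.
  move=> tT; apply: le_lt_trans (hii t tT); apply: le_integral_ge0 => s _.
    exact: Lnorm_ge0.
  rewrite -[leLHS]mul1e; apply: lee_wpmul2r; first exact: Lnorm_ge0.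
  by rewrite lee_fin /exp_int -expR0 ler_expR Rintegral_ge0.
have [F [nf [mF [mnf nf0] nfF Fnf aef]]] := borel_source hp hf.1 finf.
pose mu' := mu_abc a' b' c'.
have mmu' : measurable_fun setT mu' by exact: measurable_mu_abc.
have amu i j r : `|a' i j r| <= mu' r by case: (mu_abc_dominates a' b' c' r).
have bmu i r : `|b' i r| <= mu' r by case: (mu_abc_dominates a' b' c' r).
have cmu r : `|c' r| <= mu' r by case: (mu_abc_dominates a' b' c' r).
have mu0 r : 0 <= mu' r by exact: le_trans (normr_ge0 _) (cmu r).
have mu_ge0 r : 0 <= mu_abc a b c r.
  by case: (mu_abc_dominates a b c r) => _ _; apply: le_trans.
have muE r : [/\ forall i j, a i j r = a' i j r, forall i, b i r = b' i r & c r = c' r] ->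
    mu_abc a b c r = mu' r.
  case=> Ea Eb Ec; rewrite /mu' /mu_abc /max_a Ec; congr (_ + _ + _).
    by apply: eq_bigr => i _; apply: eq_bigr => j _; rewrite Ea.
  by apply: eq_bigr => i _; rewrite Eb.
have cE s t : 0 <= s -> t <= T -> exp_int c s t = expR (itvint c' s t).
  move=> s0 tT; congr expR; apply: Rintegral_eq_ae; move: aeabc; apply: ae_imp => r h.
  rewrite /= in_itv/= => /andP[sr rt].
  have rT : 0 < r < T by rewrite (le_lt_trans s0 sr) (lt_le_trans rt tT).
  by case: (h rT).
have absE s t : 0 <= s -> t <= T ->
    exp_int (fun r => `|c r|) s t = expR (itvint (fun r => `|c' r|) s t).
  move=> s0 tT; congr expR; apply: Rintegral_eq_ae; move: aeabc; apply: ae_imp => r h.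
  rewrite /= in_itv/= => /andP[sr rt].
  have rT : 0 < r < T by rewrite (le_lt_trans s0 sr) (lt_le_trans rt tT).
  by case: (h rT) => _ _ ->.
have sub0t s t : 0 < t < T -> `]0, t[%classic s -> 0 < s < T.
  by move=> /andP[_ tT]; rewrite /= in_itv/= => /andP[-> /lt_trans]; exact.
have WE t : 0 < t < T -> (\int[lebesgue_measure]_(s in `]0%R, t[)
    ((exp_int c s t)%:E * Lp_norm p (f s)) = total_weight c' nf t)%E.
  move=> tT; apply: integral_eq_ae; move: aef; apply: ae_imp => s h s0t.
  have sT := sub0t _ _ tT s0t; have [_ ->] := h sT.
  have [s0 _] := andP sT; have [_ t1] := andP tT.
  by rewrite cE ?(ltW s0) ?(ltW t1).
have imu s t : 0 < s -> s < t -> t < T ->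
    lebesgue_measure.-integrable `]s, t[ (EFin \o mu').
  move=> s0 st tT; apply/integrableP; split.
    by apply/measurable_EFinP; exact: measurable_funS mmu'.
  apply: le_lt_trans (habc s t s0 st tT); rewrite le_eqVlt; apply/orP; left; apply/eqP.
  apply: integral_eq_ae; move: aeabc; apply: ae_imp => r h.
  rewrite /= in_itv/= => /andP[sr rt]; rewrite ger0_norm//.
  by rewrite muE//; apply: h; rewrite (lt_trans s0 sr) (lt_trans rt tT).
have iabs t : 0 < t < T -> (\int[lebesgue_measure]_(s in `]0%R, t[)
    (expR (itvint (fun r => `|c' r|) s t) * nf s)%:E < +oo)%E.
  move=> tT; apply: le_lt_trans (hii t tT); rewrite le_eqVlt; apply/orP; left; apply/eqP.
  apply: integral_eq_ae; move: aef; apply: ae_imp => s h s0t.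
  have sT := sub0t _ _ tT s0t; have [_ ->] := h sT.
  have [s0 _] := andP sT; have [_ t1] := andP tT.
  by rewrite absE ?(ltW s0) ?(ltW t1).
have imuW t : 0 < t < T -> (\int[lebesgue_measure]_(s in `]0%R, t[)
    ((mu' s)%:E * total_weight c' nf s) < +oo)%E.
  move=> tT; apply: le_lt_trans (hiii t tT); rewrite le_eqVlt; apply/orP; left; apply/eqP.
  apply: integral_eq_ae; move: aeabc; apply: ae_imp => s h s0t.
  have sT := sub0t _ _ tT s0t.
  by rewrite WE// muE//; exact: h.
pose u := solution a' b' c' F.
have uLp t : 0 < t < T -> (Lp_norm p (u t) <= \int[lebesgue_measure]_(s in `]0%R, t[)
    ((exp_int c s t)%:E * Lp_norm p (f s)))%E.
  by move=> tT; rewrite WE//; apply: (solution_Lp_norm ma' mb' mc' cmu hp mF mnf nf0 nfF Fnf imu iabs).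
have mu_solution : measurable_fun setT (fun z : measurableTypeR R * 'rV[R]_d => u z.1 z.2).
  exact: measurable_solution.
(* The second estimate is the first one multiplied by mu and integrated in time. *)
exists u; split; last first.
  move=> t tT; split; first exact: uLp.
  apply: le_integral_ge0 => s s0t.
    by rewrite mule_ge0 ?lee_fin ?Lnorm_ge0.
  by rewrite lee_wpmul2l ?lee_fin// uLp//; exact: sub0t tT s0t.
split; [|exact: hf|].
  split.
    apply: (@lebesgue_measurable_funP _ (measurableTypeR R * 'rV[R]_d)%type R _ _ _
      (fun z => u z.1 z.2)).
    - by apply: measurableX => //; exact: measurable_itv.
    - exact: measurable_funS mu_solution.
    - exact: aeW.
  move=> t r tT r0.
  exact: (solution_locally_integrable ma' mb' mc' cmu hp mF mnf nf0 nfF Fnf imu iabs).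
move=> phi tphi t tT.
have [w1 w2 w3] := solution_weak_formulation ma' mb' mc' mmu' amu bmu cmu ha'
  hp mF mnf nf0 nfF Fnf imu iabs imuW tphi tT.
(* The original and the Borel adjoint operators agree only for almost every [s], which is all that
   the integrals in time detect. *)
have pairE : \forall s \ae lebesgue_measure, `]0, t[%classic s ->
    pairing (u s) (adjoint a b c s phi) =
    \int[lebesgue_rV d]_x (u s x * adjoint a' b' c' s phi x).
  move: aeabc; apply: ae_imp => s h s0t.
  have [Ea Eb Ec] := h (sub0t _ _ tT s0t).
  apply: eq_Rintegral => x _; congr (_ * _); rewrite /adjoint Ec; congr (_ - _ + _).
    by apply: eq_bigr => i _; apply: eq_bigr => j _; rewrite Ea.
  by apply: eq_bigr => i _; rewrite Eb.
have madj := measurable_solution_adjoint ma' mb' mc' mF tphi.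
have mpair := @measurable_Rintegral_param _ _ _ _ _ (lebesgue_rV d) _ madj.
split.
- split=> //.
  apply: (@lebesgue_measurable_funP _ _ _ _ _ _ (fun x => u t x * phi x)).
  + exact: measurableT.
  + apply: measurable_funM; first exact: (measurable_fun_pair2 t mu_solution).
    by apply: continuous_measurable_rV; exact: test_function_continuous.
  + exact: aeW.
- split.
    apply: (lebesgue_measurable_funP _ _ pairE); first exact: measurable_ooitv.
    exact: measurable_funS mpair.
  apply: le_lt_trans w2.
  rewrite (@integral_eq_ae _ _ _ lebesgue_measure _ _ (fun s =>
    `|(\int[lebesgue_rV d]_x (u s x * adjoint a' b' c' s phi x))%R|%:E)); last first.
    by move: pairE; apply: ae_imp => s h s0t; rewrite h.
  apply: le_integral_ge0 => s _ //; apply: norm_Rintegral_le.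
  exact: (measurable_fun_pair2 s madj).
- have E1 := Rintegral_eq_ae pairE.
  have E2 : \int[lebesgue_measure]_(s in `]0, t[) pairing (f s) phi =
      \int[lebesgue_measure]_(s in `]0, t[) \int[lebesgue_rV d]_x (F s x * phi x).
    apply: Rintegral_eq_ae; move: aef; apply: ae_imp => s h s0t.
    apply: Rintegral_eq_ae; move: (h (sub0t _ _ tT s0t)).1.
    by apply: ae_imp => x -> _.
  exact: (etrans w3 (f_equal2 +%R (esym E1) (esym E2))).
Qed.
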